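(* Let $\Omega\subseteq\mathbb{C}$ be a compact infinite set such that $\Omega^c$ is a simply connected domain in $\widehat{\mathbb{C}}$, with exterior Riemann map $\mathcal{R}_\Omega$ and $d_1=\mathcal{R}_\Omega'(\infty)>0$. Let $P_n(z)=\sum_{j=0}^n p_jz^j$ be a polynomial of degree $n\ge1$ and $E=P_n^{-1}(\Omega)$, with components $E_1,\ldots,E_\ell$. Let $\Phi:E^c\to L^c$ be the Walsh map of $E$ and $a_1,\ldots,a_\ell$ the centers of $L$. For $j=1,\ldots,\ell$ let $n_j$ be the number of zeros (with multiplicity) of $P_n(z)-\omega$ in $E_j$, which is the same for all $\omega\in\Omega$, and set $$Q(w)=d_1p_n\prod_{j=1}^\ell(w-a_j)^{n_j}.$$ Then $$Q(\Phi(z))=\mathcal{R}_\Omega(P_n(z)),\qquad z\in E^c,$$ that is, $\Phi=Q^{-1}\circ\mathcal{R}_\Omega\circ P_n$, with that branch of $Q^{-1}$ such that $\Phi(z)=z+\mathcal{O}(1/z)$ at $\infty$. Moreover, for $n\ge2$, $$\sum_{j=1}^\ell n_ja_j=-\frac{p_{n-1}}{p_n}.$$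
   Context: $\widehat{\mathbb{C}}=\mathbb{C}\cup\{\infty\}$, $K^c=\widehat{\mathbb{C}}\setminus K$, $\mathbb{D}$ is the open unit disk. A compact set $K\subseteq\mathbb{C}$ is called simply connected if $K$ and $K^c$ are both connected. $\operatorname{cap}(K)$ is the logarithmic capacity. The exterior Riemann map of $\Omega$ is the conformal map $\mathcal{R}_\Omega:\Omega^c\to\overline{\mathbb{D}}^c$ with $\mathcal{R}_\Omega(z)=d_1z+d_0+\sum_{k\ge1}d_{-k}z^{-k}$ near $\infty$ and $d_1=\mathcal{R}_\Omega'(\infty)=1/\operatorname{cap}(\Omega)>0$. The preimage $E=P_n^{-1}(\Omega)=\{z\in\mathbb{C}:P_n(z)\in\Omega\}$ is compact with finitely many components, each of which is an infinite simply connected compact set. Walsh's theorem (known): if $E_1,\ldots,E_\ell\subseteq\mathbb{C}$ are disjoint simply connected, infinite compact sets and $E=\bigcup_j E_j$, then there exist a unique compact set of the form $L=\{w\in\mathbb{C}:|U(w)|\le\operatorname{cap}(E)\}$, $|U(w)|=\prod_{j=1}^\ell|w-a_j|^{m_j}$, with distinct $a_1,\ldots,a_\ell\in\mathbb{C}$ (centers) and real $m_1,\ldots,m_\ell>0$ (exponents), $\sum_{j=1}^\ell m_j=1$, and a unique conformal (i.e. bijective holomorphic) map $\Phi:E^c\to L^c$ with $\Phi(z)=z+\mathcal{O}(1/z)$ at $\infty$ (the Walsh map). The $a_j$ and $m_j$ are uniquely determined. $L$ has $\ell$ disjoint compact components $L_1,\ldots,L_\ell$ with $a_j\in L_j$,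 labeled such that a Jordan curve in $\mathbb{C}\setminus E$ surrounding $E_j$ (and no other $E_k$) is mapped by $\Phi$ onto a Jordan curve surrounding $L_j$ (and no other $L_k$). *)

(* Defs.v *)
From HB Require Import structures.
From mathcomp Require Import all_boot all_order all_algebra.
From mathcomp Require Import all_classical all_reals all_analysis.
From mathcomp Require Import complex.

Set Implicit Arguments.
Unset Strict Implicit.
Unset Printing Implicit Defensive.

Import Order.TTheory GRing.Theory Num.Theory.
Import numFieldNormedType.Exports.
Import ComplexField.Normc.

Local Open Scope classical_set_scope.
Local Open Scope ring_scope.
Local Open Scope complex_scope.

(* MathComp-Analysis puts its topology on an abstract numFieldType or on K^o;
   the concrete field R[i] gets that same structure here.  Note that the library
   norm `|z| of z : R[i] lives in R[i]; the R-valued modulus is normc z. *)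
HB.instance Definition _ (R : realType) := NormedModule.copy R[i] R[i]^o.

(* The Riemann sphere; None is the point at infinity. *)
Notation sphere R := (one_point_compactification R[i]).

Section RiemannSphere.
Variable R : realType.
Local Notation C := R[i].

Definition fin (z : C) : sphere R := Some z.
Definition infty : sphere R := None.

(* K^c = sphere \ K, for K a subset of the plane. *)
Definition sphere_compl (K : set C) : set (sphere R) := ~` (fin @` K).

(* z |-> 1/z, exchanging 0 and infinity *)
Definition sphere_inv (x : sphere R) : sphere R :=
  if x is Some z then (if z == 0 then infty else fin z^-1) else fin 0.

(* The junk value at infinity is harmless below: near the base point, the
   functions read through this projection take finite values. *)
Definition finite_part (x : sphere R) : C := if x is Some z then z else 0.

(* Holomorphy between Riemann surfaces: f is continuous at x and is complex
   differentiable at x when read in the charts z and 1/z, the latter being used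
   in the source if x is infinity and in the target if f x is infinity. *)
Definition holomorphic_at (f : sphere R -> sphere R) (x : sphere R) : Prop :=
  let g := if x is Some _ then f else f \o sphere_inv in
  let h := if f x is Some _ then g else sphere_inv \o g in
  {for x, continuous f} /\
  derivable (fun z : C => finite_part (h (fin z))) (finite_part x) 1.

Definition holomorphic_on (D : set (sphere R)) (f : sphere R -> sphere R) :=
  forall x, D x -> holomorphic_at f x.

(* For open D, only the values of f on D matter. *)
Definition conformal (D D' : set (sphere R)) (f : sphere R -> sphere R) :=
  holomorphic_on D f /\ set_bij D D' f.

(* f(z) = z + O(1/z) at infinity *)
Definition normalized_at_infty (f : sphere R -> sphere R) : Prop :=
  exists M r : R, forall z : C, r < normc z ->
    exists2 w : C, f (fin z) = fin w & normc (w - z) <= M / normc z.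

Definition poly_sphere (p : {poly C}) (x : sphere R) : sphere R :=
  if x is Some z then fin p.[z]
  else if (1 < size p)%N then infty else fin p`_0.

End RiemannSphere.

Arguments infty {R}.

Section Topology.
Variables (R : realType) (T : topologicalType).

Definition loop_in (D : set T) (g : R -> T) :=
  [/\ {within `[0, 1], continuous g}, g @` `[0, 1] `<=` D & g 0 = g 1].

Definition null_homotopic_in (D : set T) (g : R -> T) :=
  exists H : R * R -> T,
    [/\ {within `[0, 1] `*` `[0, 1], continuous H},
        H @` (`[0, 1] `*` `[0, 1]) `<=` D,
        forall t, 0 <= t <= 1 -> H (0, t) = g t /\ H (1, t) = g 0 &
        forall s, 0 <= s <= 1 -> H (s, 0) = g 0 /\ H (s, 1) = g 0].

(* E_ lists the connected components of E without repetition. *)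
Definition enumerates_components (l : nat) (E : set T) (E_ : 'I_l -> set T) :=
  injective E_ /\ range E_ = [set connected_component E x | x in E].

End Topology.

Definition simply_connected_domain (R : realType) (D : set (sphere R)) :=
  [/\ open D, D !=set0, connected D &
      forall g : R -> sphere R, loop_in D g -> null_homotopic_in D g].

Section Jordan.
Variable R : realType.
Local Notation C := R[i].

Definition jordan_curve (G : set C) :=
  exists g : R -> C,
    [/\ {within `[0, 1], continuous g}, {in `[0, 1[ &, injective g},
        g 0 = g 1 & G = g @` `[0, 1]].

Definition jordan_interior (G : set C) : set C :=
  [set z | ~ G z /\ bounded_set (connected_component (~` G) z)].

Definition surrounds_only (l : nat) (G : set C) (E_ : 'I_l -> set C) (j : 'I_l) :=
  forall k, E_ k `<=` jordan_interior G <-> k = j.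

(* The image of a plane set under f, as a plane set. *)
Definition plane_image (f : sphere R -> sphere R) (G : set C) : set C :=
  [set w | exists2 z, G z & f (fin z) = fin w].

End Jordan.

Section Capacity.
Variable R : realType.
Local Notation C := R[i].

Definition borelC := g_sigma_algebraType (@open C).

(* log (1/|z - w|); the diagonal is separate because ln 0 = 0 in the library. *)
Definition log_kernel (z w : C) : \bar R :=
  if z == w then +oo%E else (- ln (normc (z - w)))%:E.

Definition log_energy (mu : probability borelC R) : \bar R :=
  (\int[mu]_z \int[mu]_w log_kernel z w)%E.

(* cap(K) = exp(- inf I(mu)), mu ranging over the Borel probability measures
   carried by the compact set K. *)
Definition log_capacity (K : set C) : R :=
  fine (expeR (- ereal_inf
    [set log_energy mu | mu in [set mu : probability borelC R | mu K = 1%E]])).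

End Capacity.

Section WalshMap.
Variable R : realType.
Local Notation C := R[i].

(* R_Omega : Omega^c -> (closed unit disk)^c, with
   R_Omega(z) = d1 z + d_0 + \sum_(k >= 1) d_(-k) z^(-k) near infinity; the
   coefficient d_(-k) is d k. *)
Record is_exterior_riemann_map (Omega : set C) (d1 : R)
    (f : sphere R -> sphere R) : Prop := {
  exterior_riemann_conformal :
    conformal (sphere_compl Omega) (sphere_compl [set w : C | normc w <= 1]) f;
  exterior_riemann_gt0 : 0 < d1;
  exterior_riemann_expansion : exists (d : nat -> C) (r : R),
    forall z : C, r < normc z -> exists2 w : C, f (fin z) = fin w &
      series (fun k => d k / z ^+ k) @ \oo --> w - d1%:C * z }.

(* {w : |U(w)| <= c}, |U(w)| = \prod_j |w - a_j|^(m_j) *)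
Definition lemniscatic_set (l : nat) (a : 'I_l -> C) (m : 'I_l -> R) (c : R) :
  set C := [set w | \prod_(j < l) (normc (w - a j) `^ m j) <= c].

Definition walsh_set (l : nat) (E : set C) (a : 'I_l -> C) (m : 'I_l -> R) :
  set C := lemniscatic_set a m (log_capacity E).

Definition walsh_component (l : nat) (E : set C) (a : 'I_l -> C)
    (m : 'I_l -> R) (j : 'I_l) : set C :=
  connected_component (walsh_set E a m) (a j).

(* Phi is the Walsh map of E, a set with components E_ j; the canonical set L
   has centers a j and exponents m j, and its component L_j is the one
   containing a j. *)
Record is_walsh_map (l : nat) (E : set C) (E_ : 'I_l -> set C)
    (a : 'I_l -> C) (m : 'I_l -> R) (Phi : sphere R -> sphere R) : Prop := {
  walsh_centers : injective a;
  walsh_exponents_gt0 : forall j, 0 < m j;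
  walsh_exponents_sum : \sum_(j < l) m j = 1;
  walsh_conformal : conformal
    (sphere_compl E) (sphere_compl (walsh_set E a m)) Phi;
  walsh_normalized : normalized_at_infty Phi;
  walsh_components :
    enumerates_components (walsh_set E a m) (walsh_component E a m);
  walsh_labels : forall (G : set C) (j : 'I_l),
    jordan_curve G -> G `<=` ~` E -> surrounds_only G E_ j ->
    jordan_curve (plane_image Phi G) /\
    surrounds_only (plane_image Phi G) (walsh_component E a m) j }.

(* Number of zeros of p in A, with multiplicity (finitely supported if p != 0). *)
Definition count_zeros (p : {poly C}) (A : set C) : nat :=
  \big[addn/0%N]_(z \in A) mup z p.

End WalshMap.

(* Main.v *)
Require Import Defs.
From mathcomp Require Import all_boot all_order all_algebra.
From mathcomp Require Import all_classical all_reals all_analysis.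
From mathcomp Require Import complex lra ring zify.
Set Implicit Arguments.
Unset Strict Implicit.
Unset Printing Implicit Defensive.
Import Order.TTheory GRing.Theory Num.Theory.
Import numFieldNormedType.Exports.
Import ComplexField.Normc.
Local Open Scope classical_set_scope.
Local Open Scope ring_scope.
Local Open Scope complex_scope.
Local Notation Re := complex.Re.
Local Notation Im := complex.Im.

(* Write F = RO o P and let n_j be the number of zeros of P - omega in E_j.  Two
   applications of the maximum principle to sums of logarithms of moduli show that
     ln |F| = n (sum_k m_k ln |Phi - a_k| - ln c),   c = cap E,
   off E (and that c > 0).  Along a Jordan polygon around E_j alone, the argument of
   F changes as much as that of P - omega, because RO(x) / (x - omega) has a
   continuous extension without zeros to the simply connected complement of Omega;
   this is n_j turns.  The image of the polygon under Phi winds around a_j some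
   integer number s_j of times and does not wind around a_k for k <> j, because L_k
   is outside it.  Comparing arguments in the formula for ln |F| gives
   n_j = |s_j| n m_j with s_j <> 0, hence n_j >= n m_j, and summing over j gives
   n_j = n m_j.  Therefore Q(Phi) / F has constant modulus, so it is locally
   constant; it tends to 1 at infinity, so it equals 1 near infinity.  It equals 1
   everywhere because a bounded holomorphic function g off E that vanishes near
   infinity is 0: for every N the maximum principle gives |g| <= M / |F|^N, where
   |F| > 1.  Uniqueness of Phi follows in the same way, and the formula for the
   centers by comparing coefficients of Q and d1 P. *)

(** * The complex plane *)

(** The maps [RO] and [Phi] are given off compact sets only, without boundary values. What replaces
    [|F| -> 1] at [E] is that the sets where [|F|] is at least [expR e] are closed in the whole
    plane. This is continuity of the inverse of a conformal map, hence an open mapping theorem, and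
    it is why the maximum principle is stated with compact superlevel sets. The exponents [m_j] are
    real, so [|U|] is not the modulus of a holomorphic function: the principle is derived from
    integer exponents by approximation, and arguments are compared only along curves. The labels
    tell which component an image curve surrounds, not how often or in which direction; this is why
    [s_j] is only an integer and equality has to come from a sum of inequalities. Interiors of
    Jordan curves are handled through winding numbers: a nonzero one puts a point inside, and on an
    unbounded component of the complement it is 0. Finally, that [Q(Phi) / F] is locally constant
    says nothing across a complement of unknown shape; the vanishing lemma plays the part of
    connectedness and of the identity theorem. *)

Arguments normc {R} x : simpl never.

Section ComplexPlane.
Variable R : realType.
Local Notation C := R[i].
Implicit Types (z w x y : C) (A B D : set C) (f g : C -> C).

Lemma normc_ge0 z : 0 <= normc z.
Proof. by case: z => x y; rewrite /normc sqrtr_ge0. Qed.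

Lemma normc_eq0 z : (normc z == 0) = (z == 0).
Proof. by apply/eqP/eqP => [/eq0_normc|->] //; rewrite normc0. Qed.

Lemma normc_gt0 z : (0 < normc z) = (z != 0).
Proof. by rewrite lt_def normc_eq0 normc_ge0 andbT. Qed.

Lemma normcD z w : normc (z + w) <= normc z + normc w.
Proof. exact: le_normcD. Qed.

Lemma normcNE z : normc (- z) = normc z.
Proof. exact: normcN. Qed.

Lemma normc_distC z w : normc (z - w) = normc (w - z).
Proof. by rewrite -opprB normcNE. Qed.

Lemma normcB z w : normc (z - w) <= normc z + normc w.
Proof. by rewrite -[normc w]normcNE normcD. Qed.

Lemma normc_triangle x z w : normc (z - w) <= normc (z - x) + normc (x - w).
Proof. by rewrite -{1}[z](subrK x) -addrA normcD. Qed.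

Lemma ler_subnormc z w : normc z - normc w <= normc (z - w).
Proof. by rewrite lerBlDr -{1}[z](subrK w) normcD. Qed.

Lemma normcX z k : normc (z ^+ k) = normc z ^+ k.
Proof. by elim: k => [|k IH]; rewrite ?normc1 // !exprS normcM IH. Qed.

Lemma normc_div z w : normc (z / w) = normc z / normc w.
Proof. by rewrite normcM normcV. Qed.

Lemma normc_prod (I : Type) (r : seq I) (P : pred I) (F : I -> C) :
  normc (\prod_(i <- r | P i) F i) = \prod_(i <- r | P i) normc (F i).
Proof. by elim/big_rec2: _ => [|i y1 y2 _ <-]; rewrite ?normc1 ?normcM. Qed.

Lemma normcR (t : R) : normc t%:C = `|t|.
Proof. by rewrite /normc /= expr0n /= addr0 sqrtr_sqr. Qed.

Lemma sqr_normcE z : normc z ^+ 2 = Re z ^+ 2 + Im z ^+ 2.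
Proof. by case: z => a b; rewrite /normc /= sqr_sqrtr // addr_ge0 ?sqr_ge0. Qed.

Lemma Re_le_normc z : `|Re z| <= normc z.
Proof.
case: z => a b; rewrite /normc /= -sqrtr_sqr ler_sqrt ?addr_ge0 ?sqr_ge0 //.
by rewrite lerDl sqr_ge0.
Qed.

Lemma Im_le_normc z : `|Im z| <= normc z.
Proof.
case: z => a b; rewrite /normc /= -sqrtr_sqr ler_sqrt ?addr_ge0 ?sqr_ge0 //.
by rewrite lerDr sqr_ge0.
Qed.

Lemma complex_split z : z = (Re z)%:C + 'i * (Im z)%:C.
Proof. exact: complexE. Qed.

Lemma normc_le_ReIm z : normc z <= `|Re z| + `|Im z|.
Proof.
rewrite {1}[z]complex_split (le_trans (normcD _ _)) // normcM !normcR.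
by rewrite /normc /= expr0n /= add0r expr1n sqrtr1 mul1r.
Qed.

Lemma ReD z w : Re (z + w) = Re z + Re w. Proof. by case: z w => [? ?] []. Qed.
Lemma ImD z w : Im (z + w) = Im z + Im w. Proof. by case: z w => [? ?] []. Qed.
Lemma ReN z : Re (- z) = - Re z. Proof. by case: z. Qed.
Lemma ImN z : Im (- z) = - Im z. Proof. by case: z. Qed.
Lemma ReB z w : Re (z - w) = Re z - Re w. Proof. by rewrite ReD ReN. Qed.
Lemma ImB z w : Im (z - w) = Im z - Im w. Proof. by rewrite ImD ImN. Qed.
Lemma ReM z w : Re (z * w) = Re z * Re w - Im z * Im w.
Proof. by case: z w => [? ?] []. Qed.
Lemma ImM z w : Im (z * w) = Re z * Im w + Im z * Re w.
Proof. by case: z w => [? ?] []. Qed.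
Lemma eqC z w : Re z = Re w -> Im z = Im w -> z = w.
Proof. by case: z w => [? ?] [? ?] /= -> ->. Qed.

Lemma nbhs_normc z A :
  nbhs z A <-> exists2 e : R, 0 < e & forall w, normc (w - z) < e -> A w.
Proof.
rewrite -nbhs_ballE; split => [[e /= e0 H]|[e e0 H]].
  move: e0 H; rewrite -ball_normE /= ltcE /= => /andP[/eqP e_im e_re] H.
  exists (Re e) => // w wz; apply: H => /=; rewrite distrC.
  by rewrite ltcE /= e_im eqxx.
exists e%:C => /=; first by rewrite ltcR.
by rewrite -ball_normE => w /= wz; apply: H; rewrite -ltcR normc_distC.
Qed.

Lemma near_normc z (e : R) : 0 < e -> \forall w \near z, normc (w - z) < e.
Proof. by move=> e0; apply/nbhs_normc; exists e. Qed.

Lemma open_normc A :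
  (forall z, A z -> exists2 e : R, 0 < e & forall w, normc (w - z) < e -> A w) ->
  open A.
Proof. by move=> H; rewrite openE => z /H ?; apply/nbhs_normc. Qed.

Lemma closed_normc A :
  (forall z, (forall e : R, 0 < e -> exists2 w, A w & normc (w - z) < e) -> A z) ->
  closed A.
Proof.
move=> H z clz; apply: H => e e0.
by have [w [Aw ?]] := clz _ (near_normc z e0); exists w.
Qed.

Lemma cvg_normcP (T : Type) (F : set_system T) {FF : Filter F} (f : T -> C) z :
  f @ F --> z <-> forall e : R, 0 < e -> \forall t \near F, normc (f t - z) < e.
Proof.
split => [fz e e0|H]; first exact: fz (near_normc z e0).
move=> A /nbhs_normc[e e0 HA]; apply: filterS (H e e0) => t; exact: HA.
Qed.

Lemma continuous_normcP f z :
  {for z, continuous f} <->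
  forall e : R, 0 < e -> exists2 d : R, 0 < d &
    forall w, normc (w - z) < d -> normc (f w - f z) < e.
Proof.
split => [fz e e0|H].
  by apply/nbhs_normc; exact: (iffLR (cvg_normcP _ _)) fz e e0.
by apply: (iffRL (@cvg_normcP _ (nbhs z) _ f (f z))) => e /H He; apply/nbhs_normc.
Qed.

Lemma real_continuous_normcP (f : C -> R) z :
  {for z, continuous f} <->
  forall e : R, 0 < e -> exists2 d : R, 0 < d &
    forall w, normc (w - z) < d -> `|f w - f z| < e.
Proof.
split => [fz e e0|H].
  apply/nbhs_normc; apply: (fz (fun t => `|t - f z| < e)).
  by apply/nbhs_ballP; exists e => // t /=; rewrite distrC.
move=> A /nbhs_ballP[e /= e0 HA].
have [d d0 Hd] := H e e0.
apply/nbhs_normc; exists d => // w /Hd ?; apply: HA => /=.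
by rewrite /ball /= distrC.
Qed.

Lemma normc_continuous : continuous (@normc R : C -> R).
Proof.
move=> z; apply/real_continuous_normcP => e e0; exists e => // w wz.
rewrite ltr_norml; apply/andP; split.
  by have := ler_subnormc z w; rewrite normc_distC; lra.
by have := ler_subnormc w z; lra.
Qed.

Lemma Re_continuous : continuous (@complex.Re R : C -> R).
Proof.
move=> z; apply/real_continuous_normcP => e e0; exists e => // w wz.
by rewrite -ReB (le_lt_trans (Re_le_normc _)).
Qed.

Lemma Im_continuous : continuous (@complex.Im R : C -> R).
Proof.
move=> z; apply/real_continuous_normcP => e e0; exists e => // w wz.
by rewrite -ImB (le_lt_trans (Im_le_normc _)).
Qed.

Lemma real_complex_continuous : continuous (fun t : R => t%:C : C).
Proof.
move=> t; apply/cvg_normcP => e e0.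
apply/nbhs_ballP; exists e => //= s; rewrite /ball /= => ts.
by rewrite -rmorphB normcR distrC.
Qed.

Lemma complex_cvg (T : Type) (F : set_system T) {FF : Filter F} (f : T -> C) z :
  (fun t => Re (f t)) @ F --> Re z -> (fun t => Im (f t)) @ F --> Im z ->
  f @ F --> z.
Proof.
move=> fr fi; apply/cvg_normcP => e e0.
have e20 : 0 < e / 2 by lra.
have nR (u : T -> R) (l : R) : u @ F --> l -> \forall t \near F, `|u t - l| < e / 2.
  by move=> /cvgrPdist_lt/(_ _ e20); apply: filterS => t; rewrite distrC.
apply: filterS2 (nR _ _ fr) (nR _ _ fi) => t Hr Hi.
rewrite (le_lt_trans (normc_le_ReIm _)) // ReB ImB; lra.
Qed.

Section Algebra.
Context (T : Type) (F : set_system T) {FF : Filter F}.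

Lemma ccvgM (f g : T -> C) (a b : C) :
  f @ F --> a -> g @ F --> b -> (fun t => f t * g t) @ F --> a * b.
Proof. by move=> fa gb; exact: (@cvgM C T F FF f g a b fa gb). Qed.

Lemma ccvgD (f g : T -> C) (a b : C) :
  f @ F --> a -> g @ F --> b -> (fun t => f t + g t) @ F --> a + b.
Proof. by move=> fa gb; exact: (@cvgD C C T F FF f g a b fa gb). Qed.

Lemma ccvgB (f g : T -> C) (a b : C) :
  f @ F --> a -> g @ F --> b -> (fun t => f t - g t) @ F --> a - b.
Proof. by move=> fa gb; exact: (@cvgB C C T F FF f g a b fa gb). Qed.

Lemma ccvgV (f : T -> C) (a : C) : a != 0 -> f @ F --> a -> (fun t => (f t)^-1) @ F --> a^-1.
Proof. by move=> a0 fa; exact: (@cvgV C T F FF f a a0 fa). Qed.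

Lemma ccvg_cst (a : C) : (fun=> a) @ F --> a.
Proof. by apply/cvg_normcP => e e0; apply: nearW => t; rewrite subrr normc0. Qed.

Lemma ccvg_prod (I : Type) (r : seq I) (h : I -> T -> C) (l : I -> C) :
  (forall i, h i @ F --> l i) ->
  (fun t => \prod_(i <- r) h i t) @ F --> \prod_(i <- r) l i.
Proof.
move=> hl; elim: r => [|i r IH].
  rewrite big_nil (_ : (fun t => _) = fun=> 1); first exact: ccvg_cst.
  by apply: funext => t; rewrite big_nil.
rewrite big_cons (_ : (fun t => _) = fun t => h i t * \prod_(j <- r) h j t).
  exact: (ccvgM (hl i) IH).
by apply: funext => t; rewrite big_cons.
Qed.

End Algebra.

(* An inductive wrapper: unfolding the filter inclusions behind [continuous]
   during unification is prohibitively slow over [R[i]]. *)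
Variant ccont (T : topologicalType) (f : T -> C) (t : T) : Prop :=
  CCont of {for t, continuous f}.

Lemma ccontP (T : topologicalType) (f : T -> C) (t : T) :
  ccont f t <-> {for t, continuous f}.
Proof. by split => [[]|]. Qed.

Section PointwiseContinuity.
Variables (T : topologicalType) (t : T).

Lemma ccontM (f g : T -> C) : ccont f t -> ccont g t ->
  ccont (fun s => f s * g s) t.
Proof. by move=> [fc] [gc]; split; exact: (ccvgM fc gc). Qed.

Lemma ccontD (f g : T -> C) : ccont f t -> ccont g t ->
  ccont (fun s => f s + g s) t.
Proof. by move=> [fc] [gc]; split; exact: (ccvgD fc gc). Qed.

Lemma ccontB (f g : T -> C) : ccont f t -> ccont g t ->
  ccont (fun s => f s - g s) t.
Proof. by move=> [fc] [gc]; split; exact: (ccvgB fc gc). Qed.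

Lemma ccontV (f : T -> C) : f t != 0 -> ccont f t ->
  ccont (fun s => (f s)^-1) t.
Proof. by move=> f0 [fc]; split; exact: (ccvgV f0 fc). Qed.

Lemma ccont_cst (a : C) : ccont (fun=> a) t.
Proof. by split; exact: ccvg_cst. Qed.

Lemma ccont_prod (I : Type) (r : seq I) (h : I -> T -> C) :
  (forall i, ccont (h i) t) -> ccont (fun s => \prod_(i <- r) h i s) t.
Proof.
by move=> hc; split; apply: ccvg_prod => i; have [] := hc i.
Qed.

Lemma ccont_comp (f : T -> C) (g : C -> C) : ccont f t -> ccont g (f t) ->
  ccont (fun s => g (f s)) t.
Proof. by move=> [fc] [gc]; split; exact: (cvg_comp f g fc gc). Qed.

End PointwiseContinuity.

Lemma ccont_id z : ccont (id : C -> C) z.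
Proof. by split; exact: cvg_id. Qed.

Lemma ccont_real_complex (t : R) : ccont (fun t : R => t%:C : C) t.
Proof. by split; exact: real_complex_continuous. Qed.

Lemma closed_bounded_compact A (M : R) :
  closed A -> (forall z, A z -> normc z <= M) -> compact A.
Proof.
move=> cA bA; pose h (p : R * R) : C := p.1 +i* p.2.
have hc : continuous h.
  move=> p; apply: complex_cvg; [exact: cvg_fst | exact: cvg_snd].
pose B := h @` (`[- M, M]%classic `*` `[- M, M]%classic).
have cB : compact B.
  apply: continuous_compact; first exact: continuous_subspaceT.
  apply: compact_setX; exact: segment_compact.
apply: (subclosed_compact cA cB) => z Az.
exists (Re z, Im z); last by case: (z).
have := bA z Az; have := Re_le_normc z; have := Im_le_normc z.
rewrite !ler_norml => /andP[? ?] /andP[? ?] ?.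
by split => /=; rewrite in_itv /=; apply/andP; split; lra.
Qed.

Lemma C_hausdorff : hausdorff_space C.
Proof. exact: norm_hausdorff. Qed.

Lemma compact_bounded_normc A : compact A -> exists M : R, forall z, A z -> normc z <= M.
Proof.
move=> cA; have [->|A0] := eqVneq A set0; first by exists 0.
have /set0P A0' := A0.
have [|c _ Hc] := compact_EVT_max A0' cA (f := @normc R).
  exact/continuous_subspaceT/normc_continuous.
by exists (normc c) => z Az; apply: Hc; rewrite inE.
Qed.

Lemma segment_conn (a b : C) :
  connected ((fun t : R => a + t%:C * (b - a)) @` `[0, 1]%classic).
Proof.
apply: connected_continuous_connected; first exact: segment_connected.
apply: continuous_subspaceT => t; apply/ccontP.
apply: ccontD; first exact: ccont_cst.
by apply: ccontM; [exact: ccont_real_complex | exact: ccont_cst].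
Qed.

Lemma connected_open_split (T : topologicalType) (A U V : set T) :
  connected A -> open U -> open V -> A `<=` U `|` V -> U `&` V = set0 ->
  A `&` U !=set0 -> A `<=` U.
Proof.
move=> cA oU oV AUV UV0 AU0.
suff -> : A = A `&` U by move=> z [].
apply/esym; apply: cA => //; first by exists U.
exists (~` V); first exact: open_closedC.
apply/seteqP; split => z [Az].
  by move=> Uz; split => // Vz; have : (U `&` V) z by []; rewrite UV0.
by move=> nVz; split => //; have [] := AUV z Az.
Qed.

Lemma clopenC A : open A -> closed A -> A !=set0 -> A = setT.
Proof.
move=> oA cA [a Aa]; apply/seteqP; split => // z _.
have H : (fun t : R => a + t%:C * (z - a)) @` `[0, 1]%classic `<=` A.
apply: (connected_open_split (@segment_conn a z) oA (closed_openC cA)).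
- by move=> x _; have [|] := pselect (A x); [left | right].
- by rewrite setICr.
- exists a; split => //; exists 0; rewrite /= ?in_itv /= ?lexx ?ler01 //.
  by rewrite mul0r addr0.
by apply: H; exists 1; rewrite /= ?in_itv /= ?lexx ?ler01 // mul1r addrC subrK.
Qed.

(** Neighbourhoods through the real-valued modulus, wrapped inductively for the same reason as
    [ccont]. *)
Variant nearc z A : Prop :=
  NearC (r : R) of 0 < r & (forall w, normc (w - z) < r -> A w).

Lemma nearcP z A : nearc z A <-> nbhs z A.
Proof.
split=> [[r r0 H]|/nbhs_normc[r r0 H]]; last by exists r.
by apply/nbhs_normc; exists r.
Qed.

Lemma nearcS z A B : A `<=` B -> nearc z A -> nearc z B.
Proof. by move=> AB [r r0 H]; exists r => // w /H /AB. Qed.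

Lemma nearcI z A B : nearc z A -> nearc z B -> nearc z (A `&` B).
Proof.
move=> [r r0 H] [s s0 K]; exists (Num.min r s); first by rewrite lt_min r0.
by move=> w; rewrite lt_min => /andP[/H ? /K].
Qed.

Lemma nearcS2 z A B D : (forall w, A w -> B w -> D w) ->
  nearc z A -> nearc z B -> nearc z D.
Proof.
by move=> ABD nA nB; apply: nearcS (nearcI nA nB) => w [] ; exact: ABD.
Qed.

Lemma nearcW z A : (forall w, A w) -> nearc z A.
Proof. by move=> H; exists 1. Qed.

Lemma nearc_self z A : nearc z A -> A z.
Proof. by move=> [r r0]; apply; rewrite subrr normc0. Qed.

Lemma open_nearc A z : open A -> A z -> nearc z A.
Proof. by rewrite openE => oA /oA /nearcP. Qed.

Lemma ccont_normcP f z :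
  ccont f z <-> forall e : R, 0 < e -> nearc z (fun w => normc (f w - f z) < e).
Proof.
split=> [[/continuous_normcP H] e /H[d d0 Hd]|H]; first by exists d.
by split; apply/continuous_normcP => e /H[d d0 Hd]; exists d.
Qed.

Lemma ccont_near f g z : nearc z (fun w => f w = g w) -> ccont f z -> ccont g z.
Proof.
move=> fg /ccont_normcP H; apply/ccont_normcP => e /H.
by have fgz := nearc_self fg; apply: nearcS2 fg => w <-; rewrite -fgz.
Qed.

Lemma ccont_preimage f z A : ccont f z -> nearc (f z) A -> nearc z (fun w => A (f w)).
Proof.
move=> /ccont_normcP H [r r0 HA]; apply: nearcS (H r r0) => w; exact: HA.
Qed.

(* Caratheodory's form of complex differentiability. *)
Variant cder f z (d : C) : Prop :=
  CDer (q : C -> C) of ccont q z & q z = d &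
    (nearc z (fun w => f w - f z = q w * (w - z))).

Definition cdiff f z := exists d, cder f z d.

Lemma cder_continuous f z d : cder f z d -> ccont f z.
Proof.
move=> [q qc qz H].
have H0 : ccont (fun w => q w * (w - z) + f z) z.
  apply: ccontD; last exact: ccont_cst.
  by apply: ccontM qc _; apply: ccontB; [exact: ccont_id | exact: ccont_cst].
by apply: ccont_near H0; apply: nearcS H => w <-; rewrite subrK.
Qed.

Lemma cdiff_continuous f z : cdiff f z -> ccont f z.
Proof. by move=> [d /cder_continuous]. Qed.

Lemma cder_near f g z a : (nearc z (fun w => f w = g w)) -> cder f z a -> cder g z a.
Proof.
move=> fg [p pc pz Hp]; exists p => //.
have fgz := nearc_self fg.
by apply: nearcS2 fg Hp => w <-; rewrite fgz.
Qed.

Lemma cdiff_near f g z : (nearc z (fun w => f w = g w)) -> cdiff f z -> cdiff g z.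
Proof. by move=> fg [a /(cder_near fg)]; exists a. Qed.

Lemma eq_cdiff f g z : f =1 g -> cdiff f z -> cdiff g z.
Proof. by move=> /funext ->. Qed.

Lemma cder_cst (c : C) z : cder (fun=> c) z 0.
Proof.
exists (fun=> 0) => //; first exact: ccont_cst.
by apply: nearcW => w; rewrite subrr mul0r.
Qed.

Lemma cder_id z : cder id z 1.
Proof.
exists (fun=> 1) => //; first exact: ccont_cst.
by apply: nearcW => w; rewrite mul1r.
Qed.

Lemma cderD f g z a b : cder f z a -> cder g z b ->
  cder (fun w => f w + g w) z (a + b).
Proof.
move=> [p pc pz Hp] [q qc qz Hq].
exists (fun w => p w + q w); [exact: ccontD | by rewrite pz qz|].
apply: nearcS2 Hp Hq => w Hp Hq.
by rewrite mulrDl -Hp -Hq; ring.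
Qed.

Lemma cderM f g z a b : cder f z a -> cder g z b ->
  cder (fun w => f w * g w) z (a * g z + f z * b).
Proof.
move=> /[dup] fd [p pc pz Hp] [q qc qz Hq].
exists (fun w => p w * g z + f w * q w).
- apply: ccontD; first by apply: ccontM pc _; exact: ccont_cst.
  by apply: ccontM qc; exact: cder_continuous fd.
- by rewrite pz qz.
apply: nearcS2 Hp Hq => w Hp Hq.
have -> : (p w * g z + f w * q w) * (w - z) =
  p w * (w - z) * g z + f w * (q w * (w - z)) by ring.
by rewrite -Hp -Hq; ring.
Qed.

Lemma near_neq0 f z : ccont f z -> f z != 0 -> nearc z (fun w => f w != 0).
Proof.
move=> /ccont_normcP fc fz.
have n0 : 0 < normc (f z) by rewrite normc_gt0.
apply: nearcS (fc _ n0) => w.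
by apply: contraTneq => ->; rewrite sub0r normcNE ltxx.
Qed.

Lemma cderV f z a : cder f z a -> f z != 0 ->
  cder (fun w => (f w)^-1) z (- a / f z ^+ 2).
Proof.
move=> /[dup] fd [p pc pz Hp] fz.
have fc := cder_continuous fd.
exists (fun w => (-1 * p w) * (f w * f z)^-1).
- apply: ccontM; first by apply: ccontM pc; exact: ccont_cst.
  apply: ccontV; first by rewrite mulf_neq0.
  by apply: ccontM fc _; exact: ccont_cst.
- by rewrite pz expr2 mulN1r.
apply: nearcS2 Hp (near_neq0 fc fz) => w Hp fw.
have -> : (-1 * p w) * (f w * f z)^-1 * (w - z) =
  - (p w * (w - z)) / (f w * f z) by ring.
by rewrite -Hp; field; rewrite fz fw.
Qed.

Lemma cder_comp f g z a b : cder f z a -> cder g (f z) b ->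
  cder (fun w => g (f w)) z (b * a).
Proof.
move=> /[dup] fd [p pc pz Hp] [q qc qz Hq].
have fc := cder_continuous fd.
exists (fun w => q (f w) * p w).
- by apply: ccontM pc; exact: ccont_comp fc qc.
- by rewrite qz pz.
apply: nearcS2 Hp (ccont_preimage fc Hq) => w /= Hp Hq'.
by rewrite Hq' Hp mulrA.
Qed.

Lemma cdiff_cst (c : C) z : cdiff (fun=> c) z.
Proof. by exists 0; exact: cder_cst. Qed.

Lemma cdiff_id z : cdiff id z.
Proof. by exists 1; exact: cder_id. Qed.

Lemma cdiffD f g z : cdiff f z -> cdiff g z -> cdiff (fun w => f w + g w) z.
Proof. by move=> [a fa] [b gb]; exists (a + b); exact: cderD. Qed.

Lemma cdiffM f g z : cdiff f z -> cdiff g z -> cdiff (fun w => f w * g w) z.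
Proof. by move=> [a fa] [b gb]; exists (a * g z + f z * b); exact: cderM. Qed.

Lemma cdiffB f g z : cdiff f z -> cdiff g z -> cdiff (fun w => f w - g w) z.
Proof.
move=> fa gb; apply: eq_cdiff (cdiffD fa (cdiffM (cdiff_cst (-1) z) gb)).
by move=> w; rewrite mulN1r.
Qed.

Lemma cdiffV f z : cdiff f z -> f z != 0 -> cdiff (fun w => (f w)^-1) z.
Proof. by move=> [a fa] fz; exists (- a / f z ^+ 2); exact: cderV. Qed.

Lemma cdiffX f k z : cdiff f z -> cdiff (fun w => f w ^+ k) z.
Proof.
move=> fa; elim: k => [|k IH]; first exact: cdiff_cst.
by apply: eq_cdiff (cdiffM fa IH) => w; rewrite exprS.
Qed.

Lemma cdiff_comp f g z : cdiff f z -> cdiff g (f z) -> cdiff (fun w => g (f w)) z.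
Proof. by move=> [a fa] [b gb]; exists (b * a); exact: cder_comp. Qed.

Lemma cdiff_prod (I : Type) (r : seq I) (F : I -> C -> C) z :
  (forall i, cdiff (F i) z) -> cdiff (fun w => \prod_(i <- r) F i w) z.
Proof.
move=> Fd; elim: r => [|i r IH].
  by apply: eq_cdiff (cdiff_cst 1 z) => w; rewrite big_nil.
by apply: eq_cdiff (cdiffM (Fd i) IH) => w; rewrite big_cons.
Qed.

Lemma cdiff_horner (p : {poly C}) z : cdiff (fun w => p.[w]) z.
Proof.
elim/poly_ind: p => [|p c IH].
  by apply: eq_cdiff (cdiff_cst 0 z) => w; rewrite horner0.
apply: eq_cdiff (cdiffD (cdiffM IH (cdiff_id z)) (cdiff_cst c z)) => w.
by rewrite hornerMXaddC.
Qed.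

Lemma derivable_cdiff f z : derivable f z (1 : C) -> cdiff f z.
Proof.
move=> /cvg_ex[d fd]; exists d.
(* The Caratheodory factor is the difference quotient completed by its limit [d]. *)
exists (fun w => if w == z then d else (f w - f z) / (w - z)).
- split; apply/continuous_normcP => e e0.
  have fde := (iffLR (@cvg_normcP _ _ (dnbhs_filter _) _ _)) fd e e0.
  have /nbhs_normc[r r0 Hr] : nbhs (0 : C)
    (fun t => t != 0 -> normc (t^-1 *: ((f \o shift z) t%:A - f z) - d) < e).
    exact: fde.
  exists r => // w wr; rewrite eqxx.
  have [_|wz] := eqVneq w z; first by rewrite subrr normc0.
  have := Hr (w - z); rewrite subr0 subr_eq0 => /(_ wr wz).
  by rewrite /= [_%:A]mulr1 subrK [_ *: _]mulrC.
- by rewrite eqxx.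
apply: nearcW => w; case: eqVneq => [->|wz]; first by rewrite !subrr mulr0.
by rewrite divfK // subr_eq0.
Qed.

Lemma cder_eps f z d : cder f z d -> forall e : R, 0 < e ->
  nearc z (fun w => normc (f w - f z - d * (w - z)) <= e * normc (w - z)).
Proof.
move=> [q /ccont_normcP qc qz H] e e0.
apply: nearcS2 H (qc e e0) => w -> Hw.
by rewrite -mulrBl normcM -qz ler_wpM2r ?normc_ge0 // ltW.
Qed.

End ComplexPlane.

(** * Goursat, and a weak maximum principle *)

Section LineIntegral.
Variable R : realType.
Local Notation C := R[i].
Implicit Types (a b c M : R).

Definition ig (g : R -> R) a b : R := \int[lebesgue_measure]_(t in `[a, b]) g t.

Lemma ig_integrable (g : R -> R) a b : continuous g ->
  lebesgue_measure.-integrable `[a, b] (EFin \o g).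
Proof.
move=> gc; apply: continuous_compact_integrable; first exact: segment_compact.
exact: continuous_subspaceT.
Qed.

Lemma eq_ig (f g : R -> R) a b :
  (forall t, a <= t <= b -> f t = g t) -> ig f a b = ig g a b.
Proof.
by move=> fg; apply: eq_Rintegral => t; rewrite inE /= in_itv /=; exact: fg.
Qed.

Lemma igD (f g : R -> R) a b : continuous f -> continuous g ->
  ig (fun t => f t + g t) a b = ig f a b + ig g a b.
Proof. by move=> fc gc; apply: RintegralD => //; exact: ig_integrable. Qed.

Lemma igZ (g : R -> R) k a b : continuous g -> ig (fun t => k * g t) a b = k * ig g a b.
Proof. by move=> gc; apply: RintegralZl => //; exact: ig_integrable. Qed.

Lemma ig_split (g : R -> R) a b c : continuous g -> a <= c -> c <= b ->
  ig g a b = ig g a c + ig g c b.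
Proof.
move=> gc ac cb; have := @Rintegral_itvB R g (BLeft a) (BRight b) c (ig_integrable _ _ gc).
rewrite !bnd_simp => /(_ ac cb) E.
rewrite /ig -[X in _ = _ + X]Rintegral_itv_obnd_cbnd -?E; first by ring.
apply: integrableS (ig_integrable a b gc) => //= t /=.
by rewrite !in_itv /= => /andP[ct ->]; rewrite andbT ltW // (le_lt_trans ac).
Qed.

Lemma ig_cst k a b : a <= b -> ig (fun=> k) a b = k * (b - a).
Proof.
move=> ab; rewrite /ig Rintegral_cst //= lebesgue_measure_itv /= lte_fin.
case: ltP => // ba; have -> : b = a by apply/eqP; rewrite eq_le ab ba.
by rewrite subrr.
Qed.

Lemma le_ig (f g : R -> R) a b : continuous f -> continuous g ->
  (forall t, a <= t <= b -> f t <= g t) -> ig f a b <= ig g a b.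
Proof.
move=> fc gc fg; apply: le_Rintegral => //; first exact: ig_integrable.
  exact: ig_integrable.
Qed.

Lemma ig_bound (g : R -> R) a b M : continuous g -> a <= b ->
  (forall t, a <= t <= b -> `|g t| <= M) -> `|ig g a b| <= M * (b - a).
Proof.
move=> gc ab gM; rewrite -(ig_cst M ab) ler_norml; apply/andP; split.
  have -> : - ig (fun=> M) a b = ig (fun=> - M) a b by rewrite !ig_cst // mulNr.
  apply: le_ig => //; first exact: cst_continuous.
  by move=> t /gM; rewrite ler_norml => /andP[].
apply: le_ig => //; first exact: cst_continuous.
by move=> t /gM; rewrite ler_norml => /andP[].
Qed.

Definition cig (g : R -> C) a b : C :=
  ig (fun t => Re (g t)) a b +i* ig (fun t => Im (g t)) a b.

Definition cc (g : R -> C) := forall t, ccont g t.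

Lemma cc_Re g : cc g -> continuous (fun t => Re (g t)).
Proof.
move=> gc t; have [gt] := gc t.
exact: (cvg_comp g (@complex.Re R) gt (@Re_continuous R (g t))).
Qed.

Lemma cc_Im g : cc g -> continuous (fun t => Im (g t)).
Proof.
move=> gc t; have [gt] := gc t.
exact: (cvg_comp g (@complex.Im R) gt (@Im_continuous R (g t))).
Qed.

Lemma eq_cig (f g : R -> C) a b :
  (forall t, a <= t <= b -> f t = g t) -> cig f a b = cig g a b.
Proof. by move=> fg; congr (_ +i* _); apply: eq_ig => t /fg ->. Qed.

Lemma cigD f g a b : cc f -> cc g ->
  cig (fun t => f t + g t) a b = cig f a b + cig g a b.
Proof.
move=> fc gc; rewrite /cig.
under [X in X +i* _]eq_ig do rewrite ReD.
under [X in _ +i* X]eq_ig do rewrite ImD.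
by rewrite !igD //; do ?exact: cc_Re; do ?exact: cc_Im.
Qed.

Lemma cigZ (k : C) g a b : cc g -> cig (fun t => k * g t) a b = k * cig g a b.
Proof.
move=> gc; have rc := cc_Re gc; have ic := cc_Im gc.
have Zc (l : R) (h : R -> R) : continuous h -> continuous (fun t => l * h t).
  by move=> hc t; apply: cvgM; [exact: cvg_cst | exact: hc].
rewrite /cig.
have -> : ig (fun t => Re (k * g t)) a b =
    Re k * ig (fun t => Re (g t)) a b + (- Im k) * ig (fun t => Im (g t)) a b.
  rewrite -!igZ // -igD; [|exact: Zc..].
  by apply: eq_ig => t _; rewrite ReM mulNr.
have -> : ig (fun t => Im (k * g t)) a b =
    Re k * ig (fun t => Im (g t)) a b + Im k * ig (fun t => Re (g t)) a b.
  rewrite -!igZ // -igD; [|exact: Zc..].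
  by apply: eq_ig => t _; rewrite ImM.
by apply: eqC; rewrite ?ReM ?ImM /=; ring.
Qed.

Lemma cig_split g a b c : cc g -> a <= c -> c <= b ->
  cig g a b = cig g a c + cig g c b.
Proof.
move=> gc ac cb; rewrite /cig (ig_split (cc_Re gc) ac cb) (ig_split (cc_Im gc) ac cb).
exact: eqC.
Qed.

Lemma cig_cst (k : C) a b : a <= b -> cig (fun=> k) a b = k * (b - a)%:C.
Proof.
by move=> ab; apply: eqC; rewrite /= ig_cst // ?ReM ?ImM /=; ring.
Qed.

(** The factor 2 comes from estimating real and imaginary parts separately; it is harmless, since
    [weak_maximum] gets rid of all constants. *)
Lemma cig_bound g a b M : cc g -> a <= b ->
  (forall t, a <= t <= b -> normc (g t) <= M) -> normc (cig g a b) <= 2 * M * (b - a).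
Proof.
move=> gc ab gM; rewrite (le_trans (normc_le_ReIm _)) //= -mulrA mulr_natl mulr2n.
apply: lerD; apply: ig_bound => //; do ?exact: cc_Re; do ?exact: cc_Im.
  by move=> t /gM; apply: le_trans; exact: Re_le_normc.
by move=> t /gM; apply: le_trans; exact: Im_le_normc.
Qed.

End LineIntegral.

Section Goursat.
Variable R : realType.
Local Notation C := R[i].

(** Bisection as an induction principle: a square on which [P] fails could be quartered for ever
    into squares of the same kind, and these would shrink to a point [(a, b)] around which [P] holds
    for all small squares. *)
Lemma square_bisection (P : R -> R -> R -> Prop) (x y s : R) : 0 < s ->
  (forall x y s, 0 < s -> P x y (s / 2) -> P (x + s / 2) y (s / 2) ->
     P x (y + s / 2) (s / 2) -> P (x + s / 2) (y + s / 2) (s / 2) -> P x y s) ->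
  (forall a b, x <= a <= x + s -> y <= b <= y + s -> exists2 r : R, 0 < r &
     forall x' y' s', 0 < s' < r -> x <= x' -> x' + s' <= x + s ->
       y <= y' -> y' + s' <= y + s -> x' <= a <= x' + s' -> y' <= b <= y' + s' ->
       P x' y' s') ->
  P x y s.
Proof.
move=> s0 Pquarter Ploc; apply: contrapT => nP.
pose h k : R := s / 2 ^+ k.
have h0 k : 0 < h k by rewrite divr_gt0 // exprn_gt0.
have hS k : h k = 2 * h k.+1.
  by rewrite /h exprS; field; rewrite expf_neq0.
(* Failure of [P] on the current square is a premise inside the existential, so that [choice] yields
   a total successor function. *)
have step (kq : nat * (R * R)) : exists q' : R * R,
    ~ P kq.2.1 kq.2.2 (h kq.1) ->
    [/\ ~ P q'.1 q'.2 (h kq.1.+1), kq.2.1 <= q'.1 <= kq.2.1 + h kq.1.+1 &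
        kq.2.2 <= q'.2 <= kq.2.2 + h kq.1.+1].
  case: kq => k [a b] /=; have hk := h0 k.+1.
  apply: contrapT => /forallNP H; apply: (H (a, b)) => nPab; exfalso; apply: nPab.
  have e : h k / 2 = h k.+1 by rewrite hS; field.
  have Q c d : a <= c <= a + h k.+1 -> b <= d <= b + h k.+1 -> P c d (h k.+1).
    move=> ca db; apply: contrapT => nPcd; apply: (H (c, d)) => _.
    by split.
  by apply: Pquarter => //; rewrite e; apply: Q; apply/andP; split; lra.
have [nxt Hnxt] := choice step.
pose u := fix u k := if k is k'.+1 then nxt (k', u k') else (x, y).
have uP k : ~ P (u k).1 (u k).2 (h k).
  elim: k => [|k IH]; first by rewrite /h expr0 divr1.
  by have [] := Hnxt (k, u k) IH.
have u1S k : (u k).1 <= (u k.+1).1 <= (u k).1 + h k.+1.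
  by have [] := Hnxt (k, u k) (uP k).
have u2S k : (u k).2 <= (u k.+1).2 <= (u k).2 + h k.+1.
  by have [] := Hnxt (k, u k) (uP k).
have nested (v : nat -> R) : (forall k, v k <= v k.+1 <= v k + h k.+1) ->
    exists a, forall k, v k <= a <= v k + h k.
  move=> vS.
  have vmono i j : (i <= j)%N -> v i <= v j.
    move=> /subnK <-; elim: (j - i)%N => // k IH; rewrite addSn.
    by rewrite (le_trans IH) //; have /andP[] := vS (k + i)%N.
  have wmono i j : (i <= j)%N -> v j + h j <= v i + h i.
    move=> /subnK <-; elim: (j - i)%N => // k IH; rewrite addSn.
    rewrite (le_trans _ IH) //; have /andP[_] := vS (k + i)%N.
    have := hS (k + i)%N; lra.
  have vw i j : v i <= v j + h j.
    have [ij|/ltnW ji] := leqP i j.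
      by rewrite (le_trans (vmono _ _ ij)) // lerDl ltW.
    by rewrite (le_trans _ (wmono _ _ ji)) // lerDl ltW.
  exists (sup (range v)) => k; apply/andP; split.
    apply: ub_le_sup; last by exists k.
    by exists (v 0%N + h 0%N) => _ [i _ <-].
  by apply: ge_sup; [exists (v 0%N); exists 0%N | move=> _ [i _ <-]].
have [a Ha] := nested _ u1S; have [b Hb] := nested _ u2S.
have xa : x <= a <= x + s by have := Ha 0%N; rewrite /h expr0 divr1.
have yb : y <= b <= y + s by have := Hb 0%N; rewrite /h expr0 divr1.
have [r r0 Pr] := Ploc a b xa yb.
have inbox k : [/\ x <= (u k).1, (u k).1 + h k <= x + s,
                  y <= (u k).2 & (u k).2 + h k <= y + s].
  elim: k => [|k [? ? ? ?]]; first by rewrite /= /h expr0 divr1 !lexx.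
  have := u1S k; have := u2S k; have := hS k; move=> ? /andP[? ?] /andP[? ?].
  by split; lra.
have [k hk] : exists k, h k < r.
  have [k Hk] := ltr_add_invr (divr_gt0 r0 s0).
  exists k; rewrite /h ltr_pdivrMr ?exprn_gt0 //.
  move: Hk; rewrite add0r ltr_pdivlMr // => Hk.
  have k1 : (k.+1%:R : R) <= 2 ^+ k.
    by rewrite -natrX ler_nat ltn_expl.
  have sk : s < r * k.+1%:R by rewrite -ltr_pdivrMr ?ltr0Sn // mulrC.
  by rewrite (lt_le_trans sk) // ler_pM2l.
have [? ? ? ?] := inbox k.
by apply: (uP k); apply: Pr => //; rewrite h0.
Qed.

(** The counterclockwise contour integral over the boundary of the square, with opposite sides
    combined into one integrand. *)
Definition square_int (f : C -> C) (x y s : R) : C :=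
  cig (fun t => f (t +i* y) - f (t +i* (y + s))) x (x + s) +
  'i * cig (fun t => f ((x + s) +i* t) - f (x +i* t)) y (y + s).

Definition square (x y s : R) : set C :=
  [set z | x <= Re z <= x + s /\ y <= Im z <= y + s].

Section GlobalContinuity.
Variable f : C -> C.
Hypothesis fc : forall z, ccont f z.

Lemma cc_horizontal (y : R) : cc (fun t => f (t +i* y)).
Proof.
move=> t; apply: (@ccont_comp _ _ t (fun t : R => t +i* y) f) => //.
split; apply: complex_cvg => /=; [exact: cvg_id | exact: cvg_cst].
Qed.

Lemma cc_vertical (x : R) : cc (fun t => f (x +i* t)).
Proof.
move=> t; apply: (@ccont_comp _ _ t (fun t : R => x +i* t) f) => //.
split; apply: complex_cvg => /=; [exact: cvg_cst | exact: cvg_id].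
Qed.

Lemma cc_horizontalB (y y' : R) : cc (fun t => f (t +i* y) - f (t +i* y')).
Proof. by move=> t; apply: ccontB; exact: cc_horizontal. Qed.

Lemma cc_verticalB (x x' : R) : cc (fun t => f (x +i* t) - f (x' +i* t)).
Proof. by move=> t; apply: ccontB; exact: cc_vertical. Qed.

Lemma square_int_quarter x y s : 0 < s ->
  square_int f x y s =
    square_int f x y (s / 2) + square_int f (x + s / 2) y (s / 2) +
    square_int f x (y + s / 2) (s / 2) +
    square_int f (x + s / 2) (y + s / 2) (s / 2).
Proof.
move=> s0; rewrite /square_int -!addrA.
have e : s / 2 + s / 2 = s by field.
rewrite !e !addrA.
rewrite (@cig_split _ _ x (x + s) (x + s / 2)); [|exact: cc_horizontalB|lra|lra].
rewrite (@cig_split _ _ y (y + s) (y + s / 2)); [|exact: cc_verticalB|lra|lra].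
have H u v : cig (fun t => f (t +i* y) - f (t +i* (y + s))) u v =
    cig (fun t => f (t +i* y) - f (t +i* (y + s / 2))) u v +
    cig (fun t => f (t +i* (y + s / 2)) - f (t +i* (y + s))) u v.
  rewrite -cigD; [|exact: cc_horizontalB|exact: cc_horizontalB].
  by apply: eq_cig => t _; ring.
have V u v : cig (fun t => f ((x + s) +i* t) - f (x +i* t)) u v =
    cig (fun t => f ((x + s / 2) +i* t) - f (x +i* t)) u v +
    cig (fun t => f ((x + s) +i* t) - f ((x + s / 2) +i* t)) u v.
  rewrite -cigD; [|exact: cc_verticalB|exact: cc_verticalB].
  by apply: eq_cig => t _; ring.
by rewrite !H !V; ring.
Qed.

Lemma square_int_bound x y s M : 0 < s ->
  (forall z, square x y s z -> normc (f z) <= M) ->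
  normc (square_int f x y s) <= 8 * M * s.
Proof.
move=> s0 fM; rewrite /square_int (le_trans (normcD _ _)) // normcM.
have -> : normc ('i : C) = 1 by rewrite /normc /= expr0n add0r expr1n sqrtr1.
rewrite mul1r (_ : 8 * M * s = 2 * (M + M) * (x + s - x) + 2 * (M + M) * (y + s - y));
  last by ring.
apply: lerD; apply: cig_bound; [exact: cc_horizontalB|lra|move=> t tx
  |exact: cc_verticalB|lra|move=> t ty];
  rewrite (le_trans (normcB _ _)) // lerD // fM //; split => //=;
  apply/andP; split; lra.
Qed.

(** Local estimates may thus be made after subtracting the first-order expansion: the contributions
    of [d] from the two pairs of sides are [- i d s^2] and [i d s^2]. *)
Lemma square_intB_affine (a d : C) x y s : 0 < s ->
  square_int (fun w => f w - (a + d * w)) x y s = square_int f x y s.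
Proof.
move=> s0; rewrite /square_int.
have -> : cig (fun t => f (t +i* y) - (a + d * (t +i* y)) -
      (f (t +i* (y + s)) - (a + d * (t +i* (y + s))))) x (x + s) =
    cig (fun t => f (t +i* y) - f (t +i* (y + s))) x (x + s) + d * (0 +i* s) * s%:C.
  have -> : d * (0 +i* s) * s%:C = cig (fun=> d * (0 +i* s)) x (x + s).
    by rewrite cig_cst; [congr (_ * _%:C); ring | lra].
  rewrite -cigD; [|exact: cc_horizontalB|by move=> t; exact: ccont_cst].
  apply: eq_cig => t _.
  have -> : 0 +i* s = t +i* (y + s) - t +i* y by apply: eqC => /=; ring.
  ring.
have -> : cig (fun t => f ((x + s) +i* t) - (a + d * ((x + s) +i* t)) -
      (f (x +i* t) - (a + d * (x +i* t)))) y (y + s) =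
    cig (fun t => f ((x + s) +i* t) - f (x +i* t)) y (y + s) - d * s%:C * s%:C.
  have -> : - (d * s%:C * s%:C) = cig (fun=> - (d * s%:C)) y (y + s).
    by rewrite cig_cst -?mulNr; [congr (_ * _%:C); ring | lra].
  rewrite -cigD; [|exact: cc_verticalB|by move=> t; exact: ccont_cst].
  apply: eq_cig => t _.
  have -> : s%:C = (x + s) +i* t - x +i* t by apply: eqC => /=; ring.
  ring.
have -> : 0 +i* s = 'i * s%:C by apply: eqC => /=; ring.
ring.
Qed.

End GlobalContinuity.

Lemma square_diam x y s z w : square x y s z -> square x y s w ->
  normc (w - z) <= 2 * s.
Proof.
move=> [/andP[? ?] /andP[? ?]] [/andP[? ?] /andP[? ?]].
rewrite (le_trans (normc_le_ReIm _)) // ReB ImB mulr2n mulrDl mul1r.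
by apply: lerD; rewrite ler_norml; apply/andP; split; lra.
Qed.

(* The exceptional point 0 is absorbed by the error term
   [(phi (x + s) - phi x) * (phi (y + s) - phi y)], which is additive under
   subdivision and dominates [s] on squares containing 0. *)
Lemma goursat (f : C -> C) (x y s : R) : 0 < s ->
  (forall z, ccont f z) ->
  (forall z, square x y s z -> z != 0 -> exists d : C, forall e : R, 0 < e ->
     nearc z (fun w => square x y s w ->
       normc (f w - f z - d * (w - z)) <= e * normc (w - z))) ->
  square_int f x y s = 0.
Proof.
move=> s0 fc fd.
(* Square roots of negative reals are 0 here, so [phi] is the increasing odd function
   [sgn t * sqrt |t|]; on a square of side [s] containing 0, [area] is at least
   [sqrt s * sqrt s = s]. *)
pose phi (t : R) := Num.sqrt t - Num.sqrt (- t).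
have phi_mono a b : a <= b -> phi a <= phi b.
  by move=> ab; rewrite /phi lerB // ler_wsqrtr // lerN2.
have phi0 a t : a <= 0 -> 0 <= a + t -> Num.sqrt t <= phi (a + t) - phi a.
  move=> a0 at0; rewrite /phi (ler0_sqrtr a0) (@ler0_sqrtr _ (- (a + t))) ?oppr_le0 //.
  rewrite subr0 sub0r opprK.
  rewrite -(@ler_pXn2r _ 2) // ?nnegrE ?sqrtr_ge0 ?addr_ge0 ?sqrtr_ge0 //.
  rewrite sqrrD !sqr_sqrtr ?oppr_ge0 //; last by lra.
  by have := mulr_ge0 (sqrtr_ge0 (a + t)) (sqrtr_ge0 (- a)); lra.
pose area x y s := (phi (x + s) - phi x) * (phi (y + s) - phi y).
have area_ge0 x' y' s' : 0 < s' -> 0 <= area x' y' s'.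
  by move=> ?; rewrite mulr_ge0 // subr_ge0 phi_mono // lerDl ltW.
suff H e : 0 < e -> normc (square_int f x y s) <= e * (s ^+ 2 + area x y s).
  apply/eqP; rewrite -normc_eq0 eq_le normc_ge0 andbT; apply/ler_addgt0Pl => e e0.
  have K0 : 0 < s ^+ 2 + area x y s + 1.
    by have := area_ge0 x y s s0; have := exprn_gt0 2 s0; lra.
  rewrite addr0 (le_trans (H (e / (s ^+ 2 + area x y s + 1)) _)) ?divr_gt0 //.
  rewrite -mulrA ler_piMr ?(ltW e0) //.
  by rewrite mulrC ler_pdivrMr // mul1r lerDl.
move=> e0.
apply: (@square_bisection (fun x y s =>
  normc (square_int f x y s) <= e * (s ^+ 2 + area x y s)) x y s s0).
  move=> x1 y1 s1 s10 h1 h2 h3 h4; rewrite (square_int_quarter fc) //.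
  have -> : e * (s1 ^+ 2 + area x1 y1 s1) =
    e * ((s1 / 2) ^+ 2 + area x1 y1 (s1 / 2)) +
    e * ((s1 / 2) ^+ 2 + area (x1 + s1 / 2) y1 (s1 / 2)) +
    e * ((s1 / 2) ^+ 2 + area x1 (y1 + s1 / 2) (s1 / 2)) +
    e * ((s1 / 2) ^+ 2 + area (x1 + s1 / 2) (y1 + s1 / 2) (s1 / 2)).
    have E (v : R) : v + s1 / 2 + s1 / 2 = v + s1 by field.
    by rewrite /area !E; field.
  by do 3 rewrite (le_trans (normcD _ _)) // lerD //.
move=> a b xa yb; pose z := a +i* b.
have zQ : square x y s z by [].
have [z0|z0] := eqVneq z 0.
  (* At 0 only continuity is available. With the constant 8 of [square_int_bound] the integral is at
     most [e * s'], and [area] is at least [s']. *)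
  have /ccont_normcP/(_ (e / 8)) := fc z; rewrite divr_gt0 // => /(_ isT).
  case=> r r0 fr; exists (r / 4); first lra.
  move=> x' y' s' /andP[s'0 s'r] _ _ _ _ x'a y'b.
  have zQ' : square x' y' s' z by [].
  have [a0 b0] : a = 0 /\ b = 0 by case: z0.
  rewrite -(square_intB_affine fc (f z) 0) //.
  have gc w : ccont (fun w => f w - (f z + 0 * w)) w.
    apply: ccontB (fc w) _; apply: ccontD; first exact: ccont_cst.
    by apply: ccontM; [exact: ccont_cst | exact: ccont_id].
  rewrite (le_trans (square_int_bound gc s'0 (M := e / 8) _)) //.
    move=> w wQ; rewrite mul0r addr0 ltW // fr //.
    by rewrite (le_lt_trans (square_diam zQ' wQ)) //; lra.
  have -> : 8 * (e / 8) * s' = e * s' by field.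
  rewrite ler_pM2l // (le_trans _ (_ : area x' y' s' <= _)) ?lerDr ?sqr_ge0 //.
  move: x'a y'b; rewrite a0 b0 => /andP[? ?] /andP[? ?].
  rewrite -{1}(sqr_sqrtr (ltW s'0)) expr2 /area.
  by rewrite ler_pM ?sqrtr_ge0 // phi0.
have [d Hd] := fd z zQ z0.
have [|r r0 fr] := Hd (e / 16); first by rewrite divr_gt0.
exists (r / 4); first lra.
move=> x' y' s' /andP[s'0 s'r] xx' xx's yy' yy's x'a y'b.
have zQ' : square x' y' s' z by [].
rewrite -(square_intB_affine fc (f z - d * z) d) //.
have gc w : ccont (fun w => f w - (f z - d * z + d * w)) w.
  apply: ccontB (fc w) _; apply: ccontD; first exact: ccont_cst.
  by apply: ccontM; [exact: ccont_cst | exact: ccont_id].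
rewrite (le_trans (square_int_bound gc s'0 (M := e / 16 * (2 * s')) _)) //.
  move=> w wQ; have wd := square_diam zQ' wQ.
  have -> : f w - (f z - d * z + d * w) = f w - f z - d * (w - z) by ring.
  have wQ0 : square x y s w.
    case: wQ => /andP[? ?] /andP[? ?].
    by split; apply/andP; split; lra.
  rewrite (le_trans (fr w _ wQ0)) //; first by rewrite (le_lt_trans wd) //; lra.
  by rewrite ler_pM2l // divr_gt0.
have -> : 8 * (e / 16 * (2 * s')) * s' = e * s' ^+ 2 by field.
by rewrite ler_pM2l // lerDl area_ge0.
Qed.

End Goursat.

Section WeakMaximum.
Variable R : realType.
Local Notation C := R[i].

Definition clamp (h t : R) : R := Num.max (- h) (Num.min h t).

Lemma clamp_lip h (s t : R) : `|clamp h s - clamp h t| <= `|s - t|.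
Proof.
have maxL (a u v : R) : `|Num.max a u - Num.max a v| <= `|u - v|.
  have := ler_norm (u - v); have := ler_norm (v - u); rewrite distrC => ? ?.
  rewrite ler_norml; case: (leP a u) => ?; case: (leP a v) => ?;
  apply/andP; split; lra.
have minL (a u v : R) : `|Num.min a u - Num.min a v| <= `|u - v|.
  have := ler_norm (u - v); have := ler_norm (v - u); rewrite distrC => ? ?.
  rewrite ler_norml; case: (leP a u) => ?; case: (leP a v) => ?;
  apply/andP; split; lra.
exact: le_trans (maxL _ _ _) (minL _ _ _).
Qed.

Lemma clamp_itv h t : 0 <= h -> - h <= clamp h t <= h.
Proof.
by move=> ?; rewrite /clamp; case: (leP h t) => ?; case: (leP (- h) h) => ?;
  case: (leP (- h) t) => ?;
  apply/andP; split; lra.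
Qed.

Lemma clamp_id h t : - h <= t <= h -> clamp h t = t.
Proof.
by move=> /andP[? ?]; rewrite /clamp; case: (leP h t) => ?; case: (leP (- h) h) => ?;
  case: (leP (- h) t) => ?; lra.
Qed.

(** The retraction onto the square; composing with it turns a function on the square into a globally
    continuous one, as the lemmas on [square_int] require. *)
Definition clampC (h : R) (z : C) : C := clamp h (Re z) +i* clamp h (Im z).

Lemma ccont_clampC h z : ccont (clampC h) z.
Proof.
apply/ccont_normcP => e e0; exists (e / 2); first lra.
move=> w wz; rewrite (le_lt_trans (normc_le_ReIm _)) // ReB ImB /=.
have := clamp_lip h (Re w) (Re z); have := clamp_lip h (Im w) (Im z).
have := Re_le_normc (w - z); have := Im_le_normc (w - z); rewrite ReB ImB; lra.
Qed.

Definition centered_square (h : R) : set C := square (- h) (- h) (2 * h).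

Lemma centered_squareP h z :
  centered_square h z <-> - h <= Re z <= h /\ - h <= Im z <= h.
Proof. by rewrite /centered_square /square /= (_ : - h + 2 * h = h) //; ring. Qed.

Lemma clampC_square h z : 0 <= h -> centered_square h (clampC h z).
Proof. by move=> h0; apply/centered_squareP; rewrite /= !clamp_itv. Qed.

Lemma clampC_id h z : centered_square h z -> clampC h z = z.
Proof.
by move=> /centered_squareP[? ?]; rewrite /clampC !clamp_id //; case: (z).
Qed.

Lemma centered_square_near h z : normc z <= h -> centered_square h z.
Proof.
move=> zh; apply/centered_squareP; rewrite -!ler_norml.
by rewrite !(le_trans _ zh) ?Re_le_normc ?Im_le_normc.
Qed.

(* Cauchy's formula at the centre applied to the powers of [u]: letting the
   exponent grow removes the constant coming from the length of the contour. *)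
Lemma weak_maximum (u : C -> C) (h M : R) : 0 < h ->
  (forall z, centered_square h z -> cdiff u z) ->
  (forall z, centered_square h z -> `|Re z| = h \/ `|Im z| = h -> normc (u z) <= M) ->
  normc (u 0) <= M.
Proof.
move=> h0 ud uM; have hge0 := ltW h0.
have M0 : 0 <= M.
  apply: (le_trans (normc_ge0 (u h%:C))); apply: uM; last by left; rewrite /= ger0_norm.
  by apply: centered_square_near; rewrite normcR ger0_norm.
suff key N : normc (u 0) ^+ N <= 4 * M ^+ N.
  rewrite leNgt; apply/negP => Mu.
  have [M00|Mpos] := leP M 0.
    have Meq : M = 0 by apply/eqP; rewrite eq_le M00 M0.
    by have := key 1%N; rewrite !expr1 Meq mulr0; rewrite Meq in Mu; lra.
  pose x := normc (u 0) / M - 1.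
  have x0 : 0 < x by rewrite subr_gt0 ltr_pdivlMr // mul1r.
  have [N HN] : exists N, 4 < 1 + x *+ N.
    have [k Hk] := ltr_add_invr (divr_gt0 x0 (ltr0Sn R 3)).
    exists k.+1; move: Hk; rewrite add0r ltr_pdivlMr ?ltr0Sn // => Hk.
    have k0 : 0 < (k.+1%:R : R) by rewrite ltr0Sn.
    have : 4 < x * k.+1%:R by rewrite -ltr_pdivrMr // mulrC.
    by rewrite mulr_natr; lra.
  have bern k : 1 + x *+ k <= (1 + x) ^+ k.
    elim: k => [|k IH]; first by rewrite mulr0n addr0 expr0.
    have : (1 + x) * (1 + x *+ k) <= (1 + x) * (1 + x) ^+ k by rewrite ler_pM2l //; lra.
    have : 0 <= x * (x *+ k) by rewrite mulr_ge0 ?mulrn_wge0 // ltW.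
    rewrite exprS mulrS; lra.
  have := key N; rewrite -ler_pdivrMr ?exprn_gt0 // -expr_div_n.
  have -> : normc (u 0) / M = 1 + x by rewrite /x; ring.
  have := bern N; lra.
pose v (w : C) := u (clampC h w) ^+ N.
have vE w : centered_square h w -> v w = u w ^+ N by move=> /clampC_id; rewrite /v => ->.
have vc w : ccont v w.
  apply: (@ccont_comp _ _ w (clampC h) (fun z => u z ^+ N)); first exact: ccont_clampC.
  exact/cdiff_continuous/cdiffX/ud/clampC_square.
have sq0 : centered_square h (0 : C) by apply: centered_square_near; rewrite normc0.
have [d [q qc qd Hq]] : cdiff (fun w => u w ^+ N) (0 : C) by exact/cdiffX/ud.
(* The difference quotient is continuous at 0 but not known to be differentiable there; this is why
   [goursat] allows an exceptional point. *)
pose g w : C := if w == 0 then d else (v w - v 0) * w^-1.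
have nearsq : nearc (0 : C) (centered_square h).
  by exists h => // w; rewrite subr0 => /ltW; exact: centered_square_near.
have gc w : ccont g w.
  have [->|w0] := eqVneq w 0.
    apply: ccont_near qc; apply: nearcS2 Hq nearsq => w' Hw /vE vw.
    rewrite /g; case: eqVneq => [->//|w'0].
    by rewrite vw (vE _ sq0) Hw subr0 mulfK.
  have wc : ccont (fun w => (v w - v 0) * w^-1) w.
    apply: ccontM; last exact: (ccontV w0 (ccont_id w)).
    by apply: ccontB (vc w) _; exact: ccont_cst.
  apply: ccont_near wc; apply: nearcS (near_neq0 (ccont_id w) w0) => w' w'0.
  by rewrite /g (negPf w'0).
have gG : square_int g (- h) (- h) (2 * h) = 0.
  apply: goursat => //; first lra.
  move=> z zQ z0.
  have [d' Hd'] : cdiff (fun w => (u w ^+ N - u 0 ^+ N) * w^-1) z.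
    apply: cdiffM; last exact: (cdiffV (cdiff_id z) z0).
    by apply: cdiffB (cdiff_cst _ _); exact/cdiffX/ud.
  exists d' => e e0.
  apply: nearcS2 (cder_eps Hd' e0) (near_neq0 (ccont_id z) z0) => w Hw w0 wQ.
  by rewrite /g (negPf w0) (negPf z0) !vE.
have e1 : - h + 2 * h = h by ring.
pose k1 (f : C -> C) t := f (t +i* - h) - f (t +i* h).
pose k2 (f : C -> C) t := f (h +i* t) - f (- h +i* t).
have hne (t : R) : (t +i* - h != 0 :> C) /\ (t +i* h != 0 :> C).
  by rewrite !eq_complex /= oppr_eq0 (gt_eqF h0) !andbF.
have vne (t : R) : (h +i* t != 0 :> C) /\ (- h +i* t != 0 :> C).
  by rewrite !eq_complex /= oppr_eq0 (gt_eqF h0).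
have hcc (b t : R) : ccont (fun t : R => t +i* b : C) t.
  by split; apply: complex_cvg => /=; [exact: cvg_id | exact: cvg_cst].
have vcc (b t : R) : ccont (fun t : R => b +i* t : C) t.
  by split; apply: complex_cvg => /=; [exact: cvg_cst | exact: cvg_id].
pose W (w : C) := v w * w^-1; pose I1 (w : C) := w^-1.
have I1c : cc (k1 I1) /\ cc (k2 I1).
  split=> t; apply: ccontB; apply: ccontV; do ?[exact: hcc|exact: vcc];
  by have [] := hne t; have [] := vne t.
have Wc : cc (k1 W) /\ cc (k2 W).
  split=> t; apply: ccontB; apply: ccontM;
  do ?[exact: (cc_horizontal vc)|exact: (cc_vertical vc)];
  apply: ccontV; do ?[exact: hcc|exact: vcc];
  by have [] := hne t; have [] := vne t.
pose c0 : C := cig (k1 I1) (- h) h + 'i * cig (k2 I1) (- h) h.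
pose cW : C := cig (k1 W) (- h) h + 'i * cig (k2 W) (- h) h.
have Zc0 (k : R -> C) : cc k -> cc (fun t => - v 0 * k t).
  by move=> kc t; apply: ccontM (kc t); exact: ccont_cst.
have cWE : cW = v 0 * c0.
  move: gG; rewrite /square_int e1.
  have -> : cig (fun t => g (t +i* - h) - g (t +i* h)) (- h) h =
      cig (k1 W) (- h) h + - v 0 * cig (k1 I1) (- h) h.
    rewrite -cigZ -?cigD; [|by case: Wc|by apply: Zc0; case: I1c|by case: I1c].
    apply: eq_cig => t _; rewrite /g /k1 /W /I1.
    by have [/negPf -> /negPf ->] := hne t; ring.
  have -> : cig (fun t => g (h +i* t) - g (- h +i* t)) (- h) h =
      cig (k2 W) (- h) h + - v 0 * cig (k2 I1) (- h) h.
    rewrite -cigZ -?cigD; [|by case: Wc|by apply: Zc0; case: I1c|by case: I1c].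
    apply: eq_cig => t _; rewrite /g /k2 /W /I1.
    by have [/negPf -> /negPf ->] := vne t; ring.
  move=> /eqP; rewrite -subr_eq0 => /eqP E; apply/eqP; rewrite -subr_eq0; apply/eqP.
  by rewrite -[RHS]E /cW /c0; ring.
(* [c0] is the integral of [1 / z], that is [2 pi i]. A lower bound is enough: each pair of opposite
   sides contributes an integrand of at least [1 / h] over a length [2 h]. *)
have c04 : 4 <= normc c0.
  rewrite (le_trans _ (Im_le_normc _)) // (le_trans _ (ler_norm _)) //.
  have -> : Im c0 = Im (cig (k1 I1) (- h) h) + Re (cig (k2 I1) (- h) h).
    by rewrite /c0 ImD ImM /= mul0r mul1r add0r.
  have half (f : R -> R) : continuous f ->
      (forall t, - h <= t <= h -> h^-1 <= f t) -> 2 <= ig f (- h) h.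
    move=> fcont fh; rewrite (le_trans _ (le_ig (f := fun=> h^-1) _ fcont fh)) //.
      by rewrite ig_cst ?opprK; [rewrite mulrDr mulVf ?gt_eqF //; lra | lra].
    exact: cst_continuous.
  have kern (t : R) : - h <= t <= h -> h^-1 <= 2 * (h / (t ^+ 2 + h ^+ 2)).
    move=> /andP[? ?]; have th : 0 < t ^+ 2 + h ^+ 2.
      by have := exprn_gt0 2 h0; have := sqr_ge0 t; lra.
    rewrite mulrA ler_pdivlMr // mulrC ler_pdivrMr // expr2 expr2; nra.
  have [I1c1 I1c2] := I1c.
  rewrite (_ : 4 = 2 + 2); last by ring.
  apply: lerD.
    apply: (half _ (cc_Im I1c1)) => t tx.
    rewrite (le_trans (kern t tx)) // /k1 /I1 ImB /=.
    by rewrite sqrrN mulNr !opprK -mulr2n mulr_natl.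
  apply: (half _ (cc_Re I1c2)) => t tx.
  rewrite (le_trans (kern t tx)) // /k2 /I1 ReB /=.
  by rewrite sqrrN mulNr opprK -mulr2n mulr_natl addrC.
have cW16 : normc cW <= 16 * M ^+ N.
  have Mh : M ^+ N / h + M ^+ N / h = 2 * (M ^+ N / h) by ring.
  have Wb (z : C) : centered_square h z -> `|Re z| = h \/ `|Im z| = h ->
      normc (W z) <= M ^+ N / h.
    move=> zQ zh; rewrite /W normcM normcV vE // normcX ler_pM ?normc_ge0 //.
    - by rewrite exprn_ge0 // normc_ge0.
    - by rewrite invr_ge0 normc_ge0.
    - by rewrite lerXn2r ?nnegrE ?normc_ge0 // uM.
    - have hz : h <= normc z.
        by case: zh => <-; [exact: Re_le_normc | exact: Im_le_normc].
      by rewrite lef_pV2 ?posrE // (lt_le_trans h0).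
  rewrite /cW (le_trans (normcD _ _)) // normcM.
  have -> : normc ('i : C) = 1 by rewrite /normc /= expr0n add0r expr1n sqrtr1.
  rewrite mul1r (_ : 16 * M ^+ N =
    2 * (2 * (M ^+ N / h)) * (h - - h) + 2 * (2 * (M ^+ N / h)) * (h - - h)); last first.
    by field; rewrite gt_eqF.
  have hh : - h <= h by lra.
  have [Wc1 Wc2] := Wc.
  have hnn : `|- h| = h by rewrite normrN ger0_norm.
  have hn : `|h| = h by rewrite ger0_norm.
  apply: lerD; apply: cig_bound => // t tx; rewrite -Mh (le_trans (normcB _ _)) //;
    apply: lerD; apply: Wb => /=; do ?[by left|by right]; apply/centered_squareP => /=;
    by rewrite tx ?lexx ?hh.
have v0E : normc (v 0) = normc (u 0) ^+ N by rewrite vE // normcX.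
rewrite -v0E.
have : normc (v 0) * 4 <= 16 * M ^+ N.
  rewrite (le_trans _ cW16) // cWE normcM ler_wpM2l ?normc_ge0 //.
lra.
Qed.

End WeakMaximum.

(** * The maximum principle for sums of logarithms *)

Section LogModulus.
Variable R : realType.
Local Notation C := R[i].
Implicit Types (z w : C) (D : set C).

Definition lnc z : R := ln (normc z).

Lemma lncM z w : z != 0 -> w != 0 -> lnc (z * w) = lnc z + lnc w.
Proof. by move=> z0 w0; rewrite /lnc normcM lnM // posrE normc_gt0. Qed.

Lemma lncV z : z != 0 -> lnc z^-1 = - lnc z.
Proof. by move=> z0; rewrite /lnc normcV lnV // posrE normc_gt0. Qed.

Lemma lncX z k : z != 0 -> lnc (z ^+ k) = k%:R * lnc z.
Proof. by move=> z0; rewrite /lnc normcX lnXn ?normc_gt0 // mulr_natl. Qed.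

Lemma lnc_exprz z (k : int) : z != 0 -> lnc (z ^ k) = k%:~R * lnc z.
Proof.
move=> z0; case: k => k; first by rewrite -exprnP lncX.
by rewrite NegzE -exprnN lncV ?expf_neq0 // lncX // mulrNz mulNr.
Qed.

Lemma lnc_prod (I : Type) (r : seq I) (F : I -> C) : (forall i, F i != 0) ->
  lnc (\prod_(i <- r) F i) = \sum_(i <- r) lnc (F i).
Proof.
move=> F0; elim: r => [|i r IH]; first by rewrite !big_nil /lnc normc1 ln1.
by rewrite !big_cons lncM ?IH // prodf_seq_neq0; elim: r {IH} => //= j r ->; rewrite F0.
Qed.

Lemma cdiff_exprz (f : C -> C) (k : int) z :
  cdiff f z -> f z != 0 -> cdiff (fun w => f w ^ k) z.
Proof.
move=> fd f0; case: k => k.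
  exact: cdiffX.
apply: (@eq_cdiff _ (fun w => (f w ^+ k.+1)^-1)) => //.
by apply: cdiffV; [exact: cdiffX | rewrite expf_neq0].
Qed.

Definition rcont (g : C -> R) z :=
  forall e : R, 0 < e -> nearc z (fun w => `|g w - g z| < e).

Lemma rcont_within (g : C -> R) (K : set C) :
  (forall z, K z -> rcont g z) -> {within K, continuous g}.
Proof.
move=> gc; apply: continuous_in_subspaceT => z; rewrite inE => /gc gz.
by apply/real_continuous_normcP => e /gz[d d0 Hd]; exists d.
Qed.

Lemma rcontD (f g : C -> R) z : rcont f z -> rcont g z -> rcont (fun w => f w + g w) z.
Proof.
move=> fc gc e e0; have e2 : 0 < e / 2 by lra.
apply: nearcS2 (fc _ e2) (gc _ e2) => w; rewrite !ltr_norml.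
by move=> /andP[? ?] /andP[? ?]; apply/andP; split; lra.
Qed.

Lemma rcontZ (g : C -> R) k z : rcont g z -> rcont (fun w => k * g w) z.
Proof.
move=> gc e e0; have k0 : 0 < `|k| + 1 by rewrite ltr_wpDl.
apply: nearcS (gc (e / (`|k| + 1)) _); last by rewrite divr_gt0.
move=> w Hw; rewrite -mulrBr normrM.
rewrite ltr_pdivlMr // in Hw; rewrite (le_lt_trans _ Hw) // mulrC ler_wpM2l //; lra.
Qed.

Lemma rcont_sum (I : Type) (r : seq I) (F : I -> C -> R) z :
  (forall i, rcont (F i) z) -> rcont (fun w => \sum_(i <- r) F i w) z.
Proof.
move=> Fc; elim: r => [|i r IH] e e0.
  by apply: nearcW => w; rewrite !big_nil subrr normr0.
by apply: nearcS (rcontD (Fc i) IH e0) => w; rewrite !big_cons.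
Qed.

Lemma rcont_normc (f : C -> C) z : ccont f z -> rcont (fun w => normc (f w)) z.
Proof.
move=> /ccont_normcP fc e e0; apply: nearcS (fc e e0) => w; apply: le_lt_trans.
rewrite ler_norml lerNl opprB; apply/andP; split; last exact: ler_subnormc.
by rewrite normc_distC; exact: ler_subnormc.
Qed.

Lemma rcont_lnc (f : C -> C) z : ccont f z -> f z != 0 -> rcont (fun w => lnc (f w)) z.
Proof.
move=> fc f0 e e0; have n0 : 0 < normc (f z) by rewrite normc_gt0.
have /nbhs_ballP[d /= d0 Hd] : nbhs (normc (f z)) (fun t => `|ln (normc (f z)) - ln t| < e).
  exact: (iffLR (cvgrPdist_lt _ _) (continuous_ln n0) e e0).
apply: nearcS (rcont_normc fc d0) => w Hw; rewrite distrC; apply: Hd.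
by rewrite /ball /= distrC.
Qed.

(** [ln |prod f_i^beta_i|] for real exponents, where the product itself is multivalued. *)
Definition logsum (I : finType) (beta : I -> R) (f : I -> C -> C) (z : C) : R :=
  \sum_i beta i * lnc (f i z).

Lemma rcont_logsum (I : finType) (beta : I -> R) (f : I -> C -> C) z :
  (forall i, cdiff (f i) z) -> (forall i, f i z != 0) -> rcont (logsum beta f) z.
Proof.
move=> fd f0; apply: rcont_sum => i; apply: rcontZ.
by apply: rcont_lnc => //; exact: cdiff_continuous.
Qed.

Lemma closed_centered_square h : closed (centered_square h : set C).
Proof.
apply: closed_normc => z H; apply/centered_squareP.
have K e : 0 < e -> - h <= Re z + e /\ Re z - e <= h /\
    - h <= Im z + e /\ Im z - e <= h.
  move=> e0; have [w /centered_squareP[/andP[? ?] /andP[? ?]] wz] := H e e0.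
  have := le_lt_trans (Re_le_normc _) wz; have := le_lt_trans (Im_le_normc _) wz.
  by rewrite ReB ImB !ltr_norml => /andP[? ?] /andP[? ?]; repeat split; lra.
split; apply/andP; split; rewrite leNgt; apply/negP => hz.
- have := K ((- h - Re z) / 2); lra.
- have := K ((Re z - h) / 2); lra.
- have := K ((- h - Im z) / 2); lra.
- have := K ((Im z - h) / 2); lra.
Qed.

Lemma compact_centered_square h : compact (centered_square h : set C).
Proof.
apply: (@closed_bounded_compact _ _ (h + h)); first exact: closed_centered_square.
move=> z /centered_squareP[? ?]; rewrite (le_trans (normc_le_ReIm _)) //.
by apply: lerD; rewrite ler_norml.
Qed.

(** [N beta_i] is rounded to integers [p i]. For every [N] this changes the logarithm by at most
    [B], the maximum over the square of the sum of the [|ln |f_i||], and the product with integer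
    exponents is holomorphic. Dividing by [N] removes the error. *)
Lemma weak_maximum_log (I : finType) (beta : I -> R) (f : I -> C -> C) (z0 : C) (h M : R) :
  0 < h ->
  (forall w, centered_square h w -> forall i, cdiff (f i) (z0 + w)) ->
  (forall w, centered_square h w -> forall i, f i (z0 + w) != 0) ->
  (forall w, centered_square h w -> `|Re w| = h \/ `|Im w| = h ->
     logsum beta f (z0 + w) <= M) ->
  logsum beta f z0 <= M.
Proof.
move=> h0 fd f0 fM.
pose g i w := f i (z0 + w).
have gd w i : centered_square h w -> cdiff (g i) w.
  move=> wQ; apply: (@cdiff_comp _ (fun w => z0 + w) (f i)); last exact: fd.
  by apply: cdiffD; [exact: cdiff_cst | exact: cdiff_id].
have sq0 : centered_square h (0 : C) by apply: centered_square_near; rewrite normc0 ltW.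
pose S w := \sum_i `|lnc (g i w)|.
have Sc w : centered_square h w -> rcont S w.
  move=> wQ; apply: rcont_sum => i e e0.
  have gc := cdiff_continuous (gd w i wQ).
  apply: nearcS (rcont_lnc gc (f0 w wQ i) e0) => w'.
  by apply: le_lt_trans; exact: ler_dist_dist.
have [c _ Hc] := compact_EVT_max (ex_intro _ _ sq0) (@compact_centered_square h) (rcont_within Sc).
pose B := S c.
have SB w : centered_square h w -> S w <= B by move=> ?; apply: Hc; rewrite inE.
have B0 : 0 <= B by apply: le_trans (SB _ sq0); apply: sumr_ge0.
suff key N : N%:R * (logsum beta f z0 - M) <= 2 * B.
  rewrite leNgt; apply/negP => ML.
  have L0 : 0 < logsum beta f z0 - M by rewrite subr_gt0.
  have B1 : 0 < 2 * B + 1 by lra.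
  have [k] := ltr_add_invr (divr_gt0 L0 B1).
  rewrite add0r ltr_pdivlMr // => Hk.
  have k0 : 0 < (k.+1%:R : R) by rewrite ltr0Sn.
  have := key k.+1; rewrite mulrC in Hk; rewrite ltr_pdivrMr // mulrC in Hk; lra.
pose p i : int := Num.floor (N%:R * beta i).
have pE i : `|(p i)%:~R - N%:R * beta i| <= 1.
  have /andP[? ] := floor_itv (N%:R * beta i); rewrite intrD => ?.
  by rewrite ler_norml /p; apply/andP; split; lra.
pose u w := \prod_i g i w ^ p i.
have u0 w : centered_square h w -> u w != 0.
  by move=> wQ; apply/prodf_neq0 => i _; rewrite expfz_neq0 // f0.
have uE w : centered_square h w -> `|lnc (u w) - N%:R * logsum beta g w| <= B.
  move=> wQ; rewrite /u lnc_prod; last by move=> i; rewrite expfz_neq0 // f0.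
  rewrite /logsum mulr_sumr -sumrB (le_trans _ (SB w wQ)) //.
  rewrite (le_trans (ler_norm_sum _ _ _)) // ler_sum // => i _.
  rewrite lnc_exprz ?f0 // mulrA -mulrBl normrM ler_piMl // pE.
have uM : normc (u 0) <= expR (N%:R * M + B).
  apply: (weak_maximum h0).
    move=> w wQ; apply: cdiff_prod => i; apply: cdiff_exprz; [exact: gd | exact: f0].
  move=> w wQ wh; rewrite -[normc _]lnK ?posrE ?normc_gt0 ?u0 // ler_expR.
  have := uE w wQ; rewrite ler_norml => /andP[_].
  have : N%:R * logsum beta g w <= N%:R * M by rewrite ler_wpM2l // fM.
  by rewrite /lnc; lra.
have g0E : logsum beta g 0 = logsum beta f z0 by rewrite /logsum /g addr0.
have := uE 0 sq0; rewrite g0E ler_norml => /andP[+ _].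
have : lnc (u 0) <= N%:R * M + B.
  by rewrite -[X in _ <= X]expRK ler_ln ?posrE ?expR_gt0 ?normc_gt0 ?u0.
by rewrite mulrBr; lra.
Qed.

(** From [ln (1 + y) <= y], since [|1 + x|^2 = 1 + 2 Re x + |x|^2]. *)
Lemma lnc_1D (x : C) : normc x < 1 -> lnc (1 + x) <= Re x + normc x ^+ 2 / 2.
Proof.
move=> x1; have x0 : 1 + x != 0.
  apply/eqP => E; have Ex : x = -1 by rewrite -[LHS](addKr 1) E addr0.
  by move: x1; rewrite Ex normcNE normc1 ltxx.
have n0 : 0 < normc (1 + x) by rewrite normc_gt0.
suff : 2 * lnc (1 + x) <= 2 * Re x + normc x ^+ 2 by lra.
rewrite mulr_natl -lnXn // sqr_normcE sqr_normcE ReD ImD /= add0r.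
have -> : (1 + Re x) ^+ 2 + Im x ^+ 2 = 1 + (2 * Re x + (Re x ^+ 2 + Im x ^+ 2)).
  by ring.
apply: le_ln1Dx; have := exprn_gt0 2 n0; rewrite sqr_normcE ReD ImD /= add0r.
rewrite !expr2; nra.
Qed.

(* [H + eps |z|^2] is maximised at an interior point [z1]; the linear part of
   [|z|^2] at [z1] is cancelled by adding [ln |1 + 2 eps conj(z1) (z - z1)|]. *)
Lemma maximum_principle (I : finType) (beta : I -> R) (f : I -> C -> C) D (M : R) :
  open D -> (forall z, D z -> forall i, cdiff (f i) z) ->
  (forall z, D z -> forall i, f i z != 0) ->
  (forall e : R, 0 < e -> compact [set z | D z /\ M + e <= logsum beta f z]) ->
  forall z, D z -> logsum beta f z <= M.
Proof.
move=> oD fd f0 cK z Dz; rewrite leNgt; apply/negP => Mz.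
set H := logsum beta f in Mz cK *.
pose e := (H z - M) / 2.
have e0 : 0 < e by rewrite /e; lra.
set K := [set z | D z /\ M + e <= H z] in cK.
have KK := cK e e0; rewrite -/K in KK.
have Kz : K z by split => //; rewrite /e; lra.
have [rho Hrho] := compact_bounded_normc KK.
have rho0 : 0 <= rho by apply: le_trans (Hrho z Kz); exact: normc_ge0.
pose rr := rho ^+ 2 + 1.
have rr0 : 0 < rr by rewrite /rr; have := sqr_ge0 rho; lra.
(* The first bound keeps [H] above the level [M + e] at the maximum of [G], away from the edge of
   [K]; the second makes the square of the linear correction small against [eps |w|^2]. *)
pose eps := Num.min (e / (2 * rr)) (1 / (4 * rr)).
have eps0 : 0 < eps by rewrite lt_min; apply/andP; split; apply: divr_gt0 => //; apply: mulr_gt0.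
have eps1 : eps * rr <= e / 2.
  by rewrite -ler_pdivlMr // -mulrA -invfM ge_min lexx.
have eps2 : eps * rr <= 1 / 4.
  by rewrite -ler_pdivlMr // -[_ / 4 / _]mulrA -invfM ge_min lexx orbT.
pose G w := H w + eps * normc w ^+ 2.
have Hc w : D w -> rcont H w by move=> Dw; apply: rcont_logsum => i; [exact: fd | exact: f0].
have sqc w : rcont (fun w : C => normc w ^+ 2) w.
  have : rcont (fun w : C => normc (w * w)) w.
    by apply: rcont_normc; apply: ccontM; exact: ccont_id.
  by move=> Hs e' /Hs; apply: nearcS => w'; rewrite !normcM !expr2.
have Gc w : K w -> rcont G w.
  by move=> [Dw _]; apply: rcontD; [exact: Hc | exact: rcontZ].
have [z1 Kz1 Hz1] := compact_EVT_max (ex_intro _ _ Kz) KK (rcont_within Gc).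
rewrite inE in Kz1; have [Dz1 _] := Kz1.
have sqK w : K w -> 0 <= normc w ^+ 2 <= rr.
  move=> Kw; rewrite sqr_ge0 /= /rr; have := Hrho w Kw; have := normc_ge0 w => ? ?.
  rewrite !expr2; nra.
have Gz := Hz1 z (mem_set Kz).
have Mz1 : M + e < H z1.
  have /andP[? ?] := sqK z1 Kz1; have /andP[? ?] := sqK z Kz.
  have : eps * normc z1 ^+ 2 <= eps * rr by rewrite ler_pM2l.
  have : 0 <= eps * normc z ^+ 2 by rewrite mulr_ge0 // ltW.
  move: Gz; rewrite /G /e in eps1 e0 *; lra.
have nearK : nearc z1 (fun w => D w /\ G w <= G z1).
  have e'0 : 0 < H z1 - (M + e) by lra.
  apply: nearcS2 (open_nearc oD Dz1) (Hc z1 Dz1 _ e'0) => w Dw.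
  rewrite ltr_norml => /andP[? _]; split => //.
  by apply: Hz1; rewrite inE; split => //; lra.
have [r r0 Hr] := nearK.
(* [Re (lam * w)] is the part of [eps |z1 + w|^2] that is linear in [w]. *)
pose lam : C := (2 * eps)%:C * conjc z1.
have lamN : normc lam ^+ 2 = 4 * eps ^+ 2 * normc z1 ^+ 2.
  rewrite /lam normcM exprMn normcR ger0_norm; last by lra.
  by rewrite [normc z1 ^+ 2]sqr_normcE [normc (conjc z1) ^+ 2]sqr_normcE; case: (z1) => /= a b; ring.
(* Points of the square have modulus at most [2 h]: they stay in the disc of radius [r], and
   [|lam * w| < 1] keeps the extra factor off 0. *)
pose h := Num.min (r / 4) (1 / (4 * (normc lam + 1))).
have lam1 : 0 < normc lam + 1 by rewrite ltr_wpDl ?normc_ge0.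
have h0 : 0 < h by rewrite lt_min; apply/andP; split; apply: divr_gt0 => //; apply: mulr_gt0.
have hr : h <= r / 4 by rewrite ge_min lexx.
have hl : h * (normc lam + 1) <= 1 / 4.
  by rewrite -ler_pdivlMr // -[_ / 4 / _]mulrA -invfM ge_min lexx orbT.
have hw w : centered_square h w -> normc w <= 2 * h.
  move=> /centered_squareP[? ?]; rewrite (le_trans (normc_le_ReIm _)) //.
  by rewrite mulr2n mulrDl mul1r; apply: lerD; rewrite ler_norml.
have lw w : centered_square h w -> normc (lam * w) < 1.
  move=> /hw wh; rewrite normcM.
  have : normc lam * normc w <= normc lam * (2 * h) by rewrite ler_wpM2l ?normc_ge0.
  by have := normc_ge0 lam; nra.
pose beta' (i : I + unit) := if i is inl j then beta j else 1.
pose f' (i : I + unit) (w : C) : C := if i is inl j then f j w else 1 + lam * (w - z1).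
have logE w : logsum beta' f' w = H w + lnc (1 + lam * (w - z1)).
  by rewrite /logsum big_sumType /= big_const card_unit /= addr0 mul1r.
have near_w w : centered_square h w -> D (z1 + w) /\ G (z1 + w) <= G z1.
  move=> /hw wh; apply: Hr; rewrite addrAC subrr add0r; lra.
have big_h : 0 < eps / 2 * h ^+ 2 by rewrite mulr_gt0 ?divr_gt0 // exprn_gt0.
(* At [z1] the sum equals [H z1]. On the boundary of the square, where [|w| >= h], the term
   [- eps |w|^2] is at least twice the error of [lnc_1D], so the sum is smaller there by a fixed
   amount. *)
suff : logsum beta' f' z1 <= H z1 - eps / 2 * h ^+ 2.
  rewrite logE subrr mulr0 addr0 /lnc normc1 ln1; lra.
apply: (@weak_maximum_log _ beta' f' z1 h _ h0).
- move=> w wQ [j|[]] /=; first by apply: fd; have [] := near_w w wQ.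
  apply: cdiffD; first exact: cdiff_cst.
  apply: cdiffM; first exact: cdiff_cst.
  by apply: cdiffB; [exact: cdiff_id | exact: cdiff_cst].
- move=> w wQ [j|[]] /=; first by apply: f0; have [] := near_w w wQ.
  rewrite addrAC subrr add0r; apply: contraTneq (lw w wQ) => E.
  have -> : lam * w = -1 by rewrite -[LHS](addKr 1) E addr0.
  by rewrite normcNE normc1 ltxx.
move=> w wQ wh; rewrite logE.
have [Dw Gw] := near_w w wQ.
have := lnc_1D (lw w wQ); rewrite (_ : z1 + w - z1 = w); last by ring.
move=> Lw.
have hN : h ^+ 2 <= normc w ^+ 2.
  rewrite lerXn2r ?nnegrE ?normc_ge0 ?(ltW h0) //.
  by case: wh => <-; [exact: Re_le_normc | exact: Im_le_normc].
have Elin : normc (z1 + w) ^+ 2 = normc z1 ^+ 2 + 2 * (Re z1 * Re w + Im z1 * Im w) + normc w ^+ 2.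
  by rewrite !sqr_normcE ReD ImD; ring.
have Erel : Re (lam * w) = 2 * eps * (Re z1 * Re w + Im z1 * Im w).
  by rewrite /lam; case: (z1) (w) => [a b] [c d] /=; ring.
have lamw : normc (lam * w) ^+ 2 / 2 <= eps / 2 * normc w ^+ 2.
  rewrite normcM exprMn lamN.
  have /andP[z1a z1b] := sqK z1 Kz1.
  have P1 : eps * normc z1 ^+ 2 <= 1 / 4 by rewrite (le_trans _ eps2) // ler_pM2l.
  have P2 : 0 <= eps * normc w ^+ 2 by rewrite mulr_ge0 ?sqr_ge0 // ltW.
  have : (eps * normc z1 ^+ 2) * (eps * normc w ^+ 2) <= 1 / 4 * (eps * normc w ^+ 2).
    by rewrite ler_wpM2r.
  lra.
have : eps / 2 * h ^+ 2 <= eps / 2 * normc w ^+ 2 by rewrite ler_pM2l ?divr_gt0.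
move: Gw; rewrite /G Elin !mulrDr; rewrite Erel in Lw; lra.
Qed.

End LogModulus.

(** * Open mappings *)

Section OpenMapping.
Variable R : realType.
Local Notation C := R[i].
Implicit Types (z w y : C) (f : C -> C).

Lemma closed_rcont_le (g : C -> R) (c : R) :
  (forall z, rcont g z) -> closed [set z | g z <= c].
Proof.
move=> gc; apply: closed_normc => z H; rewrite /= leNgt; apply/negP => cg.
have [|d d0 Hd] := gc z (g z - c); first by rewrite subr_gt0.
have [w /= wc wz] := H d d0; have := Hd w wz; rewrite ltr_norml; lra.
Qed.

Lemma rcont_abs_normc z : rcont (@normc R) z.
Proof. exact: (rcont_normc (ccont_id z)). Qed.

Lemma compact_square_boundary (h : R) :
  compact [set w : C | centered_square h w /\ (`|Re w| = h \/ `|Im w| = h)].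
Proof.
pose I := [set w : C | `|Re w| < h /\ `|Im w| < h].
have oI : open I.
  apply: open_normc => z [z1 z2].
  exists (Num.min (h - `|Re z|) (h - `|Im z|)); first by rewrite lt_min !subr_gt0 z1.
  move=> w; rewrite lt_min => /andP[w1 w2].
  have := Re_le_normc (w - z); have := Im_le_normc (w - z); rewrite ReB ImB => ? ?.
  split; first by have := ler_normD (Re w - Re z) (Re z); rewrite subrK; lra.
  by have := ler_normD (Im w - Im z) (Im z); rewrite subrK; lra.
have -> : [set w : C | centered_square h w /\ (`|Re w| = h \/ `|Im w| = h)] =
    centered_square h `&` ~` I.
  apply/seteqP; split => w /= [wQ H]; split => //.
    by move=> [w1 w2]; case: H => E; [move: w1 | move: w2]; rewrite E ltxx.
  have /centered_squareP[] := wQ; rewrite -!ler_norml => w1 w2.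
  apply: contrapT => /not_orP[n1 n2]; apply: H; split; rewrite lt_neqAle.
    by rewrite w1 andbT; apply/eqP.
  by rewrite w2 andbT; apply/eqP.
apply: (subclosed_compact _ (@compact_centered_square R h)); last by move=> ? [].
by apply: closedI; [exact: closed_centered_square | exact: open_closedC].
Qed.

(** If [y] were omitted, [1 / (f - y)] would be holomorphic on a small square. With [d] the minimum
    of [|f - f z0|] on the boundary and [y] within [d / 2] of [f z0], its modulus at the centre
    would exceed the bound [2 / d] that holds on the boundary. *)
Lemma open_mapping f z0 (r : R) : nearc z0 (cdiff f) ->
  nearc z0 (fun w => f w = f z0 -> w = z0) -> 0 < r ->
  nearc (f z0) (fun y => exists2 z, normc (z - z0) < r & f z = y).
Proof.
move=> fd fi r0.
have [s s0 Hs] := nearcI fd fi.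
pose h := Num.min r s / 4.
have h0 : 0 < h by rewrite divr_gt0 // lt_min r0.
have hr : 2 * h < r.
  have : Num.min r s <= r by rewrite ge_min lexx.
  by have : 0 < Num.min r s; rewrite ?lt_min ?r0 // /h; lra.
have hs : 2 * h < s.
  have : Num.min r s <= s by rewrite ge_min lexx orbT.
  by have : 0 < Num.min r s; rewrite ?lt_min ?r0 // /h; lra.
have hw w : centered_square h w -> normc w <= 2 * h.
  move=> /centered_squareP[? ?]; rewrite (le_trans (normc_le_ReIm _)) //.
  by rewrite mulr2n mulrDl mul1r; apply: lerD; rewrite ler_norml.
have shiftE w : normc (z0 + w - z0) = normc w by congr normc; ring.
have near_w w : centered_square h w -> cdiff f (z0 + w) /\ (f (z0 + w) = f z0 -> z0 + w = z0).
  by move=> /hw ?; apply: Hs; rewrite shiftE; lra.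
have gd w : centered_square h w -> cdiff (fun w => f (z0 + w)) w.
  move=> /near_w[? _]; apply: (@cdiff_comp _ (fun w => z0 + w) f) => //.
  by apply: cdiffD; [exact: cdiff_cst | exact: cdiff_id].
set Q := [set w : C | centered_square h w /\ (`|Re w| = h \/ `|Im w| = h)].
have Qh : Q h%:C.
  split; last by left; rewrite /= ger0_norm // ltW.
  by apply: centered_square_near; rewrite normcR ger0_norm // ltW.
have gc w : Q w -> rcont (fun w => normc (f (z0 + w) - f z0)) w.
  move=> [wQ _]; apply: rcont_normc; apply: ccontB; last exact: ccont_cst.
  exact/cdiff_continuous/gd.
have [c Qc Hc] := compact_EVT_min (ex_intro _ _ Qh) (@compact_square_boundary h) (rcont_within gc).
rewrite inE in Qc; set d := normc (f (z0 + c) - f z0) in Hc.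
have d0 : 0 < d.
  rewrite normc_gt0 subr_eq0; apply/eqP => E.
  have [cQ cb] := Qc; have [_ /(_ E) E0] := near_w c cQ.
  have c00 : c = 0 by rewrite -[LHS](addKr z0) E0 addNr.
  by move: cb; rewrite c00 /= normr0 => -[] E1; move: h0; rewrite -E1 ltxx.
exists (d / 2); first lra.
move=> y yd; apply: contrapT => /forall2NP noz.
have fy w : centered_square h w -> f (z0 + w) - y != 0.
  move=> wQ; rewrite subr_eq0; apply/eqP => E.
  have [|//] := noz (z0 + w).
  by rewrite shiftE => H; apply: H; have := hw w wQ; lra.
have sq0 : centered_square h (0 : C) by apply: centered_square_near; rewrite normc0 ltW.
have : normc ((f (z0 + 0) - y)^-1) <= (d / 2)^-1.
  apply: (@weak_maximum _ (fun w => (f (z0 + w) - y)^-1) h _ h0).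
    move=> w wQ; apply: cdiffV; last exact: fy.
    by apply: cdiffB; [exact: gd | exact: cdiff_cst].
  move=> w wQ wb; rewrite normcV lef_pV2 ?posrE ?normc_gt0 ?fy //; last by lra.
  have := Hc w; rewrite inE => /(_ (conj wQ wb)).
  have := normc_triangle y (f (z0 + w)) (f z0); lra.
rewrite addr0 normcV lef_pV2 ?posrE; first by rewrite normc_distC; lra.
- by have := fy 0 sq0; rewrite addr0 normc_gt0.
- lra.
Qed.

End OpenMapping.

(** * Continuity of the inverse of an exterior conformal map *)

Section ExteriorMap.
Variable R : realType.
Local Notation C := R[i].
Variables (K K' : set C) (f : C -> C) (alpha : C).
Hypothesis Kclosed : closed K.
Hypothesis Kbounded : exists M : R, forall z, K z -> normc z <= M.
Hypothesis fd : forall z, ~ K z -> cdiff f z.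
Hypothesis finj : forall z w, ~ K z -> ~ K w -> f z = f w -> z = w.
Hypothesis fsurj : forall y, ~ K' y -> exists2 z, ~ K z & f z = y.
Hypothesis alpha0 : alpha != 0.
Hypothesis fasym : forall e : R, 0 < e -> exists r : R, forall z, r < normc z ->
  normc (f z - alpha * z) <= e * normc z.

Let oK : open (~` K). Proof. exact: closed_openC. Qed.

Lemma exterior_open_mapping z (r : R) : ~ K z -> 0 < r ->
  nearc (f z) (fun y => exists2 x, normc (x - z) < r & f x = y).
Proof.
move=> nKz r0; apply: open_mapping => //.
  by apply: nearcS (open_nearc oK nKz) => w; exact: fd.
by apply: nearcS (open_nearc oK nKz) => w nKw; exact: finj.
Qed.

(* Open mapping at 0 for [zeta |-> 1 / f (1 / zeta)]. *)
Lemma exterior_proper_infty (rho : R) : exists Y : R, forall z, ~ K z ->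
  Y < normc (f z) -> rho < normc z.
Proof.
pose g (z : C) := if z == 0 then alpha else z * f z^-1.
have gc : ccont g 0.
  apply/ccont_normcP => e e0; have e2 : 0 < e / 2 by lra.
  have [r Hr] := fasym e2.
  have r0 : 0 < `|r| + 1 by rewrite ltr_wpDl.
  exists (`|r| + 1)^-1; first by rewrite invr_gt0.
  move=> z; rewrite subr0 /g eqxx; case: eqVneq => [->|z0 zr].
    by rewrite subrr normc0.
  have nz : 0 < normc z by rewrite normc_gt0.
  have zr' : r < normc z^-1.
    rewrite normcV; rewrite -(ltf_pV2 _ _) ?posrE ?invr_gt0 // invrK in zr.
    by have := ler_norm r; lra.
  have := Hr _ zr'; rewrite normcV -ler_pdivrMr ?invr_gt0 // invrK => H.
  have -> : z * f z^-1 - alpha = (f z^-1 - alpha * z^-1) * z by field.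
  by rewrite normcM; lra.
(* For non-zero [z] this is [1 / f (1 / z)]; it is differentiable at 0 because [g] is continuous
   there with the non-zero value [alpha]. *)
pose k (z : C) := z * (g z)^-1.
have g0 : g 0 != 0 by rewrite /g eqxx.
have [M KM] := Kbounded.
have M10 : 0 < `|M| + 1 by rewrite ltr_wpDl.
have small : nearc (0 : C) (fun z => normc z < (`|M| + 1)^-1).
  by exists (`|M| + 1)^-1; rewrite ?invr_gt0 // => w; rewrite subr0.
have nKV (z : C) : z != 0 -> normc z < (`|M| + 1)^-1 -> ~ K z^-1.
  move=> z0 zM /KM; apply/negP; rewrite -ltNge normcV.
  have nz : 0 < normc z by rewrite normc_gt0.
  rewrite -(ltf_pV2 _ _) ?posrE ?invr_gt0 // invrK in zM.
  by have := ler_norm M; lra.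
have kd : nearc (0 : C) (cdiff k).
  apply: nearcS2 (near_neq0 gc g0) small => z gz zs.
  have [->|z0] := eqVneq z 0.
    exists (g 0)^-1; exists (fun z => (g z)^-1) => //; first exact: ccontV.
    by apply: nearcW => w; rewrite /k mul0r !subr0 mulrC.
  apply: cdiffM; first exact: cdiff_id.
  apply: cdiffV => //.
  apply: (@cdiff_near _ (fun z => z * f z^-1)).
    by apply: nearcS (near_neq0 (ccont_id z) z0) => w w0; rewrite /g (negPf w0).
  apply: cdiffM; first exact: cdiff_id.
  apply: (@cdiff_comp _ (fun z => z^-1) f); first exact: cdiffV (cdiff_id z) z0.
  by apply: fd; exact: nKV.
have kinj : nearc (0 : C) (fun w => k w = k 0 -> w = 0).
  apply: nearcS (near_neq0 gc g0) => w gw; rewrite /k mul0r => /eqP.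
  by rewrite mulf_eq0 invr_eq0 (negPf gw) orbF => /eqP.
pose s := Num.min (`|rho| + 1)^-1 (`|M| + 1)^-1.
have rho10 : 0 < `|rho| + 1 by rewrite ltr_wpDl.
have s0 : 0 < s by rewrite lt_min !invr_gt0 rho10.
have [d d0 Hd] := open_mapping kd kinj s0.
exists d^-1 => z nKz fzd.
have fz0 : 0 < normc (f z) by rewrite (lt_trans _ fzd) // invr_gt0.
have fzn0 : f z != 0 by rewrite -normc_gt0.
have [|w] := Hd (f z)^-1.
  by rewrite {1}/k mul0r subr0 normcV -[d]invrK ltf_pV2 ?posrE ?invr_gt0.
rewrite subr0 lt_min => /andP[wrho wM] kw.
have w0 : w != 0.
  by apply/eqP => E; move: kw; rewrite E /k mul0r => /esym/eqP; rewrite invr_eq0 (negPf fzn0).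
have fw : f w^-1 = f z.
  apply: invr_inj; rewrite -kw /k /g (negPf w0).
  by rewrite invfM mulrA divff // mul1r.
have <- : w^-1 = z by apply: finj => //; exact: nKV.
have nw : 0 < normc w by rewrite normc_gt0.
rewrite normcV; rewrite -(ltf_pV2 _ _) ?posrE ?invr_gt0 // invrK in wrho.
by have := ler_norm rho; lra.
Qed.

(** If points with values in [B] approached a point [z] of [K], these values would be bounded and
    accumulate at some [y] in [B], which has a preimage [x] off [K]. The image of a small disc
    around [x] covers a neighbourhood of [y], so by injectivity the points would be near [x], not
    near [z]. Compactness is used in covering form. *)
Lemma exterior_preimage_closed (B : set C) : closed B -> B `<=` ~` K' ->
  closed [set z | ~ K z /\ B (f z)].
Proof.
move=> cB BK' z cz.
have [Kz|nKz] := pselect (K z); last first.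
  split => //; apply: contrapT => nB.
  have fc := cdiff_continuous (fd nKz).
  have /nearcP := ccont_preimage fc (open_nearc (closed_openC cB) nB).
  by move=> /cz[w [[_ ?] ?]].
exfalso.
have [Y HY] := exterior_proper_infty (normc z + 1).
pose S := [set y | B y /\ normc y <= Y].
have cS : compact S.
  apply: (@closed_bounded_compact _ _ Y); last by move=> ? [].
  exact: (closedI cB (closed_rcont_le (@rcont_abs_normc R))).
have /compact_near_coveringP ncS := cS.
have wrap : \forall i \near nbhs z, S `<=` (fun y => ~ K i -> f i <> y).
  apply: ncS => y [By _].
  have [x nKx fx] := fsurj (BK' y By).
  have xz : x != z by apply/eqP => E; apply: nKx; rewrite E.
  pose r := normc (x - z) / 2.
  have r0 : 0 < r by rewrite divr_gt0 // normc_gt0 subr_eq0.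
  have [r1 r10 Hr1] := open_nearc oK nKx.
  pose s := Num.min r r1.
  have s0 : 0 < s by rewrite lt_min r0.
  have := exterior_open_mapping nKx s0; rewrite fx => /nearcP nearY.
  exists ([set y' | exists2 x0, normc (x0 - x) < s & f x0 = y'],
          [set i | normc (i - z) < r]).
    split => //; exact: near_normc.
  move=> [y' i] /= [[x0 x0x fx0] iz] nKi fi.
  move: x0x; rewrite lt_min => /andP[x0r x0r1].
  have E : i = x0 by apply: finj => //; [exact: Hr1 | rewrite fi].
  have := normc_triangle i x z; rewrite [normc (x - i)]normc_distC E in iz *.
  by rewrite -/r; rewrite /r in x0r iz *; lra.
have wrap2 : \forall i \near nbhs z, normc (i - z) < 1 by exact: near_normc.
have [w [[nKw Bw] [Hw w1]]] := cz _ (filterI wrap wrap2).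
apply: (Hw (f w)) => //; split => //.
rewrite leNgt; apply/negP => /(HY w nKw).
by have := ler_subnormc w z; lra.
Qed.

End ExteriorMap.

(** * Winding numbers *)

Section Winding.
Variable R : realType.
Local Notation C := R[i].
Implicit Types (x y t : R) (z w : C) (f g : R -> C).

Definition cis t : C := cos t +i* sin t.

Lemma cisD x y : cis (x + y) = cis x * cis y.
Proof. by apply: eqC; rewrite ?ReM ?ImM /= ?cosD ?sinD //; ring. Qed.

Lemma cis0 : cis 0 = 1. Proof. by rewrite /cis cos0 sin0. Qed.

Lemma normc_cis t : normc (cis t) = 1.
Proof.
apply/eqP; rewrite -(@eqrXn2 _ 2) // ?normc_ge0 // sqr_normcE expr1n /=.
by rewrite cos2Dsin2.
Qed.

Lemma cis_neq0 t : cis t != 0.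
Proof. by rewrite -normc_eq0 normc_cis oner_eq0. Qed.

Lemma cisN t : cis (- t) = (cis t)^-1.
Proof.
by apply: (mulfI (cis_neq0 t)); rewrite -cisD subrr cis0 divff // cis_neq0.
Qed.

Lemma cisB x y : cis (x - y) = cis x / cis y.
Proof. by rewrite cisD cisN. Qed.

Lemma cis_sum (I : Type) (r : seq I) (F : I -> R) :
  cis (\sum_(i <- r) F i) = \prod_(i <- r) cis (F i).
Proof. by elim/big_rec2: _ => [|i a b _ <-]; rewrite ?cis0 ?cisD. Qed.

Lemma cis_small t : cis t = 1 -> `|t| <= pi -> t = 0.
Proof.
move=> [c1 _] tpi; apply/eqP; rewrite -normr_eq0; apply/eqP.
apply: cos_inj; rewrite ?in_itv /= ?normr_ge0 ?lexx ?pi_ge0 //.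
by rewrite cos_norm c1 cos0.
Qed.

Lemma cis_2pi (k : int) : cis (k%:~R * (pi *+ 2)) = 1.
Proof.
have nat_case (n : nat) : cis (n%:R * (pi *+ 2)) = 1.
  elim: n => [|n IH]; first by rewrite mul0r cis0.
  by rewrite -addn1 natrD mulrDl mul1r cisD IH mul1r /cis cos2pi sin2pi.
case: k => n; first exact: nat_case.
by rewrite NegzE mulrNz mulNr cisN nat_case invr1.
Qed.

Lemma cis_eq1 t : cis t = 1 -> exists k : int, t = k%:~R * (pi *+ 2).
Proof.
move=> ct; have p0 : 0 < (pi : R) := pi_gt0 R.
have p2 : 0 < (pi *+ 2 : R) by rewrite mulrn_wgt0.
pose k := Num.floor (t / (pi *+ 2)).
have /andP[k1 k2] := floor_itv (t / (pi *+ 2)).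
rewrite ler_pdivlMr // in k1; rewrite ltr_pdivrMr // intrD mulrDl mul1r in k2.
pose y := t - k%:~R * (pi *+ 2).
have cy : cis y = 1 by rewrite /y cisB ct cis_2pi divr1.
have y0 : 0 <= y by rewrite /y; lra.
have y2 : y < pi *+ 2 by rewrite /y; lra.
exists k; apply/eqP; rewrite -subr_eq0 -/y; apply/eqP.
have [ypi|piy] := leP y pi; first by apply: cis_small cy _; rewrite ger0_norm.
suff : y - pi *+ 2 = 0 by lra.
apply: cis_small; first by rewrite cisB cy -[pi *+ 2]mul1r (cis_2pi 1) divr1.
by rewrite ler0_norm; lra.
Qed.

Definition Arg z : R := atan (Im z / Re z).

Lemma ArgP z : 0 < Re z -> z = (normc z)%:C * cis (Arg z).
Proof.
move=> rz; have nz : 0 < normc z by apply: lt_le_trans rz (le_trans (ler_norm _) (Re_le_normc z)).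
have cosE : cos (Arg z) = Re z / normc z.
  rewrite /Arg cos_atan -[RHS]invrK invf_div; congr (_^-1).
  apply/eqP; rewrite -(@eqrXn2 _ 2) // ?sqrtr_ge0 ?divr_ge0 ?(ltW rz) ?(ltW nz) //.
  rewrite sqr_sqrtr; last by rewrite addr_ge0 ?sqr_ge0.
  by rewrite !expr_div_n sqr_normcE; apply/eqP; field; rewrite gt_eqF.
have sinE : sin (Arg z) = Im z / normc z.
  have c0 : cos (Arg z) != 0 by rewrite cosE mulf_neq0 ?invr_eq0 ?gt_eqF.
  have := atanK (Im z / Re z); rewrite /tan -/(Arg z) => E.
  rewrite -[LHS](divfK c0) E cosE; field; by rewrite !gt_eqF.
by apply: eqC; rewrite ?ReM ?ImM /= ?cosE ?sinE; field; rewrite gt_eqF.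
Qed.

Lemma Arg_bound z : - (pi / 2) < Arg z < pi / 2.
Proof. by rewrite atan_gtNpi2 atan_ltpi2. Qed.

Lemma continuous_Arg f t : ccont f t -> 0 < Re (f t) -> {for t, continuous (fun s => Arg (f s))}.
Proof.
move=> [fc] r0.
have rc : (fun s => Re (f s)) @ t --> Re (f t) := cvg_comp f _ fc (@Re_continuous R (f t)).
have ic : (fun s => Im (f s)) @ t --> Im (f t) := cvg_comp f _ fc (@Im_continuous R (f t)).
apply: (cvg_comp (fun s => Im (f s) / Re (f s)) atan _ (continuous_atan (x := _))).
by apply: cvgM => //; apply: cvgV => //; rewrite gt_eqF.
Qed.

Definition clamp01 t : R := Num.max 0 (Num.min t 1).

Lemma clamp01_itv t : 0 <= clamp01 t <= 1.
Proof.
rewrite /clamp01; case: (leP t 1) => ?; first by case: (leP 0 t) => ?; apply/andP; split; lra.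
by case: (leP (0 : R) 1) => ?; apply/andP; split; lra.
Qed.

Lemma clamp01_id t : 0 <= t <= 1 -> clamp01 t = t.
Proof.
move=> /andP[? ?]; rewrite /clamp01; case: (leP t 1) => ?; first by case: (leP 0 t) => ?; lra.
by case: (leP (0 : R) 1) => ?; lra.
Qed.

Lemma clamp01_continuous : continuous clamp01.
Proof.
move=> t; apply/cvgrPdist_lt => e e0; apply/nbhs_ballP; exists e => // s.
rewrite /ball /=; apply: le_lt_trans.
have maxL (a u v : R) : `|Num.max a u - Num.max a v| <= `|u - v|.
  have := ler_norm (u - v); have := ler_norm (v - u); rewrite distrC => ? ?.
  rewrite ler_norml; case: (leP a u) => ?; case: (leP a v) => ?;
  apply/andP; split; lra.
have minL (a u v : R) : `|Num.min u a - Num.min v a| <= `|u - v|.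
  have := ler_norm (u - v); have := ler_norm (v - u); rewrite distrC => ? ?.
  rewrite ler_norml; case: (leP u a) => ?; case: (leP v a) => ?;
  apply/andP; split; lra.
exact: le_trans (maxL _ _ _) (minL _ _ _).
Qed.

Lemma continuous_sum (I : Type) (r : seq I) (F : I -> R -> R) t :
  (forall i, {for t, continuous (F i)}) ->
  {for t, continuous (fun s => \sum_(i <- r) F i s)}.
Proof.
move=> Fc; elim: r => [|i r IH].
  rewrite (_ : (fun s => _) = fun=> 0); first exact: cst_continuous.
  by apply: funext => s; rewrite big_nil.
rewrite (_ : (fun s => _) = fun s => F i s + \sum_(j <- r) F j s).
  exact: cvgD (Fc i) IH.
by apply: funext => s; rewrite big_cons.
Qed.

Lemma normc_lt1_Re z : normc (z - 1) < 1 -> 0 < Re z.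
Proof.
by move=> /(le_lt_trans (Re_le_normc _)); rewrite ReB ltr_norml /= => /andP[? _]; lra.
Qed.

(** Dividing by [f 0] makes the phase relative to the starting point; [th 0] may still be any
    multiple of [2 pi], for which [winding] corrects. *)
Definition is_lift f (th : R -> R) :=
  continuous th /\ forall t, 0 <= t <= 1 ->
    f t / f 0 = (normc (f t / f 0))%:C * cis (th t).

(* [x] is the change of argument of [f] along [0, 1], not divided by 2 pi. *)
Definition winding f x := exists2 th, is_lift f th & th 1 - th 0 = x.

(** The homotopy is cut so finely in [s] that consecutive curves have quotients within 1 of 1, where
    [Arg] is continuous. The sum of these principal arguments lifts the telescoping product of the
    quotients. Cutting in [s] and not in [t] keeps each summand continuous in [t], and equal at both
    ends for closed curves. *)
Lemma homotopy_lift (K : R * R -> C) : (forall p, ccont K p) ->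
  (forall s t, 0 <= s <= 1 -> 0 <= t <= 1 -> K (s, t) != 0) ->
  exists th : R -> R, [/\ continuous th,
    forall t, 0 <= t <= 1 -> K (0, t) / K (1, t) =
      (normc (K (0, t) / K (1, t)))%:C * cis (th t) &
    (forall s, 0 <= s <= 1 -> K (s, 0) = K (s, 1)) -> th 0 = th 1].
Proof.
move=> Kc K0.
pose A := (`[0, 1]%classic `*` `[0, 1]%classic : set (R * R)).
have cA : compact A by apply: compact_setX; exact: segment_compact.
have AP p : A p <-> (0 <= p.1 <= 1) /\ (0 <= p.2 <= 1).
  by rewrite /A /= !in_itv.
have Knc : {within A, continuous (fun p => normc (K p))}.
  apply: continuous_subspaceT => p; have [Kp] := Kc p.
  exact: (cvg_comp K _ Kp (@normc_continuous R (K p))).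
have A00 : A (0, 0) by apply/AP; rewrite /= lexx ler01.
have [pm pmA Hpm] := compact_EVT_min (ex_intro _ _ A00) cA Knc.
rewrite inE in pmA; set m := normc (K pm) in Hpm.
have m0 : 0 < m by rewrite normc_gt0; case: (pm) pmA => s t /AP[]; exact: K0.
have /compact_near_coveringP ncA := cA.
have unif : \forall d \near (0 : R)^'+, A `<=` (fun p => forall s', 0 <= s' <= 1 ->
    `|p.1 - s'| < d -> normc (K p - K (s', p.2)) < m).
  apply: ncA => p Ap.
  have m2 : 0 < m / 2 by lra.
  have [Kp] := Kc p.
  have /nbhs_ballP[r /= r0 Hr] : nbhs p (fun q => normc (K q - K p) < m / 2).
    exact: (iffLR (@cvg_normcP _ _ (nbhs p) _ K (K p))) Kp _ m2.
  exists (ball p (r / 2), [set d | d < r / 2]).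
    split=> /=; first by apply: nbhsx_ballx; rewrite divr_gt0.
    by apply: nbhs_right_lt; rewrite divr_gt0.
  move=> [q d] /= [[q1 q2] dr] s' s'01 qs'.
  have rr : r / 2 <= r by lra.
  have H1 : normc (K q - K p) < m / 2.
    by apply: Hr; split; [exact: (le_ball rr q1) | exact: (le_ball rr q2)].
  have H2 : normc (K (s', q.2) - K p) < m / 2.
    apply: Hr; split; last exact: (le_ball rr q2).
    rewrite /ball /= in q1 *.
    by have := ler_distD q.1 p.1 s'; lra.
  by have := normc_triangle (K p) (K q) (K (s', q.2)); rewrite [normc (K p - _)]normc_distC; lra.
have [d [d0 Hd]] : exists d : R, 0 < d /\ A `<=` (fun p => forall s', 0 <= s' <= 1 ->
    `|p.1 - s'| < d -> normc (K p - K (s', p.2)) < m).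
  have : \forall d \near (0 : R)^'+, 0 < d /\ A `<=` (fun p => forall s', 0 <= s' <= 1 ->
    `|p.1 - s'| < d -> normc (K p - K (s', p.2)) < m).
    by apply: filterS2 (nbhs_right_gt 0) unif => d.
  by move=> /filter_ex.
have [n Hn] := ltr_add_invr d0; rewrite add0r in Hn.
pose N := n.+1.
have N0 : 0 < (N%:R : R) by rewrite ltr0Sn.
pose s_ i : R := i%:R / N%:R.
have s01 i : (i <= N)%N -> 0 <= s_ i <= 1.
  by move=> iN; rewrite divr_ge0 //= ler_pdivrMr // mul1r ler_nat.
pose rat i t := K (s_ i, clamp01 t) / K (s_ i.+1, clamp01 t).
have ratRe (i : 'I_N) t : 0 < Re (rat i t).
  have tc := clamp01_itv t.
  have iN : (i < N)%N := ltn_ord i.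
  have nz := K0 _ _ (s01 _ iN) tc.
  apply: normc_lt1_Re.
  have -> : rat i t - 1 = (K (s_ i, clamp01 t) - K (s_ i.+1, clamp01 t)) / K (s_ i.+1, clamp01 t).
    by rewrite /rat mulrBl divff.
  rewrite normc_div ltr_pdivrMr ?normc_gt0 // mul1r.
  have mle : m <= normc (K (s_ i.+1, clamp01 t)).
    by apply: Hpm; rewrite inE; apply/AP; split => //; exact: s01.
  apply: lt_le_trans mle; apply: (Hd (s_ i, clamp01 t)).
  - by apply/AP; split => //; exact: (s01 _ (ltnW iN)).
  - exact: s01.
  rewrite /= /s_ -mulrBl -addn1 natrD opprD addrA subrr sub0r mulN1r normrN.
  by rewrite ger0_norm // invr_ge0 ltW.
pose th t := \sum_(i < N) Arg (rat i t).
have ratK (n' : nat) t : (n' <= N)%N -> \prod_(i < n') rat i t = K (0, clamp01 t) / K (s_ n', clamp01 t).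
  have tc := clamp01_itv t; have s00 : s_ 0%N = 0 by rewrite /s_ mul0r.
  elim: n' => [_|n' IH n'N].
    by rewrite big_ord0 s00 divff // K0 // lexx ler01.
  rewrite big_ord_recr /= IH ?(ltnW n'N) // /rat.
  by have nz := K0 _ _ (s01 _ (ltnW n'N)) tc; rewrite mulrA divfK.
exists th; split.
- move=> t; apply: continuous_sum => i; apply: continuous_Arg; last exact: ratRe.
  have Kst s : ccont (fun t => K (s, clamp01 t)) t.
    have [Kp] := Kc (s, clamp01 t); split.
    have pc : (fun t => (s, clamp01 t)) @ t --> (s, clamp01 t).
      exact: (cvg_pair (cvg_cst s) (@clamp01_continuous t)).
    exact: (cvg_comp (fun t => (s, clamp01 t)) K pc Kp).
  apply: ccontM; first exact: Kst.
  apply: ccontV; last exact: Kst.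
  by apply: K0; [apply: s01; exact: ltn_ord | exact: clamp01_itv].
- move=> t t01; have := ratK N t (leqnn N).
  rewrite clamp01_id // (_ : s_ N = 1); last by rewrite /s_ divff // gt_eqF.
  move=> <-; rewrite /th cis_sum normc_prod rmorph_prod /= -big_split /=.
  by apply: eq_bigr => i _; apply: ArgP.
- move=> Kper; apply: eq_bigr => i _; rewrite /rat !clamp01_id ?lexx ?ler01 //.
  by rewrite !Kper // s01 // ltnW.
Qed.

(** The homotopy [f ((1 - s) t)] contracts the curve along itself to [f 0], so it never meets 0. *)
Lemma winding_ex f : (forall t, ccont f t) -> (forall t, 0 <= t <= 1 -> f t != 0) ->
  exists x, winding f x.
Proof.
move=> fc f0; pose K (p : R * R) := f ((1 - p.1) * p.2).
have Kc p : ccont K p.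
  have [fp] := fc ((1 - p.1) * p.2); split.
  apply: (@cvg_comp _ _ _ (fun p : R * R => (1 - p.1) * p.2) f _ _ _ _ fp).
  apply: cvgM; last exact: cvg_snd.
  by apply: cvgB; [exact: cvg_cst | exact: cvg_fst].
have [|th [thc thE _]] := homotopy_lift Kc.
  move=> s t /andP[? ?] /andP[? ?]; apply: f0; apply/andP.
  by split; [apply: mulr_ge0 | apply: mulr_ile1]; rewrite /=; lra.
exists (th 1 - th 0); exists th => //; split => // t t01.
by have := thE t t01; rewrite /K /= subr0 subrr mul1r mul0r.
Qed.

Lemma winding_null_homotopic f (K : R * R -> C) : (forall p, ccont K p) ->
  (forall s t, 0 <= s <= 1 -> 0 <= t <= 1 -> K (s, t) != 0) ->
  (forall t, 0 <= t <= 1 -> K (0, t) = f t /\ K (1, t) = f 0) ->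
  (forall s, 0 <= s <= 1 -> K (s, 0) = f 0 /\ K (s, 1) = f 0) ->
  winding f 0.
Proof.
move=> Kc K0 Kt Ks; have [th [thc thE thp]] := homotopy_lift Kc K0.
exists th; last by rewrite thp ?subrr // => s /Ks[-> ->].
split => // t t01; have := thE t t01; have [-> ->] := Kt t t01; exact.
Qed.

Lemma lift_unit f th : is_lift f th -> f 0 != 0 -> cis (th 0) = 1.
Proof.
move=> [_ /(_ 0)]; rewrite lexx ler01 => /(_ isT) + f0.
by rewrite divff // normc1 mul1r => <-.
Qed.

Lemma cis_continuous_cst (D : R -> R) : continuous D ->
  (forall t, 0 <= t <= 1 -> cis (D t) = 1) -> D 1 = D 0.
Proof.
suff H (D' : R -> R) : continuous D' -> (forall t, 0 <= t <= 1 -> cis (D' t) = 1) ->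
    D' 1 <= D' 0.
  move=> Dc D1; apply/eqP; rewrite eq_le H //= -lerN2.
  apply: (H (fun t => - D t)); first by move=> t; apply: cvgN; exact: Dc.
  by move=> t /D1; rewrite cisN => ->; rewrite invr1.
move=> Dc D1; rewrite leNgt; apply/negP => lt01.
have pi0 := pi_gt0 R.
pose s := Num.min pi (D' 1 - D' 0).
have s0 : 0 < s by rewrite lt_min pi0 subr_gt0.
have sD : s <= D' 1 - D' 0 by rewrite ge_min lexx orbT.
have spi : s <= pi by rewrite ge_min lexx.
have [||c] := @IVT R D' 0 1 (D' 0 + s) ler01.
- exact: continuous_subspaceT.
- rewrite min_l ?max_r ?(ltW lt01) //; apply/andP; split; lra.
rewrite in_itv /= => /D1 + Dc'; rewrite Dc' cisD D1 ?lexx ?ler01 // mul1r => cs.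
by have := cis_small cs; rewrite ger0_norm ?(ltW s0) // => /(_ spi); lra.
Qed.

Lemma winding_uniq f x y : (forall t, 0 <= t <= 1 -> f t != 0) ->
  winding f x -> winding f y -> x = y.
Proof.
move=> f0 [th [thc thE] <-] [ph [phc phE] <-].
have := @cis_continuous_cst (fun t => th t - ph t) _ _.
move=> H; suff : th 1 - ph 1 = th 0 - ph 0 by lra.
apply: H; first by move=> t; apply: cvgB; [exact: thc | exact: phc].
move=> t t01; have := phE t t01; rewrite {1}(thE t t01) => E.
have n0 : (normc (f t / f 0))%:C != 0 :> C.
  by rewrite -normc_eq0 normcR normr_eq0 normc_eq0 mulf_neq0 ?invr_eq0 ?f0 ?lexx ?ler01.
by rewrite cisB (mulfI n0 E) divff // cis_neq0.
Qed.

Lemma windingM f g x y : winding f x -> winding g y ->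
  winding (fun t => f t * g t) (x + y).
Proof.
move=> [th [thc thE] <-] [ph [phc phE] <-].
exists (fun t => th t + ph t); last by ring.
split; first by move=> t; apply: cvgD; [exact: thc | exact: phc].
move=> t t01; rewrite invfM mulrACA; move: (thE t t01) (phE t t01).
set a := f t / f 0; set b := g t / g 0 => Ea Eb.
by rewrite normcM rmorphM cisD [LHS](congr2 *%R Ea Eb); exact: mulrACA.
Qed.

Lemma windingV f x : winding f x -> winding (fun t => (f t)^-1) (- x).
Proof.
move=> [th [thc thE] <-]; exists (fun t => - th t); last by ring.
split; first by move=> t; apply: cvgN; exact: thc.
move=> t t01; move: (thE t t01).
have -> : (f t)^-1 / (f 0)^-1 = (f t / f 0)^-1 by rewrite invfM.
by move: (f t / f 0) => a Ea; rewrite {1}Ea invfM cisN normcV fmorphV.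
Qed.

Lemma winding_cst (c : C) : c != 0 -> winding (fun=> c) 0.
Proof.
move=> c0; exists (fun=> 0); last by rewrite subrr.
split; first exact: cst_continuous.
by move=> t _; rewrite cis0 divff // normc1 mulr1.
Qed.

Lemma eq_winding f g x : (forall t, 0 <= t <= 1 -> f t = g t) -> winding f x -> winding g x.
Proof.
move=> fg [th [thc thE] thx]; exists th => //; split=> // t t01.
by rewrite -!fg ?lexx ?ler01 //; exact: thE.
Qed.

Lemma winding_Re_gt0 f : (forall t, ccont f t) -> f 0 = f 1 ->
  (forall t, 0 <= t <= 1 -> 0 < Re (f t)) -> winding f 0.
Proof.
move=> fc f01 fR; exists (fun t => Arg (f (clamp01 t)) - Arg (f 0)); last first.
  by rewrite !clamp01_id ?lexx ?ler01 // f01 subrr.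
split=> [t|t t01].
  apply: cvgB; last exact: cvg_cst.
  apply: continuous_Arg; last exact/fR/clamp01_itv.
  have [fp] := fc (clamp01 t); split.
  exact: (cvg_comp clamp01 f (@clamp01_continuous t) fp).
rewrite clamp01_id // cisB {1}(ArgP (fR t t01)) {1}(@ArgP (f 0)) ?fR ?lexx ?ler01 //.
by rewrite normc_div rmorphM /= fmorphV invfM /=; ring.
Qed.

(** Rouche's theorem: [g / f] stays within distance 1 of 1, hence in the right half plane. *)
Lemma winding_close f g x : (forall t, ccont f t) -> (forall t, ccont g t) ->
  f 0 = f 1 -> g 0 = g 1 -> (forall t, 0 <= t <= 1 -> f t != 0) ->
  (forall t, 0 <= t <= 1 -> normc (g t - f t) < normc (f t)) ->
  winding f x -> winding g x.
Proof.
move=> fc gc f01 g01 f0 H wf.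
pose cf t := f (clamp01 t).
have cf0 t : cf t != 0 by apply/f0/clamp01_itv.
have cfc t : ccont cf t.
  have [fp] := fc (clamp01 t); split.
  exact: (cvg_comp clamp01 f (@clamp01_continuous t) fp).
have h : winding (fun t => g t * (cf t)^-1) 0.
  apply: winding_Re_gt0.
  - by move=> t; apply: ccontM (gc t) _; exact: ccontV.
  - by rewrite /cf !clamp01_id ?lexx ?ler01 // g01 f01.
  move=> t t01; apply: normc_lt1_Re; rewrite /cf clamp01_id //.
  have -> : g t / f t - 1 = (g t - f t) / f t by rewrite mulrBl divff ?f0.
  by rewrite normc_div ltr_pdivrMr ?normc_gt0 ?f0 // mul1r H.
rewrite -[x]addr0; apply: eq_winding (windingM wf h) => t t01.
by rewrite /cf clamp01_id // mulrC divfK // f0.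
Qed.

Lemma winding_integer f x : f 0 = f 1 -> f 0 != 0 -> winding f x ->
  exists k : int, x = k%:~R * (pi *+ 2).
Proof.
move=> f01 f0 [th Hth <-]; apply: cis_eq1; rewrite cisB (lift_unit Hth f0) divr1.
have [_ /(_ 1)] := Hth; rewrite lexx ler01 => /(_ isT).
by rewrite -f01 divff // normc1 mul1r.
Qed.

End Winding.

Section WindingNumbers.
Variable R : realType.
Local Notation C := R[i].

Lemma curve_avoid (g : R -> C) (b : C) : (forall t, ccont g t) ->
  (forall t, 0 <= t <= 1 -> g t != b) ->
  exists2 m : R, 0 < m & forall t, 0 <= t <= 1 -> m <= normc (g t - b).
Proof.
move=> gc gb.
have hc : {within `[0, 1], continuous (fun t => normc (g t - b))}.
  apply: continuous_subspaceT => t; have [gt] := ccontB (gc t) (ccont_cst t b).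
  exact: (cvg_comp (fun t => g t - b) (@normc R) gt (@normc_continuous R (g t - b))).
have A0 : `[0, 1]%classic (0 : R) by rewrite /= in_itv /= lexx ler01.
have [c + Hc] := compact_EVT_min (ex_intro _ _ A0) (@segment_compact R 0 1) hc.
rewrite inE /= in_itv /= => c01.
exists (normc (g c - b)); first by rewrite normc_gt0 subr_eq0 gb.
by move=> t t01; apply: Hc; rewrite inE /= in_itv.
Qed.

Lemma winding_near (g : R -> C) (b : C) : (forall t, ccont g t) -> g 0 = g 1 ->
  (forall t, 0 <= t <= 1 -> g t != b) ->
  exists2 m : R, 0 < m & forall b', normc (b' - b) < m ->
    (forall t, 0 <= t <= 1 -> g t != b') /\
    (forall x, winding (fun t => g t - b) x <-> winding (fun t => g t - b') x).
Proof.
move=> gc g01 gb; have [m m0 Hm] := curve_avoid gc gb.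
have cB c t : ccont (fun t => g t - c) t by apply: ccontB (gc t) _; exact: ccont_cst.
exists (m / 2); first lra.
move=> b' bb'.
have Hm' t : 0 <= t <= 1 -> m / 2 < normc (g t - b').
  move=> t01; have := Hm t t01; have := normc_triangle b' (g t) b; lra.
have gb' t : 0 <= t <= 1 -> g t != b'.
  move=> t01; rewrite -subr_eq0 -normc_gt0; have := Hm' t t01; lra.
split => // x; split; apply: winding_close => //; rewrite ?g01 //.
- by move=> t /gb; rewrite subr_eq0.
- move=> t t01; have -> : g t - b' - (g t - b) = b - b' by ring.
  by rewrite normc_distC; have := Hm t t01; lra.
- by move=> t /gb'; rewrite subr_eq0.
- move=> t t01; have -> : g t - b - (g t - b') = b' - b by ring.
  by have := Hm' t t01; lra.
Qed.

Lemma winding_connected (g : R -> C) (A : set C) (a b : C) x :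
  (forall t, ccont g t) -> g 0 = g 1 -> connected A ->
  (forall c, A c -> forall t, 0 <= t <= 1 -> g t != c) -> A a -> A b ->
  winding (fun t => g t - a) x -> winding (fun t => g t - b) x.
Proof.
move=> gc g01 cA gA Aa Ab wa.
pose U := [set c | (forall t, 0 <= t <= 1 -> g t != c) /\ winding (fun t => g t - c) x].
pose V := [set c | (forall t, 0 <= t <= 1 -> g t != c) /\ ~ winding (fun t => g t - c) x].
have oU : open U.
  apply: open_normc => c [gc' wc]; have [m m0 Hm] := winding_near gc g01 gc'.
  by exists m => // c' /Hm[? Hw]; split => //; apply/Hw.
have oV : open V.
  apply: open_normc => c [gc' wc]; have [m m0 Hm] := winding_near gc g01 gc'.
  by exists m => // c' /Hm[? Hw]; split => // /Hw.
have [] // := connected_open_split cA oU oV _ _ _ Ab.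
- move=> c Ac; have [?|?] := pselect (winding (fun t => g t - c) x).
    by left; split => //; exact: gA.
  by right; split => //; exact: gA.
- by apply/seteqP; split => // c [[_ ?] [_]].
- by exists a; split => //; split => //; exact: gA.
Qed.

Lemma winding_far (g : R -> C) (a : C) : (forall t, ccont g t) -> g 0 = g 1 ->
  (forall t, 0 <= t <= 1 -> normc (g t) < normc a) ->
  winding (fun t => g t - a) 0.
Proof.
move=> gc g01 ga.
have a0 : a != 0.
  by rewrite -normc_gt0 (le_lt_trans (normc_ge0 (g 0))) // ga // lexx ler01.
apply: (@winding_close _ (fun=> - a)).
- by move=> t; exact: ccont_cst.
- by move=> t; apply: ccontB (gc t) _; exact: ccont_cst.
- by [].
- by rewrite g01.
- by move=> t _; rewrite oppr_eq0.
- by move=> t /ga; rewrite normcNE opprK subrK.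
- by apply: winding_cst; rewrite oppr_eq0.
Qed.

(* [h] stays off the positive half-line on the open interval, starting below
   and arriving above it: its argument decreases by a full turn. *)
Lemma winding_full_turn (h : R -> C) (x : R) : winding h x ->
  (forall t, 0 <= t <= 1 -> h t != 0) -> h 0 = 1 -> h 1 = 1 ->
  (forall t, 0 < t < 1 -> Im (h t) = 0 -> Re (h t) < 0) ->
  (exists2 e : R, 0 < e & forall t, 0 < t < e -> t < 1 ->
     Im (h t) < 0 /\ 0 < Im (h (1 - t))) ->
  x = - (pi *+ 2).
Proof.
move=> [th [thc thE] <-] h0 h01 h11 hneg [e e0 He].
have pi0 := pi_gt0 R.
pose ph t := th t - th 0.
have phc : continuous ph by move=> t; apply: cvgB; [exact: thc | exact: cvg_cst].
have th0 : cis (th 0) = 1.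
  by have := thE 0; rewrite lexx ler01 h01 divr1 normc1 mul1r => /(_ isT).
have phE t : 0 <= t <= 1 -> h t = (normc (h t))%:C * cis (ph t).
  by move=> t01; have := thE t t01; rewrite h01 divr1 /ph cisB th0 divr1.
have ph0 : ph 0 = 0 by rewrite /ph subrr.
have sgn t : 0 <= t <= 1 -> exists2 c, 0 < c & Re (h t) = c * cos (ph t) /\ Im (h t) = c * sin (ph t).
  move=> t01; exists (normc (h t)); first by rewrite normc_gt0 h0.
  by split; rewrite {1}(phE t t01) ?ReM ?ImM /=; ring.
have not1 t : 0 < t < 1 -> cis (ph t) <> 1.
  move=> t01 [c1 s0]; have t01' : 0 <= t <= 1 by case/andP: t01 => ? ?; rewrite !ltW.
  have [c c0 [Er Ei]] := sgn t t01'.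
  have := hneg t t01; rewrite Ei s0 mulr0 => /(_ erefl).
  by rewrite Er c1 mulr1; lra.
have smallph (s : R) : exists2 d : R, 0 < d & forall t, `|t - s| < d -> `|ph t - ph s| < pi.
  have /nbhs_ballP[d /= d0 Hd] : nbhs s (fun t => `|ph s - ph t| < pi).
    exact: (iffLR (cvgrPdist_lt _ _) (phc s) pi pi0).
  by exists d => // t ts; rewrite distrC; apply: Hd; rewrite /ball /= distrC.
have sin_neg (y : R) : - pi < y < pi -> sin y < 0 -> y < 0.
  move=> /andP[? ?] sy; rewrite ltNge; apply/negP => y0.
  by have := sin_ge0_pi; move=> /(_ R y); rewrite y0 ltW // => /(_ isT); lra.
have small (d : R) : 0 < d -> exists t, [/\ 0 < t < 1, t < e & t < d].
  move=> d0; have mn : 0 < Num.min (Num.min d e) 1 by rewrite !lt_min d0 e0 ltr01.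
  have mn1 : Num.min (Num.min d e) 1 <= 1 by rewrite ge_min lexx orbT.
  have mne : Num.min (Num.min d e) 1 <= e by rewrite !ge_min lexx orbT.
  have mnd : Num.min (Num.min d e) 1 <= d by rewrite !ge_min lexx.
  by exists (Num.min (Num.min d e) 1 / 2); split; first apply/andP; do ?split; lra.
have [d0 d00 Hd0] := smallph 0.
have [t0 [t00 t0e t0d]] := small d0 d00.
have /andP[t0p t0l] := t00.
have pht0 : - pi < ph t0 < 0.
  have [|i1 _] := He t0 _ t0l; first by rewrite t0p.
  have [|c c0 [_ Ei]] := sgn t0; first by rewrite !ltW.
  have s0 : sin (ph t0) < 0 by rewrite Ei pmulr_rlt0 in i1.
  have := Hd0 t0; rewrite ph0 !subr0 ger0_norm ?(ltW t0p) // => /(_ t0d).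
  rewrite ltr_norml => H; rewrite (sin_neg _ H s0) andbT.
  by case/andP: H.
(* By the intermediate value theorem: at a phase 0 or [- 2 pi] inside the interval, [h] would be on
   the positive real axis. *)
have range t : 0 < t < 1 -> - (pi *+ 2) < ph t < 0.
  move=> t01.
  have ivt v : (ph t <= v <= ph t0) \/ (ph t0 <= v <= ph t) -> cis v = 1 -> False.
    move=> Hv v1.
    have [c c01 phcv] : exists2 c, 0 < c < 1 & ph c = v.
      have [tt|tt] := leP t t0.
        have [|||c] := @IVT R ph t t0 v => //; first exact: continuous_subspaceT.
          by case: Hv => /andP[? ?]; rewrite ge_min le_max; apply/andP; split;
            apply/orP; [left|right|right|left].
        rewrite in_itv /= => /andP[? ?] ?; exists c => //.
        by case/andP: t01 => ? ?; case/andP: t00 => ? ?; apply/andP; split; lra.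
      have [|||c] := @IVT R ph t0 t v => //; first exact: ltW.
          exact: continuous_subspaceT.
        by case: Hv => /andP[? ?]; rewrite ge_min le_max; apply/andP; split;
          apply/orP; [right|left|left|right].
      rewrite in_itv /= => /andP[? ?] ?; exists c => //.
      by case/andP: t01 => ? ?; case/andP: t00 => ? ?; apply/andP; split; lra.
    by apply: (not1 c c01); rewrite phcv.
  have /andP[? ?] := pht0.
  apply/andP; split; rewrite ltNge; apply/negP => H.
    apply: (ivt (- (pi *+ 2))); first by left; apply/andP; split; lra.
    by rewrite cisN -[pi *+ 2]mul1r (cis_2pi _ 1) invr1.
  by apply: (ivt 0); [right; apply/andP; split; lra | exact: cis0].
have cis1 : cis (ph 1) = 1.
  by have := phE 1; rewrite ler01 lexx h11 normc1 mul1r => /(_ isT).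
have [d1 d10 Hd1] := smallph 1.
have [t1 [/andP[t1p t1l] t1e t1d]] := small d1 d10.
have t11 : 0 < 1 - t1 < 1 by apply/andP; split; lra.
have /andP[r1 r2] := range _ t11.
have [|_ i1] := He t1 _ t1l; first by rewrite t1p.
have [|c c0 [_ Ei]] := sgn (1 - t1); first by case/andP: t11 => ? ?; rewrite !ltW.
have s1 : 0 < sin (ph (1 - t1)) by rewrite Ei pmulr_rgt0 in i1.
have p1 : `|ph (1 - t1) - ph 1| < pi.
  apply: Hd1; have -> : 1 - t1 - 1 = - t1 by ring.
  by rewrite normrN ger0_norm ?ltW.
rewrite ltr_norml in p1; have /andP[p1a p1b] := p1.
have low : ph (1 - t1) < - pi.
  rewrite ltNge; apply/negP => H.
  have : 0 <= sin (- ph (1 - t1)) by apply: sin_ge0_pi; apply/andP; split; lra.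
  by rewrite sinN; lra.
have [ph1|ph1] := ltP (- pi) (ph 1).
  have : ph 1 = 0 by apply: cis_small cis1 _; rewrite ler_norml; apply/andP; split; lra.
  lra.
suff : ph 1 + pi *+ 2 = 0 by rewrite /ph; lra.
apply: cis_small; first by rewrite cisD cis1 -[pi *+ 2]mul1r (cis_2pi _ 1) mulr1.
by rewrite ler_norml mulr2n in r1 *; apply/andP; split; lra.
Qed.

End WindingNumbers.

(** * Windings of functions tied by a relation between their moduli *)

Section WindingPower.
Variable R : realType.
Local Notation C := R[i].

Lemma is_derive_eps (p : R -> R) (t l : R) :
  (forall e : R, 0 < e -> exists2 r : R, 0 < r & forall k, `|k| < r ->
     `|p (t + k) - p t - l * k| <= e * `|k|) -> is_derive t (1 : R) p l.
Proof.
move=> H.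
have cv : (fun k : R => k^-1 *: ((p \o shift t) (k *: (1 : R)) - p t)) @ (0 : R)^' --> l.
  apply/cvgrPdist_le => e e0; have [r r0 Hr] := H e e0.
  have nb : nbhs (0 : R) (fun k => k != 0 ->
      `|l - k^-1 *: ((p \o shift t) (k *: (1 : R)) - p t)| <= e).
    apply/nbhs_ballP; exists r => // k; rewrite /ball /= sub0r normrN => kr k0.
    have := Hr k kr; rewrite -ler_pdivrMr ?normr_gt0 // -normrV ?unitfE // -normrM.
    rewrite [_ *: 1]mulr1 [_ *: _]mulrC [k + t]addrC; apply: le_trans.
    rewrite distrC le_eqVlt; apply/orP; left; apply/eqP; congr `|_|.
    by field.
  exact: nb.
apply: DeriveDef; first by apply/cvg_ex; exists l.
exact: cvg_lim cv.
Qed.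

Lemma cder_line (f : C -> C) (z h : C) (t : R) (d : C) :
  cder f (z + t%:C * h) d ->
  is_derive t (1 : R) (fun s : R => Re (f (z + s%:C * h))) (Re (d * h)) /\
  is_derive t (1 : R) (fun s : R => Im (f (z + s%:C * h))) (Im (d * h)).
Proof.
move=> fd.
have H e : 0 < e -> exists2 r : R, 0 < r & forall k : R, `|k| < r ->
    normc (f (z + (t + k)%:C * h) - f (z + t%:C * h) - d * h * k%:C) <= e * `|k|.
  move=> e0; have h1 : 0 < normc h + 1 by rewrite ltr_wpDl ?normc_ge0.
  have [r r0 Hr] := cder_eps fd (divr_gt0 e0 h1).
  exists (r / (normc h + 1)); first by rewrite divr_gt0.
  move=> k kr; have E : z + (t + k)%:C * h - (z + t%:C * h) = k%:C * h.
    by rewrite rmorphD /=; ring.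
  have := Hr (z + (t + k)%:C * h); rewrite E normcM normcR.
  rewrite ltr_pdivlMr // in kr.
  have kh : `|k| * normc h <= `|k| * (normc h + 1) by rewrite ler_wpM2l // lerDl.
  move=> /(_ (le_lt_trans kh kr)).
  have -> : d * (k%:C * h) = d * h * k%:C by ring.
  move=> /le_trans; apply; rewrite (le_trans (ler_wpM2l _ kh)) //; first by rewrite divr_ge0 // ltW.
  by rewrite [`|k| * _]mulrC mulrA divfK ?gt_eqF.
split; apply: is_derive_eps => e /H[r r0 Hr]; exists r => // k /Hr; apply: le_trans.
  have -> : Re (d * h) * k = Re (d * h * k%:C) by rewrite [RHS]ReM /= mulr0 subr0.
  by rewrite -!ReB; exact: Re_le_normc.
have -> : Im (d * h) * k = Im (d * h * k%:C) by rewrite [RHS]ImM /= mulr0 add0r.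
by rewrite -!ImB; exact: Im_le_normc.
Qed.

Lemma is_derive_Arg (p q : R -> R) (t a b : R) :
  is_derive t (1 : R) p a -> is_derive t (1 : R) q b -> 0 < p t ->
  is_derive t (1 : R) (fun s => Arg (p s +i* q s)) ((b * p t - q t * a) / (p t ^+ 2 + q t ^+ 2)).
Proof.
move=> pd qd p0.
have pn0 : p t != 0 by rewrite gt_eqF.
have pV : is_derive t (1 : R) (fun s => (p s)^-1) (- (p t) ^- 2 *: a).
  exact: is_deriveV.
have qp : is_derive t (1 : R) (fun s => q s * (p s)^-1) (q t *: (- (p t) ^- 2 *: a) + (p t)^-1 *: b).
  exact: is_deriveM.
have := @is_derive1_comp R atan (fun s => q s * (p s)^-1) t _ _ (is_derive1_atan _) qp.
move=> H; apply: (is_derive_eq H).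
have s0 : p t ^+ 2 + q t ^+ 2 != 0.
  by rewrite gt_eqF // ltr_wpDr ?sqr_ge0 ?exprn_gt0.
rewrite /GRing.scale /=; field.
by rewrite pn0 s0.
Qed.

Lemma is_derive_lnc (p q : R -> R) (t a b : R) :
  is_derive t (1 : R) p a -> is_derive t (1 : R) q b -> p t +i* q t != 0 ->
  is_derive t (1 : R) (fun s => lnc (p s +i* q s)) ((p t * a + q t * b) / (p t ^+ 2 + q t ^+ 2)).
Proof.
move=> pd qd n0.
have s0 : 0 < p t ^+ 2 + q t ^+ 2.
  by have := exprn_gt0 2 (_ : 0 < normc (p t +i* q t)); rewrite sqr_normcE normc_gt0; apply.
have pp : is_derive t (1 : R) (fun s => p s * p s) (p t *: a + p t *: a) by exact: is_deriveM.
have qq : is_derive t (1 : R) (fun s => q s * q s) (q t *: b + q t *: b) by exact: is_deriveM.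
have pq : is_derive t (1 : R) (fun s => p s * p s + q s * q s)
    (p t *: a + p t *: a + (q t *: b + q t *: b)) by exact: is_deriveD.
have s1 : 0 < p t * p t + q t * q t by rewrite -!expr2.
have ln' := @is_derive1_comp R (@ln R) (fun s => p s * p s + q s * q s) t _ _
  (is_derive1_ln s1) pq.
have h := is_deriveZ (2^-1 : R) ln'.
have E : (fun s => lnc (p s +i* q s)) =
    (2^-1 : R) \*: (@ln R \o (fun s => p s * p s + q s * q s)).
  apply: funext => s /=; rewrite /lnc /= -!expr2.
  rewrite /GRing.scale /=.
  have -> : p s ^+ 2 + q s ^+ 2 = normc (p s +i* q s) ^+ 2 by rewrite sqr_normcE.
  have [->|z0] := eqVneq (p s +i* q s) 0; first by rewrite normc0 expr0n /= ln0 ?mulr0.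
  by rewrite lnXn ?normc_gt0 //; field.
rewrite E; apply: (is_derive_eq h).
rewrite /GRing.scale /=; field.
by rewrite gt_eqF.
Qed.

Lemma is_derive_bigsum (I : Type) (r : seq I) (F : I -> R -> R) (dF : I -> R) (t : R) :
  (forall i, is_derive t (1 : R) (F i) (dF i)) ->
  is_derive t (1 : R) (fun s => \sum_(i <- r) F i s) (\sum_(i <- r) dF i).
Proof.
move=> H; elim: r => [|i r IH].
  rewrite big_nil (_ : (fun s => _) = cst 0); first exact: is_derive_cst.
  by apply: funext => s; rewrite big_nil.
rewrite big_cons (_ : (fun s => _) = F i + (fun s => \sum_(j <- r) F j s)).
  exact: is_deriveD.
by apply: funext => s; rewrite big_cons.
Qed.

Lemma Re_div (x y : C) :
  Re (x / y) = (Re y * Re x + Im y * Im x) / (Re y ^+ 2 + Im y ^+ 2).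
Proof. by case: x y => [a b] [c d] /=; ring. Qed.

Lemma Im_div (x y : C) :
  Im (x / y) = (Im x * Re y - Im y * Re x) / (Re y ^+ 2 + Im y ^+ 2).
Proof. by case: x y => [a b] [c d] /=; ring. Qed.

Lemma Re_scale (t : R) (z : C) : Re (t%:C * z) = t * Re z.
Proof. by case: z => a b /=; ring. Qed.

Lemma Im_scale (t : R) (z : C) : Im (t%:C * z) = t * Im z.
Proof. by case: z => a b /=; ring. Qed.

Lemma cder_lnc (f : C -> C) (z h : C) (t : R) (d : C) :
  cder f (z + t%:C * h) d -> f (z + t%:C * h) != 0 ->
  is_derive t (1 : R) (fun s : R => lnc (f (z + s%:C * h))) (Re (d * h / f (z + t%:C * h))).
Proof.
move=> fd f0; have [rd id] := cder_line fd.
have := is_derive_lnc rd id; rewrite Re_div.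
have E s : Re (f (z + s%:C * h)) +i* Im (f (z + s%:C * h)) = f (z + s%:C * h) by case: (f _).
rewrite E => /(_ f0).
by rewrite (_ : (fun s => lnc (_ +i* _)) = fun s => lnc (f (z + s%:C * h))) //;
  apply: funext => s; rewrite E.
Qed.

Lemma cder_Arg (f : C -> C) (z h w : C) (t : R) (d : C) :
  cder f (z + t%:C * h) d -> w != 0 -> 0 < Re (f (z + t%:C * h) / w) ->
  is_derive t (1 : R) (fun s : R => Arg (f (z + s%:C * h) / w)) (Im (d * h / f (z + t%:C * h))).
Proof.
move=> fd w0 R0.
have fdw : cder (fun x => f x * w^-1) (z + t%:C * h) (d * w^-1 + f (z + t%:C * h) * 0).
  by apply: cderM fd _; exact: cder_cst.
rewrite mulr0 addr0 in fdw.
have [rd id] := cder_line fdw.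
have := is_derive_Arg rd id R0.
have f0 : f (z + t%:C * h) != 0.
  by apply: contraTneq R0 => ->; rewrite mul0r ltxx.
have -> : d * h / f (z + t%:C * h) = (d * w^-1 * h) / (f (z + t%:C * h) * w^-1).
  by field; rewrite w0 f0.
rewrite Im_div.
have E s : Re (f (z + s%:C * h) / w) +i* Im (f (z + s%:C * h) / w) = f (z + s%:C * h) / w.
  by case: (f _ / w).
by rewrite (_ : (fun s => Arg (_ +i* _)) = fun s => Arg (f (z + s%:C * h) / w)) //;
  apply: funext => s; rewrite E.
Qed.

Lemma nearc_forall (I : finType) (z : C) (A : I -> set C) :
  (forall i, nearc z (A i)) -> nearc z (fun w => forall i, A i w).
Proof.
move=> H; have : nearc z (fun w => forall i, i \in enum I -> A i w).
  elim: (enum I) => [|i r IH]; first by apply: nearcW.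
  apply: nearcS2 (H i) IH => w Ai Ar j.
  by rewrite inE => /predU1P[->|/Ar].
by apply: nearcS => w Aw i; apply: Aw; rewrite mem_enum.
Qed.

Variables (I : finType) (beta : I -> R) (f : I -> C -> C) (D : set C).
Hypothesis oD : open D.
Hypothesis fd : forall z, D z -> forall i, cdiff (f i) z.
Hypothesis f0 : forall z, D z -> forall i, f i z != 0.
Variable c : R.
Hypothesis logE : forall z, D z -> logsum beta f z = c.

(** The sum is the logarithmic derivative of the multivalued product of powers. Its product with a
    direction [h] has as real part the derivative of [logsum] along [h], and [h = 1] and [h = i]
    suffice. *)
Lemma logsum_cst_derivative z (d : I -> C) : D z -> (forall i, cder (f i) z (d i)) ->
  \sum_i (beta i)%:C * (d i / f i z) = 0.
Proof.
move=> Dz dd.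
set k := \sum_i _.
have dir (h : C) : Re (k * h) = 0.
  have di i : cder (f i) (z + (0 : R)%:C * h) (d i) by rewrite mul0r addr0.
  have fi0 i : f i (z + (0 : R)%:C * h) != 0 by rewrite mul0r addr0 f0.
  have H := is_derive_bigsum (index_enum I)
    (fun i => is_deriveZ (beta i) (cder_lnc (di i) (fi0 i))).
  have E : Re (k * h) = \sum_i beta i *: Re (d i * h / f i (z + (0 : R)%:C * h)).
    rewrite /k mulr_suml (big_morph (@complex.Re R) (@ReD R) (erefl _)).
    apply: eq_bigr => i _; rewrite mul0r addr0.
    have -> : (beta i)%:C * (d i / f i z) * h = (beta i)%:C * (d i * h / f i z) by ring.
    exact: Re_scale.
  have [r r0 Hr] := open_nearc oD Dz.
  have h1 : 0 < normc h + 1 by rewrite ltr_wpDl ?normc_ge0.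
  have Hc : \forall s \near (0 : R), cst c s =
      (fun s => \sum_(i <- index_enum I) (beta i \*: (fun s : R => lnc (f i (z + s%:C * h)))) s) s.
    apply/nbhs_ballP; exists (r / (normc h + 1)); first by rewrite /= divr_gt0.
    move=> s; rewrite /ball /= sub0r normrN ltr_pdivlMr // => sr.
    rewrite -(logE (z := z + s%:C * h)) //.
    apply: Hr; rewrite addrAC subrr add0r normcM normcR (le_lt_trans _ sr) //.
    by rewrite ler_wpM2l // lerDl.
  have H' := near_eq_is_derive Hc (is_derive_cst c (0 : R) (1 : R)).
  by rewrite E; have [_ <-] := H; have [_ ->] := H'.
apply: eqC; first by have := dir 1; rewrite mulr1.
by have := dir 'i; rewrite ReM /= mulr0 mulr1 sub0r => /eqP; rewrite oppr_eq0 => /eqP.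
Qed.

Lemma Arg1 : Arg (1 : C) = 0.
Proof. by rewrite /Arg /= mul0r atan0. Qed.

(** Along a segment the derivative of the sum of arguments is the imaginary part of the same
    logarithmic derivative, hence 0. Near [z0] all quotients are in the right half plane, where
    [Arg] is differentiable. *)
Lemma logsum_cst_Arg z0 : D z0 ->
  nearc z0 (fun z => (forall i, 0 < Re (f i z / f i z0)) /\
    \sum_i beta i * Arg (f i z / f i z0) = 0).
Proof.
move=> Dz0.
have pos : nearc z0 (fun z => forall i, 0 < Re (f i z / f i z0)).
  apply: nearc_forall => i.
  have n0 : 0 < normc (f i z0) by rewrite normc_gt0 f0.
  have /ccont_normcP := cdiff_continuous (fd Dz0 i).
  move=> /(_ _ n0); apply: nearcS => z Hz; apply: normc_lt1_Re.
  have -> : f i z / f i z0 - 1 = (f i z - f i z0) / f i z0 by rewrite mulrBl divff ?f0.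
  by rewrite normc_div ltr_pdivrMr // mul1r.
have [r r0 Hr] := nearcI pos (open_nearc oD Dz0).
exists r => // z zr; split; first by have [] := Hr z zr.
pose h := z - z0.
have onseg (s : R) : 0 <= s <= 1 ->
    (forall i, 0 < Re (f i (z0 + s%:C * h) / f i z0)) /\ D (z0 + s%:C * h).
  move=> /andP[s0 s1]; apply: Hr; rewrite addrAC subrr add0r normcM normcR ger0_norm //.
  by rewrite (le_lt_trans _ zr) // ler_piMl ?normc_ge0.
pose A (s : R) := \sum_(i <- index_enum I) (beta i \*: (fun s : R => Arg (f i (z0 + s%:C * h) / f i z0))) s.
have dA (s : R) : 0 <= s <= 1 -> is_derive s (1 : R) A 0.
  move=> s01; have [ps Ds] := onseg s s01.
  have [d dd] := choice (fun i => fd Ds i).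
  have H := is_derive_bigsum (index_enum I)
    (fun i => is_deriveZ (beta i) (cder_Arg (dd i) (f0 Dz0 i) (ps i))).
  apply: (is_derive_eq H).
  have -> : \sum_i beta i *: Im (d i * h / f i (z0 + s%:C * h)) =
      Im ((\sum_i (beta i)%:C * (d i / f i (z0 + s%:C * h))) * h).
    rewrite mulr_suml (big_morph (@complex.Im R) (@ImD R) (erefl _)).
    apply: eq_bigr => i _.
    have -> : (beta i)%:C * (d i / f i (z0 + s%:C * h)) * h =
      (beta i)%:C * (d i * h / f i (z0 + s%:C * h)) by ring.
    by rewrite Im_scale.
  by rewrite (logsum_cst_derivative Ds dd) mul0r.
have [||s _] := @MVT_segment R A (fun=> 0) 0 1 ler01.
- by move=> s; rewrite in_itv /= => /andP[? ?]; apply: dA; rewrite !ltW.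
- apply: derivable_within_continuous => s; rewrite in_itv /= => s01.
  by have [] := dA s s01.
rewrite mul0r => /eqP; rewrite subr_eq0 => /eqP.
have -> : A 0 = 0.
  rewrite /A big1 // => i _ /=; rewrite mul0r addr0 divff ?f0 // Arg1.
  by rewrite /GRing.scale /= mulr0.
move=> A1; rewrite -[RHS]A1; apply: eq_bigr => i _ /=.
by rewrite mul1r /h addrC subrK.
Qed.

(** The combination [E] of the lifts is locally constant: close to [t0] the change of each lift is
    the principal argument of a quotient, because the two differ by a multiple of [2 pi] of modulus
    at most [pi], and the combination of these arguments is 0 by [logsum_cst_Arg]. Connectedness of
    the unit interval concludes. *)
Lemma winding_logsum (g : R -> C) (x : I -> R) : (forall t, ccont g t) ->
  (forall t, 0 <= t <= 1 -> D (g t)) ->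
  (forall i, winding (fun t => f i (g t)) (x i)) -> \sum_i beta i * x i = 0.
Proof.
move=> gc gD gw.
have exth i : exists th, is_lift (fun t => f i (g t)) th /\ th 1 - th 0 = x i.
  by have [th] := gw i; exists th.
have [th Hth] := choice exth.
pose E t := \sum_i beta i * th i t.
have -> : \sum_i beta i * x i = E 1 - E 0.
  by rewrite /E -sumrB; apply: eq_bigr => i _; have [_ <-] := Hth i; rewrite mulrBr.
have fg0 i t : 0 <= t <= 1 -> f i (g t) != 0 by move=> /gD /f0; apply.
have loc (t0 : R) : 0 <= t0 <= 1 -> \forall t \near t0, 0 <= t <= 1 -> E t = E t0.
  move=> t01.
  have n1 : \forall t \near t0, (forall i, 0 < Re (f i (g t) / f i (g t0))) /\
      \sum_i beta i * Arg (f i (g t) / f i (g t0)) = 0.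
    have /nearcP/nbhs_normc[r r0 Hr] := logsum_cst_Arg (gD _ t01).
    have [gt] := gc t0.
    have nb : \forall t \near t0, normc (g t - g t0) < r.
      exact: (iffLR (@cvg_normcP _ _ (nbhs t0) _ g (g t0))) gt r r0.
    by apply: filterS nb => t /Hr.
  have n2 : \forall t \near t0, forall i, `|th i t - th i t0| < pi / 2.
    have n2' i : \forall t \near t0, `|th i t - th i t0| < pi / 2.
      have [[thc _] _] := Hth i.
      have p2 : 0 < (pi / 2 : R) by rewrite divr_gt0 ?pi_gt0.
      have nb : \forall t \near t0, `|th i t0 - th i t| < pi / 2.
        exact: (iffLR (cvgrPdist_lt _ _) (thc t0) _ p2).
      by apply: filterS nb => t; rewrite distrC.
    exact: (filter_forall _ n2').
  apply: filterS2 n1 n2 => t [pos sum0] close tt.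
  apply/eqP; rewrite -subr_eq0 /E -sumrB -[X in _ == X]sum0; apply/eqP.
  apply: eq_bigr => i _; rewrite -mulrBr; congr (_ * _).
  have [[_ thE] _] := Hth i.
  set q := f i (g t) / f i (g t0) in pos *.
  have nq : 0 < normc q by rewrite normc_gt0 mulf_neq0 ?invr_eq0 ?fg0.
  have cq : q = (normc q)%:C * cis (th i t - th i t0).
    have -> : q = (f i (g t) / f i (g 0)) / (f i (g t0) / f i (g 0)).
      by rewrite /q; field; rewrite !fg0 ?lexx ?ler01.
    rewrite cisB; move: (thE t tt) (thE t0 t01).
    move: (f i (g t) / f i (g 0)) (f i (g t0) / f i (g 0)) => u v Eu Ev.
    rewrite [LHS](congr2 (fun x y => x / y) Eu Ev) normc_div rmorphM /= fmorphV invfM.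
    exact: mulrACA.
  have ca := ArgP (pos i).
  have c1 : cis (th i t - th i t0 - Arg q) = 1.
    rewrite cisB; have nq0 : (normc q)%:C != 0 :> C.
      by rewrite -normc_eq0 normcR normr_eq0 gt_eqF.
    have <- := mulfI nq0 (etrans (esym ca) cq).
    by rewrite divff // cis_neq0.
  apply/eqP; rewrite -subr_eq0; apply/eqP; apply: cis_small => //.
  have /andP[? ?] := Arg_bound q; have := close i; rewrite ltr_norml => /andP[? ?].
  by rewrite ler_norml; apply/andP; split; lra.
have locc (t : R) : \forall t' \near t, E (clamp01 t') = E (clamp01 t).
  have nb : \forall t' \near t, 0 <= clamp01 t' <= 1 -> E (clamp01 t') = E (clamp01 t).
    exact: (@clamp01_continuous R t _ (loc _ (clamp01_itv t))).
  by apply: filterS nb => t'; apply; exact: clamp01_itv.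
pose U := [set t : R | E (clamp01 t) = E 0].
have oU : open U.
  by rewrite openE => t Ut; apply: filterS (locc t) => t' e; rewrite /U /= e.
have oV : open (~` U).
  by rewrite openE => t Ut; apply: filterS (locc t) => t' e Ut'; apply: Ut; rewrite /U /= -e.
have sub : `[0, 1]%classic `<=` U.
  apply: (connected_open_split (@segment_connected R 0 1) oU oV).
  - by move=> t _; have [|] := pselect (U t); [left|right].
  - by rewrite setICr.
  - by exists 0; split; rewrite /= ?in_itv /U /= ?clamp01_id ?lexx ?ler01.
have := sub 1; rewrite /= in_itv /= ler01 lexx /U /= clamp01_id ?lexx ?ler01 //.
by move=> ->; rewrite ?subrr.
Qed.

End WindingPower.

(** * Asymptotics at infinity *)

Section Asymptotics.
Variable R : realType.
Local Notation C := R[i].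
Implicit Types (f g : C -> C) (al be : C) (N M : nat).

(** [f z = al z^N + o(z^N)] at infinity; with [al = 0] it says [f = o(z^N)]. *)
Definition asymp f al N := forall e : R, 0 < e ->
  exists r : R, forall z, r < normc z -> normc (f z - al * z ^+ N) <= e * normc z ^+ N.

Lemma eq_asymp f g al N : (exists r : R, forall z, r < normc z -> f z = g z) ->
  asymp f al N -> asymp g al N.
Proof.
move=> [r fg] H e /H[r' Hr]; exists (Num.max r r') => z; rewrite gt_max => /andP[rz rz'].
by rewrite -fg // Hr.
Qed.

Lemma asymp_id : asymp id 1 1.
Proof.
move=> e e0; exists 0 => z _.
by rewrite mul1r expr1 subrr normc0 mulr_ge0 ?normc_ge0 // ltW.
Qed.

Lemma asymp_cst c : asymp (fun=> c) c 0.
Proof. by move=> e e0; exists 0 => z _; rewrite mulr1 subrr normc0 mulr1 ltW. Qed.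

Lemma asympD f g al be N : asymp f al N -> asymp g be N ->
  asymp (fun z => f z + g z) (al + be) N.
Proof.
move=> Hf Hg e e0; have e2 : 0 < e / 2 by rewrite divr_gt0.
have [r1 H1] := Hf _ e2; have [r2 H2] := Hg _ e2.
exists (Num.max r1 r2) => z; rewrite gt_max => /andP[/H1 h1 /H2 h2].
rewrite (_ : _ - _ = (f z - al * z ^+ N) + (g z - be * z ^+ N)); last by ring.
by apply: le_trans (normcD _ _) _; lra.
Qed.

Lemma asymp_bound f al N (e : R) : 0 < e -> asymp f al N ->
  exists r : R, forall z, r < normc z -> normc (f z) <= (normc al + e) * normc z ^+ N.
Proof.
move=> e0 /(_ _ e0)[r H]; exists r => z /H h.
have := normcD (f z - al * z ^+ N) (al * z ^+ N); rewrite subrK normcM normcX.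
by move=> /le_trans; apply; rewrite mulrDl addrC lerD2l.
Qed.

Lemma asymp_lower_bound f al N (e : R) : 0 < e -> asymp f al N ->
  exists r : R, forall z, r < normc z -> (normc al - e) * normc z ^+ N <= normc (f z).
Proof.
move=> e0 /(_ _ e0)[r H]; exists r => z /H h.
have := normcB (al * z ^+ N) (al * z ^+ N - f z); rewrite subKr.
have := normcD (al * z ^+ N - f z) (f z); rewrite subrK normcM normcX normc_distC.
by rewrite mulrBl; lra.
Qed.

Lemma asympM f g al be N M : asymp f al N -> asymp g be M ->
  asymp (fun z => f z * g z) (al * be) (N + M).
Proof.
move=> Hf Hg e e0; pose s := normc al + normc be + 1; pose e1 := e / (s + e).
have [a0 b0] : 0 <= normc al /\ 0 <= normc be by split; exact: normc_ge0.
have se0 : 0 < s + e by rewrite /s; lra.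
have e10 : 0 < e1 by rewrite divr_gt0.
have e11 : e1 <= 1 by rewrite ler_pdivrMr // mul1r /s; lra.
have es : e1 * s <= e by rewrite mulrAC ler_pdivrMr // ler_pM2l // /s; lra.
have [r1 H1] := Hf _ e10; have [r2 H2] := Hg _ e10; have [r3 H3] := asymp_bound e10 Hg.
exists (Num.max (Num.max r1 r2) r3) => z; rewrite !gt_max => /andP[/andP[/H1 h1 /H2 h2] /H3 h3].
rewrite (_ : _ - _ = (f z - al * z ^+ N) * g z + al * z ^+ N * (g z - be * z ^+ M)); last first.
  by rewrite exprD; ring.
apply: le_trans (normcD _ _) _; rewrite !normcM normcX exprD.
have zN : 0 <= normc z ^+ N by rewrite exprn_ge0 ?normc_ge0.
have zM : 0 <= normc z ^+ M by rewrite exprn_ge0 ?normc_ge0.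
apply: (@le_trans _ _ ((e1 * (normc be + e1) + normc al * e1) * (normc z ^+ N * normc z ^+ M))).
  rewrite mulrDl; apply: lerD.
    by rewrite mulrACA; apply: ler_pM => //; exact: normc_ge0.
  by rewrite mulrACA; apply: ler_pM => //; [rewrite mulr_ge0 | exact: normc_ge0].
apply: ler_wpM2r; first exact: mulr_ge0.
apply: le_trans es; rewrite [normc al * _]mulrC -mulrDr /s; apply: ler_wpM2l; first exact: ltW.
by lra.
Qed.

Lemma asymp_lt f al N M : (N < M)%N -> asymp f al N -> asymp f 0 M.
Proof.
move=> NM Hf e e0; have [r H] := asymp_bound ltr01 Hf.
pose K := normc al + 1; have K0 : 0 < K by rewrite /K ltr_pwDr ?normc_ge0.
exists (Num.max r (Num.max 1 (K / e))) => z; rewrite !gt_max => /and3P[/H h z1 zK].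
rewrite mul0r subr0; apply: le_trans h _; rewrite -/K -(subnKC NM) exprD exprS.
have zN : 0 <= normc z ^+ N by rewrite exprn_ge0 ?normc_ge0.
have zx : 1 <= normc z ^+ (M - N.+1) by rewrite exprn_ege1 // ltW.
have Kz : K <= e * normc z by rewrite mulrC -ler_pdivrMr // ltW.
have -> : e * (normc z * normc z ^+ N * normc z ^+ (M - N.+1)) =
  (e * normc z * normc z ^+ (M - N.+1)) * normc z ^+ N by ring.
apply: ler_wpM2r => //; apply: le_trans Kz _; rewrite ler_peMr //.
by rewrite mulr_ge0 ?normc_ge0 // ltW.
Qed.

Lemma asympX f N : asymp f 1 1 -> asymp (fun z => f z ^+ N) 1 N.
Proof.
move=> H; elim: N => [|N IH]; first exact: asymp_cst.
have := asympM H IH; rewrite mulr1 add1n.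
by apply: eq_asymp; exists 0 => z _; rewrite exprS.
Qed.

Lemma asympZ f c al N : asymp f al N -> asymp (fun z => c * f z) (c * al) N.
Proof. by move=> /(asympM (asymp_cst c)); rewrite add0n. Qed.

Lemma asymp_sum0 (I : Type) (s : seq I) (h : I -> C -> C) N :
  (forall i, asymp (h i) 0 N) -> asymp (fun z => \sum_(i <- s) h i z) 0 N.
Proof.
move=> H; elim: s => [|i s IH].
  by move=> e e0; exists 0 => z _; rewrite big_nil mul0r subrr normc0 mulr_ge0 ?exprn_ge0 ?normc_ge0 // ltW.
have := asympD (H i) IH; rewrite addr0.
by apply: eq_asymp; exists 0 => z _; rewrite big_cons.
Qed.

Lemma asymp_sum_top n (h : nat -> C -> C) al N :
  (forall i, (i < n)%N -> asymp (h i) 0 N) -> asymp (h n) al N ->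
  asymp (fun z => \sum_(i < n.+1) h i z) al N.
Proof.
move=> H Hn; pose h' i z := if (i < n)%N then h i z else 0.
have z0 : asymp (fun=> 0) 0 N.
  move=> e e0; exists 0 => z _.
  by rewrite mul0r subrr normc0 mulr_ge0 ?exprn_ge0 ?normc_ge0 // ltW.
have H' i : asymp (h' i) 0 N.
  by rewrite /h'; case: (ltnP i n) => [/H Hi|_]; [exact: Hi | exact: z0].
have := asympD (@asymp_sum0 _ (iota 0 n) h' N H') Hn; rewrite add0r.
apply: eq_asymp; exists 0 => z _; rewrite big_ord_recr /=; congr (_ + _).
rewrite -(big_mkord xpredT (fun i => h i z)) /index_iota subn0.
rewrite big_seq [RHS]big_seq; apply: eq_bigr => i.
by rewrite mem_iota add0n /h' => /andP[_ ->].
Qed.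

Lemma asymp_horner f (Q : {poly C}) n : size Q = n.+1 -> asymp f 1 1 ->
  asymp (fun z => Q.[f z]) Q`_n n.
Proof.
move=> sQ Hf.
suff : asymp (fun z => \sum_(i < n.+1) Q`_i * f z ^+ i) Q`_n n.
  by apply: eq_asymp; exists 0 => z _; rewrite horner_coef sQ.
apply: (@asymp_sum_top n (fun i z => Q`_i * f z ^+ i)) => [i ni|]; last by have := asympZ Q`_n (asympX n Hf); rewrite mulr1.
exact: asymp_lt ni (asympZ _ (asympX i Hf)).
Qed.

(** [q] is the divided difference of [Q]. Its growth turns closeness of [f] and [g] into closeness
    of the values of [Q]; its lack of zeros near infinity turns equality of the values into equality
    of [f] and [g]. *)
Lemma asymp_horner_quotient f g (Q : {poly C}) n : size Q = n.+2 -> asymp f 1 1 -> asymp g 1 1 ->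
  exists2 q, asymp q (n.+1%:R * Q`_n.+1) n & forall z, Q.[f z] - Q.[g z] = (f z - g z) * q z.
Proof.
move=> sQ Hf Hg.
pose h k z := \sum_(i < k) f z ^+ (k.-1 - i) * g z ^+ i.
have hE k : asymp (h k.+1) k.+1%:R k.
  have T i : (i < k.+1)%N -> asymp (fun z => f z ^+ (k - i) * g z ^+ i) 1 k.
    by move=> ik; have := asympM (asympX (k - i) Hf) (asympX i Hg); rewrite mulr1 subnK.
  suff S j : (j <= k.+1)%N -> asymp (fun z => \sum_(i < j) f z ^+ (k - i) * g z ^+ i) j%:R k by exact: S.
  elim: j => [_|j IH jk].
    move=> e e0; exists 0 => z _; rewrite big_ord0 mul0r subrr normc0.
    by rewrite mulr_ge0 ?exprn_ge0 ?normc_ge0 // ltW.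
  have := asympD (IH (ltnW jk)) (T j jk); rewrite natr1.
  by apply: eq_asymp; exists 0 => z _; rewrite big_ord_recr.
exists (fun z => \sum_(i < n.+2) Q`_i * h i z).
  apply: (@asymp_sum_top n.+1 (fun i z => Q`_i * h i z)) => [i|].
    case: i => [|i]; last by rewrite ltnS => ni; exact: asymp_lt ni (asympZ _ (hE i)).
    move=> _ e e0; exists 0 => z _; rewrite /h big_ord0 mulr0 mul0r subrr normc0.
    by rewrite mulr_ge0 ?exprn_ge0 ?normc_ge0 // ltW.
  by rewrite mulrC; exact: asympZ (hE n).
move=> z; rewrite !horner_coef sQ -sumrB mulr_sumr; apply: eq_bigr => i _.
by rewrite -mulrBr subrXX mulrCA.
Qed.

Lemma asymp_neq0 f al N : al != 0 -> asymp f al N ->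
  exists r : R, forall z, r < normc z -> f z != 0.
Proof.
move=> al0; have a0 : 0 < normc al / 2 by rewrite divr_gt0 // normc_gt0.
move=> /(asymp_lower_bound a0)[r H]; exists (Num.max r 0) => z; rewrite gt_max => /andP[/H h z0].
rewrite -normc_gt0; apply: lt_le_trans h; apply: mulr_gt0; last exact: exprn_gt0.
by lra.
Qed.

Lemma asymp_lnc f al N : al != 0 -> asymp f al N ->
  exists r K : R, 1 < r /\ forall z, r < normc z ->
    N%:R * ln (normc z) - K <= lnc (f z) <= N%:R * ln (normc z) + K.
Proof.
move=> al0 Hf; have a0 : 0 < normc al / 2 by rewrite divr_gt0 // normc_gt0.
have [r1 H1] := asymp_lower_bound a0 Hf; have [r2 H2] := asymp_bound a0 Hf.
pose K1 := - ln (normc al - normc al / 2); pose K2 := ln (normc al + normc al / 2).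
exists (Num.max 2 (Num.max r1 r2)), (Num.max K1 K2); split; first by rewrite lt_max; apply/orP; left; lra.
move=> z; rewrite !gt_max => /and3P[z2 /H1 h1 /H2 h2].
have z0 : 0 < normc z by lra.
have zN : 0 < normc z ^+ N by exact: exprn_gt0.
have b0 : 0 < normc al - normc al / 2 by lra.
have b1 : 0 < normc al + normc al / 2 by lra.
have f0 : 0 < normc (f z) by apply: lt_le_trans h1; exact: mulr_gt0.
have lnN : ln (normc z ^+ N) = N%:R * ln (normc z) by rewrite lnXn // mulr_natl.
have k1 : K1 <= Num.max K1 K2 by rewrite le_max lexx.
have k2 : K2 <= Num.max K1 K2 by rewrite le_max lexx orbT.
have l1 : ln ((normc al - normc al / 2) * normc z ^+ N) <= ln (normc (f z)).
  by rewrite ler_ln ?posrE // mulr_gt0.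
have l2 : ln (normc (f z)) <= ln ((normc al + normc al / 2) * normc z ^+ N).
  by rewrite ler_ln ?posrE // mulr_gt0.
move: l1 l2; rewrite !lnM ?posrE // lnN -/K2 => l1 l2.
by rewrite /lnc; move: l1 k1; rewrite /K1 => l1 k1; apply/andP; split; lra.
Qed.

Lemma asymp_ratio f g al N : al != 0 -> asymp f al N -> asymp g al N ->
  forall e : R, 0 < e -> exists r : R, forall z, r < normc z -> normc (f z / g z - 1) <= e.
Proof.
move=> al0 Hf Hg e e0; have na : 0 < normc al by rewrite normc_gt0.
have a0 : 0 < normc al / 2 by rewrite divr_gt0.
pose e1 := e * (normc al / 2) / 2; have e10 : 0 < e1 by rewrite !(mulr_gt0, divr_gt0).
have [r1 H1] := Hf _ e10; have [r2 H2] := Hg _ e10; have [r3 H3] := asymp_lower_bound a0 Hg.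
exists (Num.max 0 (Num.max (Num.max r1 r2) r3)) => z.
rewrite !gt_max => /and3P[z0 /andP[/H1 h1 /H2 h2] /H3 h3].
have zN : 0 < normc z ^+ N by exact: exprn_gt0.
have g0 : 0 < normc (g z) by apply: lt_le_trans h3; apply: mulr_gt0 => //; lra.
have gn0 : g z != 0 by rewrite -normc_gt0.
rewrite -[1](divff gn0) -mulrBl normc_div ler_pdivrMr //.
rewrite (_ : f z - g z = (f z - al * z ^+ N) - (g z - al * z ^+ N)); last by ring.
apply: le_trans (normcB _ _) _; apply: le_trans (lerD h1 h2) _.
have : e * ((normc al - normc al / 2) * normc z ^+ N) <= e * normc (g z) by rewrite ler_pM2l.
by rewrite /e1; lra.
Qed.

Lemma asymp_poly_size (T : {poly C}) N (K r : R) :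
  (forall z, r < normc z -> normc T.[z] <= K * normc z ^+ N) -> (size T <= N.+1)%N.
Proof.
move=> H; rewrite leqNgt; apply/negP => sT.
have [n sTn] : exists n, size T = n.+1 by exists (size T).-1; rewrite prednK // (leq_ltn_trans _ sT).
have HT := asymp_horner sTn asymp_id.
have al0 : T`_n != 0 by rewrite -[n]/(n.+1.-1) -sTn -/(lead_coef T) lead_coef_eq0 -size_poly_eq0 sTn.
have a0 : 0 < normc T`_n / 2 by rewrite divr_gt0 // normc_gt0.
have [r1 H1] := asymp_lower_bound a0 HT.
pose z : C := (Num.max 0 (Num.max (Num.max r r1) (Num.max 1 (`|K| / (normc T`_n / 2)))) + 1)%:C.
have zE : normc z = Num.max 0 (Num.max (Num.max r r1) (Num.max 1 (`|K| / (normc T`_n / 2)))) + 1.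
  by rewrite normcR ger0_norm // addr_ge0 // le_max lexx.
have : Num.max 0 (Num.max (Num.max r r1) (Num.max 1 (`|K| / (normc T`_n / 2)))) < normc z by rewrite zE; lra.
rewrite !gt_max => /and3P[z0 /andP[/H h /H1 h1]] /andP[z1 zK].
have Nn : (N < n)%N by rewrite -ltnS -sTn.
have := le_trans h1 h; move: (normc T`_n) zK a0 => q zK a0; rewrite -(subnKC Nn) exprD exprS.
have zN : 0 < normc z ^+ N by exact: exprn_gt0.
have zx : 1 <= normc z ^+ (n - N.+1) by rewrite exprn_ege1 // ltW.
rewrite (_ : _ * (_ * _ * _) = ((q / 2) * normc z * normc z ^+ (n - N.+1)) * normc z ^+ N); last by field.
rewrite ler_pM2r // leNgt => /negP; apply.
apply: (@lt_le_trans _ _ ((q / 2) * normc z)); last first.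
  by rewrite ler_peMr // mulr_ge0 ?normc_ge0 // ltW.
apply: le_lt_trans (ler_norm K) _.
by rewrite mulrC -ltr_pdivrMr.
Qed.

End Asymptotics.

(** * Rigidity in the exterior of a compact set *)

Section RealContinuity.
Variable R : realType.
Local Notation C := R[i].

Lemma open_nearcP (A : set C) : (forall z, A z -> nearc z A) -> open A.
Proof. by move=> H; apply: open_normc => z /H[r r0 Hr]; exists r. Qed.

Lemma closed_rcont_ge (T : set C) (h : C -> R) (c : R) : closed T ->
  (forall z, T z -> rcont h z) -> closed [set z | T z /\ c <= h z].
Proof.
move=> cT hc; apply: closed_normc => z Hz.
have Tz : T z.
  apply: cT => B /nbhs_normc[e e0 He]; have [w [Tw _] wz] := Hz e e0.
  by exists w; split => //; exact: He.
split => //; rewrite leNgt; apply/negP => hz.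
have e0 : 0 < c - h z by lra.
have [d d0 Hd] := hc z Tz _ e0; have [w [Tw cw] wz] := Hz d d0.
by have := Hd w wz; rewrite ltr_norml => /andP[_ ?]; lra.
Qed.

Lemma rcont_complex (h : C -> R) z : rcont h z <-> ccont (fun w => (h w)%:C) z.
Proof.
split=> [H|/ccont_normcP H e e0].
  by apply/ccont_normcP => e e0; apply: nearcS (H e e0) => w; rewrite -rmorphB normcR.
by apply: nearcS (H e e0) => w; rewrite -rmorphB normcR.
Qed.

Lemma rcont_prod (I : Type) (s : seq I) (h : I -> C -> R) z :
  (forall i, rcont (h i) z) -> rcont (fun w => \prod_(i <- s) h i w) z.
Proof.
move=> H; apply/rcont_complex.
rewrite (_ : (fun w => _) = fun w => \prod_(i <- s) (h i w)%:C); last first.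
  by apply/funext => w; rewrite rmorph_prod.
by apply: ccont_prod => i; apply/rcont_complex.
Qed.

Lemma rcont_powR (f : C -> C) (m : R) z : 0 < m -> ccont f z ->
  rcont (fun w => normc (f w) `^ m) z.
Proof.
move=> m0 fc e e0; have [fz0|fz0] := eqVneq (f z) 0.
  have d0 : 0 < e `^ m^-1 by rewrite powR_gt0.
  have := iffLR (ccont_normcP f z) fc _ d0; apply: nearcS => w; rewrite fz0 subr0 normc0.
  rewrite powR0 ?gt_eqF // subr0 ger0_norm ?powR_ge0 // => H.
  rewrite -[e]powRr1 ?ltW // -(mulVf (lt0r_neq0 m0)) powRrM.
  by apply: gt0_ltr_powR => //; rewrite nnegrE ?normc_ge0 ?powR_ge0.
have L := rcontZ m (rcont_lnc fc fz0).
have E w : f w != 0 -> normc (f w) `^ m = expR (m * lnc (f w)).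
  by move=> w0; rewrite /powR gt_eqF // normc_gt0.
have /nbhs_ballP[d /= d0 Hd] : nbhs (m * lnc (f z)) (fun t => `|expR (m * lnc (f z)) - expR t| < e).
  exact: (iffLR (cvgrPdist_lt _ _) (@continuous_expR R (m * lnc (f z))) e e0).
apply: nearcS2 (L d d0) (near_neq0 fc fz0) => w Hw w0.
by rewrite !E // distrC; apply: Hd; rewrite /ball /= distrC.
Qed.

End RealContinuity.

Section ExteriorRigidity.
Variable R : realType.
Local Notation C := R[i].
Variables (E : set C) (F : C -> C).
Hypothesis Eclosed : closed E.
Hypothesis Fd : forall z, ~ E z -> cdiff F z.
Hypothesis F1 : forall z, ~ E z -> 1 < normc (F z).
Hypothesis Fclosed : forall e : R, 0 < e -> closed [set z | ~ E z /\ expR e <= normc (F z)].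

Lemma lnc_F_gt0 z : ~ E z -> 0 < lnc (F z).
Proof. by move=> /F1 H; rewrite /lnc ln_gt0. Qed.

Lemma F_neq0 z : ~ E z -> F z != 0.
Proof. by move=> /F1 H; rewrite -normc_gt0; lra. Qed.

Lemma exterior_near z : ~ E z -> nearc z (~` E).
Proof. by move=> Ez; apply: open_nearc => //; exact: closed_openC. Qed.

(* The boundary values of [ln |g|] are beaten by [N ln |F|] for every [N]. *)
Lemma exterior_vanish (g : C -> C) : (forall z, ~ E z -> cdiff g z) ->
  (exists r : R, forall z, ~ E z -> r < normc z -> g z = 0) ->
  (exists M : R, forall z, ~ E z -> normc (g z) <= M) ->
  forall z, ~ E z -> g z = 0.
Proof.
move=> gd [r gr] [M gM] z Ez; apply/eqP; apply: contrapT => /negP gz.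
pose M1 := Num.max 1 M; have M10 : 0 < M1 by rewrite lt_max ltr01.
have gM1 w : ~ E w -> normc (g w) <= M1 by move=> /gM H; rewrite le_max H orbT.
pose D := [set w | ~ E w /\ g w != 0].
have oD : open D.
  apply: open_nearcP => w [Ew gw]; apply: nearcI; first exact: exterior_near.
  exact: near_neq0 (cdiff_continuous (gd w Ew)) gw.
have key N : lnc (g z) + N.+1%:R * lnc (F z) <= ln M1.
  have N0 : 0 < N.+1%:R :> R by rewrite ltr0n.
  pose beta (b : bool) : R := if b then 1 else N.+1%:R.
  pose f (b : bool) : C -> C := if b then g else F.
  have lE w : logsum beta f w = lnc (g w) + N.+1%:R * lnc (F w).
    by rewrite /logsum big_bool /beta /f mul1r.
  have lM w : g w != 0 -> F w != 0 -> lnc (g w) + N.+1%:R * lnc (F w) = lnc (g w * F w ^+ N.+1).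
    by move=> g0 f0; rewrite lncM ?expf_neq0 // lncX.
  rewrite -lE; apply: (@maximum_principle _ _ beta f D (ln M1)) => //.
  - by move=> w [Ew gw] []; [exact: gd | exact: Fd].
  - by move=> w [Ew gw] []; [exact: gw | exact: F_neq0].
  move=> e e0; apply: (@closed_bounded_compact _ _ r); last first.
    move=> w [[Ew gw] _]; rewrite leNgt; apply/negP => rw.
    by move: gw; rewrite gr ?eqxx.
  have e1 : 0 < e / N.+1%:R by rewrite divr_gt0.
  (* The superlevel set is rewritten without logarithms. As [ln |g| <= ln M1], it lies in a closed
     set where [|F|] stays away from 1; there the modulus of [g F^(N+1)] is continuous, and its
     positive lower bound excludes the zeros of [g]. *)
  rewrite (_ : [set _ | _] = [set w | [set w | ~ E w /\ expR (e / N.+1%:R) <= normc (F w)] w /\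
      expR (ln M1 + e) <= normc (g w * F w ^+ N.+1)]).
    apply: closed_rcont_ge; first exact: Fclosed.
    move=> w [Ew _]; apply: rcont_normc; apply: cdiff_continuous.
    by apply: cdiffM; [exact: gd | apply: cdiffX; exact: Fd].
  apply/seteqP; split=> w /=; rewrite lE.
    move=> [[Ew gw] H]; have Fw := F_neq0 Ew.
    have lF : e / N.+1%:R <= lnc (F w).
      rewrite ler_pdivrMr // [_ * _]mulrC.
      by have : lnc (g w) <= ln M1 by [rewrite /lnc ler_ln ?posrE ?normc_gt0 // gM1]; lra.
    split; first by split => //; rewrite -(@lnK _ (normc (F w))) ?posrE ?normc_gt0 // ler_expR.
    by rewrite -(@lnK _ (normc _)) ?posrE ?normc_gt0 ?mulf_neq0 ?expf_neq0 // ler_expR -/(lnc _) -lM.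
  move=> [[Ew _] H]; have Fw := F_neq0 Ew.
  have gw : g w != 0.
    apply/eqP => g0; move: H; rewrite g0 mul0r normc0 leNgt => /negP; apply; exact: expR_gt0.
  split => //; rewrite lM // /lnc -ler_expR lnK // posrE normc_gt0.
  by rewrite mulf_neq0 ?expf_neq0.
have lF := lnc_F_gt0 Ez.
pose x := (ln M1 - lnc (g z)) / lnc (F z).
have := key (Num.truncn x); have := truncnS_gt x.
by rewrite /x ltr_pdivrMr //; lra.
Qed.

(** The indicator function of such a set would be holomorphic off [E], bounded, and 0 near infinity.
    Thus the complement of [E] has no bounded component. *)
Lemma exterior_clopen (D : set C) : open D -> D `<=` ~` E ->
  (forall z, ~ E z -> closure D z -> D z) -> (exists M : R, forall z, D z -> normc z <= M) ->
  forall z, ~ D z.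
Proof.
move=> oD DE Dcl [M DM] z Dz; pose g w : C := if `[< D w >] then 1 else 0.
have : g z = 0; last by rewrite /g asboolT // => /eqP; rewrite oner_eq0.
apply: exterior_vanish (DE _ Dz).
- move=> w Ew; have [Dw|nDw] := pselect (D w).
    apply: cdiff_near (cdiff_cst 1 w); apply: nearcS (open_nearc oD Dw) => w' Dw'.
    by rewrite /g asboolT.
  apply: cdiff_near (cdiff_cst 0 w).
  have : nearc w (~` closure D).
    by apply: open_nearc; [exact: closed_openC (@closed_closure _ D) | move=> /(Dcl w Ew)].
  apply: nearcS => w' Dw'; rewrite /g asboolF // => ?; apply: Dw'; exact: subset_closure.
- exists M => w Ew Mw; rewrite /g asboolF // => /DM; lra.
- by exists 1 => w _; rewrite /g; case: ifP => _; rewrite ?normc1 // normc0.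
Qed.

End ExteriorRigidity.

(** * Two expressions for the Green function of the complement of [E] *)

Section GreenFunction.
Variable R : realType.
Local Notation C := R[i].
Variables (E : set C) (F : C -> C).
Hypothesis Eclosed : closed E.
Hypothesis Fd : forall z, ~ E z -> cdiff F z.
Hypothesis F1 : forall z, ~ E z -> 1 < normc (F z).
Hypothesis Fclosed : forall e : R, 0 < e -> closed [set z | ~ E z /\ expR e <= normc (F z)].
Variables (n : nat) (alpha : C).
Hypothesis n0 : (0 < n)%N.
Hypothesis alpha0 : alpha != 0.
Hypothesis Fasymp : asymp F alpha n.

Variables (l : nat) (a : 'I_l -> C) (m : 'I_l -> R) (c : R) (phi : C -> C).
Hypothesis m_gt0 : forall j, 0 < m j.
Hypothesis m_sum : \sum_j m j = 1.
Hypothesis c_ge0 : 0 <= c.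
Hypothesis phid : forall z, ~ E z -> cdiff phi z.
Hypothesis phiasymp : asymp phi 1 1.
Hypothesis phi_out : forall z, ~ E z -> ~ lemniscatic_set a m c (phi z).
Hypothesis phi_closed : forall B : set C, closed B -> B `<=` ~` lemniscatic_set a m c ->
  closed [set z | ~ E z /\ B (phi z)].

Definition logU w : R := \sum_j m j * lnc (w - a j).

Lemma lemniscatic_neq w j : ~ lemniscatic_set a m c w -> w - a j != 0.
Proof.
move=> Lw; apply/eqP => w0; apply: Lw; rewrite /lemniscatic_set /=.
by rewrite (bigD1 j) //= w0 normc0 powR0 ?gt_eqF // mul0r.
Qed.

Lemma expR_logU w : (forall j, w - a j != 0) ->
  expR (logU w) = \prod_j normc (w - a j) `^ m j.
Proof.
move=> w0; rewrite expR_sum; apply: eq_bigr => j _.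
by rewrite /powR gt_eqF // normc_gt0.
Qed.

Lemma phi_neq z j : ~ E z -> phi z - a j != 0.
Proof. by move=> /phi_out; exact: lemniscatic_neq. Qed.

(** The counterpart of [Fclosed] for the second expression: near [E], [|U(phi)|] cannot stay above a
    level larger than [c]. *)
Lemma logU_closed (A : R) : c < expR A -> closed [set z | ~ E z /\ A <= logU (phi z)].
Proof.
move=> cA; pose B := [set w : C | expR A <= \prod_j normc (w - a j) `^ m j].
have cB : closed B.
  rewrite (_ : B = [set w | setT w /\ expR A <= \prod_j normc (w - a j) `^ m j]).
    apply: closed_rcont_ge; first exact: closedT.
    move=> w _; apply: rcont_prod => j; apply: rcont_powR => //.
    by apply: cdiff_continuous; apply: cdiffB; [exact: cdiff_id | exact: cdiff_cst].
  by apply/seteqP; split => w //= [].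
have BL : B `<=` ~` lemniscatic_set a m c.
  by move=> w; rewrite /B /lemniscatic_set /= => H H'; have := le_trans H H'; lra.
have := phi_closed cB BL; congr closed; apply/seteqP; split => z [Ez];
by rewrite /B /= -expR_logU ?ler_expR // => j; exact: phi_neq.
Qed.

Lemma logU_gt z : ~ E z -> c < expR (logU (phi z)).
Proof.
move=> Ez; rewrite expR_logU; last by move=> j; exact: phi_neq.
by have /negP := phi_out Ez; rewrite -ltNge.
Qed.

Lemma logU_asymp : exists r K : R, 1 < r /\ forall z, r < normc z ->
  ln (normc z) - K <= logU (phi z) <= ln (normc z) + K.
Proof.
have aj j : asymp (fun z => phi z - a j) 1 1.
  have := asympD phiasymp (asymp_lt (ltn0Sn 0) (asymp_cst (- a j))).
  by rewrite addr0.
have lj j := asymp_lnc (oner_neq0 _) (aj j).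
have [r rP] := choice lj; have [K KP] := choice rP.
exists (\sum_j `|r j| + 2), (\sum_j m j * K j); split.
  have : 0 <= \sum_j `|r j| by apply: sumr_ge0.
  by lra.
move=> z rz.
have {KP} H j : ln (normc z) - K j <= lnc (phi z - a j) <= ln (normc z) + K j.
  have [_ /(_ z)] := KP j; rewrite mul1r; apply; apply: le_lt_trans rz.
  apply: le_trans (ler_norm _) _; rewrite (bigD1 j) //= -addrA lerDl addr_ge0 //.
  by apply: sumr_ge0.
have E1 : ln (normc z) = \sum_j m j * ln (normc z) by rewrite -mulr_suml m_sum mul1r.
rewrite E1 -sumrB -big_split /=; apply/andP; split; apply: ler_sum => j _.
  by rewrite -mulrBr ler_pM2l //; case/andP: (H j).
by rewrite -mulrDr ler_pM2l //; case/andP: (H j).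
Qed.

Definition potential_sum (s t : R) z : R := s * lnc (F z) + t * logU (phi z).

(** At infinity the potential behaves like [(s n + t) ln |z|], so the sign condition bounds the
    superlevel sets. *)
Lemma potential_max (s t M : R) :
  (forall e : R, 0 < e -> closed [set z | ~ E z /\ M + e <= potential_sum s t z]) ->
  s * n%:R + t < 0 -> forall z, ~ E z -> potential_sum s t z <= M.
Proof.
move=> cl st0.
pose beta (i : unit + 'I_l) : R := if i is inr j then t * m j else s.
pose f (i : unit + 'I_l) : C -> C := if i is inr j then fun z => phi z - a j else F.
have lE : logsum beta f = potential_sum s t.
  apply/funext => z; rewrite /logsum big_sumType /= /potential_sum; congr (_ + _).
    by rewrite big_const card_unit /= addr0.
  by rewrite /logU mulr_sumr; apply: eq_bigr => j _; rewrite mulrA.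
rewrite -lE in cl *; move=> z Ez; apply: (@maximum_principle _ _ beta f (~` E)) => //.
- exact: closed_openC.
- move=> w Ew [[]|j]; first exact: Fd.
  by apply: cdiffB; [exact: phid | exact: cdiff_cst].
- by move=> w Ew [[]|j]; [exact: (F_neq0 F1) | exact: phi_neq].
move=> e e0; have [r1 [K1 [r11 H1]]] := asymp_lnc alpha0 Fasymp.
have [r2 [K2 [r21 H2]]] := logU_asymp.
pose K := `|s| * K1 + `|t| * K2; pose x := (M + e - K) / (s * n%:R + t).
apply: (@closed_bounded_compact _ _ (Num.max (Num.max r1 r2) (expR x))); first exact: cl.
move=> w [Ew]; rewrite lE => Mw; rewrite leNgt; apply/negP.
rewrite !gt_max => /andP[/andP[rw1 rw2] xw].
have w0 : 0 < normc w by lra.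
have lx : x < ln (normc w) by rewrite -ltr_expR lnK.
have := H1 w rw1; have := H2 w rw2; set L := ln (normc w) in lx * => h2 h1.
have b1 : s * lnc (F w) <= s * (n%:R * L) + `|s| * K1.
  rewrite -lerBlDl -mulrBr; apply: le_trans (ler_norm _) _; rewrite normrM ler_wpM2l //.
  by rewrite ler_norml; apply/andP; split; lra.
have b2 : t * logU (phi w) <= t * L + `|t| * K2.
  rewrite -lerBlDl -mulrBr; apply: le_trans (ler_norm _) _; rewrite normrM ler_wpM2l //.
  by rewrite ler_norml; apply/andP; split; lra.
have : M + e <= (s * n%:R + t) * L + K.
  by apply: le_trans Mw _; rewrite /potential_sum /K; lra.
move: lx; rewrite /x ltr_ndivrMr // => lx; rewrite [_ * L]mulrC; lra.
Qed.

Lemma potential_rcont s t z : ~ E z -> rcont (potential_sum s t) z.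
Proof.
move=> Ez; apply: rcontD; apply: rcontZ.
  by apply: rcont_lnc; [exact: cdiff_continuous (Fd Ez) | exact: (F_neq0 F1)].
apply: rcont_sum => j; apply: rcontZ; apply: rcont_lnc; last exact: phi_neq.
by apply: cdiff_continuous; apply: cdiffB; [exact: phid | exact: cdiff_cst].
Qed.

Lemma potential_le (s t M : R) :
  (forall (e : R), 0 < e -> exists2 T, closed T /\ T `<=` ~` E &
     forall z, ~ E z -> M + e <= potential_sum s t z -> T z) ->
  s * n%:R + t < 0 -> forall z, ~ E z -> potential_sum s t z <= M.
Proof.
move=> H; apply: potential_max => e /H[T [cT TE] HT].
rewrite (_ : [set _ | _] = [set z | T z /\ M + e <= potential_sum s t z]).
  by apply: closed_rcont_ge => // z /TE; exact: potential_rcont.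
by apply/seteqP; split => z [h1 h2]; split => //; [exact: HT | exact: TE].
Qed.

Lemma le_perturb (x y k : R) : 0 <= k -> (forall e : R, 0 < e -> x <= y + e * k) -> x <= y.
Proof.
move=> k0 H; rewrite leNgt; apply/negP => xy.
have e0 : 0 < (x - y) / 2 / (k + 1) by rewrite !divr_gt0 //; lra.
have := H _ e0; have : (x - y) / 2 / (k + 1) * k <= (x - y) / 2.
  by rewrite mulrAC ler_pdivrMr ?ler_wpM2l //; lra.
lra.
Qed.

(** At infinity the difference is only bounded, so [ln |F|] first gets the coefficient [- (1 + e)].
    As [ln |F| > 0], a superlevel set lies where [logU] exceeds [A] by a fixed amount, away from
    [E]. Then [e] tends to 0. *)
Lemma logU_le (A : R) : c <= expR A -> forall z, ~ E z ->
  n%:R * logU (phi z) - lnc (F z) <= n%:R * A.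
Proof.
move=> cA z Ez; have nR : 0 < n%:R :> R by rewrite ltr0n.
have lF z' : ~ E z' -> 0 < lnc (F z') by exact: (lnc_F_gt0 F1).
apply: (@le_perturb _ _ (lnc (F z))); first exact/ltW/lF.
move=> e e0.
suff : potential_sum (- (1 + e)) n%:R z <= n%:R * A by rewrite /potential_sum; lra.
apply: potential_le Ez; last first.
  by have : 0 < e * n%:R by [exact: mulr_gt0]; lra.
move=> d d0; exists [set z | ~ E z /\ A + d / n%:R <= logU (phi z)].
  split; last by move=> w [].
  apply: logU_closed; apply: le_lt_trans cA _; rewrite ltr_expR ltrDl divr_gt0 //.
move=> w Ew H; split => //; have := lF w Ew => lFw.
have e1 : 0 < e * lnc (F w) by exact: mulr_gt0.
have : n%:R * (A + d / n%:R) <= n%:R * logU (phi w).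
  by rewrite mulrDr mulrCA divff ?gt_eqF // mulr1; move: H; rewrite /potential_sum; lra.
by rewrite ler_pM2l.
Qed.

(** If [c] were 0, [logU_le] would hold for every real [A], however negative. *)
Lemma capacity_gt0 : (exists z, ~ E z) -> 0 < c.
Proof.
move=> [z Ez]; rewrite lt_def c_ge0 andbT; apply/eqP => c0.
have nR : 0 < n%:R :> R by rewrite ltr0n.
pose A := (n%:R * logU (phi z) - lnc (F z) - 1) / n%:R.
have cA : c <= expR A by rewrite c0 expR_ge0.
have := logU_le cA Ez; rewrite /A mulrCA divff ?gt_eqF //; lra.
Qed.

(** One inequality is [logU_le] at [A = ln c]. The other exchanges the roles of the two expressions,
    with [Fclosed] in place of [logU_closed]. *)
Lemma green_function : (exists z, ~ E z) ->
  forall z, ~ E z -> lnc (F z) - n%:R * logU (phi z) = - (n%:R * ln c).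
Proof.
move=> /capacity_gt0 c0 z Ez; have nR : 0 < n%:R :> R by rewrite ltr0n.
have lF z' : ~ E z' -> 0 < lnc (F z') by exact: (lnc_F_gt0 F1).
apply/eqP; rewrite eq_le; apply/andP; split; last first.
  have cA : c <= expR (ln c) by rewrite lnK.
  by have := logU_le cA Ez; lra.
apply: (@le_perturb _ _ (lnc (F z))); first exact/ltW/lF.
move=> e e0; have e'0 : 0 < Num.min e (1 / 2) by rewrite lt_min e0; lra.
have : potential_sum (1 - Num.min e (1 / 2)) (- n%:R) z <= - (n%:R * ln c).
  apply: potential_le Ez; last first.
    by have : 0 < Num.min e (1 / 2) * n%:R by [exact: mulr_gt0]; lra.
  move=> d d0; exists [set z | ~ E z /\ expR d <= normc (F z)].
    by split; [exact: Fclosed | move=> w []].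
  move=> w Ew H; split => //; have := lF w Ew => lFw.
  rewrite -(@lnK _ (normc (F w))) ?posrE ?normc_gt0 ?(F_neq0 F1) // ler_expR -/(lnc _).
  have e1 : 0 < Num.min e (1 / 2) * lnc (F w) by exact: mulr_gt0.
  have : n%:R * ln c < n%:R * logU (phi w).
    by rewrite ltr_pM2l // -ltr_expR lnK //; exact: logU_gt.
  by move: H; rewrite /potential_sum; lra.
have : Num.min e (1 / 2) * lnc (F z) <= e * lnc (F z).
  by rewrite ler_pM2r ?lF // ge_min lexx.
by rewrite /potential_sum; lra.
Qed.

End GreenFunction.

(** * A Jordan polygon around a connected compact set *)

Section TriangularLattice.
Variable R : realType.
Local Notation C := R[i].
Implicit Types (u v w : int * int) (z : C).

Definition emb v : C := (v.1%:~R : R) +i* (v.2%:~R : R).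

(* Rotation by a sixth of a turn in the triangulation of the plane with vertex
   set Z^2 and edge directions (1,0), (1,1), (0,1) and their opposites. *)
Definition rot v : int * int := (v.1 - v.2, v.1).

(** The six directions as an orbit of [rot]: a rotation-invariant statement is checked for [(1, 0)]
    and transported by induction on [k]. *)
Definition isdir v := exists k, v = iter k rot (1, 0).

Lemma isdir_rot v : isdir v -> isdir (rot v).
Proof. by move=> [k ->]; exists k.+1. Qed.

Lemma isdir_sub_rot v : isdir v -> isdir (v - rot v).
Proof.
move=> /isdir_rot/isdir_rot/isdir_rot/isdir_rot/isdir_rot.
by congr isdir; case: v => a b; rewrite /rot; congr pair => /=; lia.
Qed.

Definition dirs : seq (int * int) :=
  [:: (1, 0); (1, 1); (0, 1); (-1, 0); (-1, -1); (0, -1)].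

Lemma isdir_cases v : isdir v -> v \in dirs.
Proof.
move=> [k ->]; elim: k => //= k; rewrite !inE.
by do 5?[move=> /predU1P[->//|]]; move=> /eqP ->.
Qed.

Lemma isdir_neq0 v : isdir v -> v <> (0, 0).
Proof. by move=> /isdir_cases + v0; rewrite v0. Qed.

Lemma dir_cancel w u : u <> (0, 0) ->
  [/\ w + u <> w, w + u <> w + rot u, w + u <> w + rot (rot u), w <> w + rot u &
      w <> w + rot u + rot (u - rot u)].
Proof.
case: w u => [a b] [x y] u0; split=> -[? ?]; apply: u0; congr pair; lia.
Qed.

Lemma embD v w : emb (v + w) = emb v + emb w.
Proof. by apply: eqC; rewrite ?ReD ?ImD /= intrD. Qed.

Lemma embN v : emb (- v) = - emb v.
Proof. by apply: eqC; rewrite ?ReN ?ImN /= mulrNz. Qed.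

(** The real-linear extension of [rot]. It is not multiplication by a complex number, since the
    triangles are not equilateral. *)
Definition rotC z : C := (Re z - Im z) +i* Re z.

Lemma emb_rot v : emb (rot v) = rotC (emb v).
Proof. by apply: eqC; rewrite /= ?intrB. Qed.

(** The norm whose unit ball is the hexagon with the six directions as vertices: the points at
    distance less than 1 from a lattice vertex form its open star in the triangulation. *)
Definition hexnorm z : R := Num.max (Num.max `|Re z| `|Im z|) `|Re z - Im z|.

Lemma hexnorm_rot z : hexnorm (rotC z) = hexnorm z.
Proof.
rewrite /hexnorm /= (_ : Re z - Im z - Re z = - Im z); last by ring.
by rewrite normrN -maxA maxC.
Qed.

Lemma hexnorm_dir u (b g : R) : isdir u -> 0 <= b -> 0 <= g ->
  hexnorm (b%:C * emb u + g%:C * emb (rot u)) = b + g.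
Proof.
move=> [k ->] b0 g0; elim: k => [|k IH].
  rewrite /hexnorm /emb /= !ger0_norm; try lra.
  rewrite /Num.max; do ![case: ifP]; lra.
rewrite -[RHS]IH -[RHS]hexnorm_rot iterS; congr hexnorm.
by rewrite !emb_rot; apply: eqC => /=; ring.
Qed.

Lemma hexnorm_lt1 z : hexnorm z < 1 -> [/\ `|Re z| < 1, `|Im z| < 1 & `|Re z - Im z| < 1].
Proof. by rewrite /hexnorm !gt_max -andbA => /and3P[]. Qed.

(** Affine coordinates for the triangle [w], [w + u], [w + rot u]; for arbitrary reals they
    parametrise the whole plane. *)
Definition bary w u (b g : R) : C := emb w + b%:C * emb u + g%:C * emb (rot u).

Definition nd v z : R := hexnorm (z - emb v).

Lemma nd_lt1 v z : nd v z < 1 -> `|Re z - v.1%:~R| < 1 /\ `|Im z - v.2%:~R| < 1.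
Proof. by rewrite /nd => /hexnorm_lt1[]; rewrite ReB ImB. Qed.

Lemma nd_w w u b g : isdir u -> 0 <= b -> 0 <= g -> nd w (bary w u b g) = b + g.
Proof.
move=> du b0 g0; rewrite -(hexnorm_dir du b0 g0) /nd /bary; congr hexnorm; ring.
Qed.

Lemma nd_b w u b g : isdir u -> b + g <= 1 -> 0 <= g -> nd (w + u) (bary w u b g) = 1 - b.
Proof.
move=> du bg g0.
have -> : 1 - b = g + (1 - b - g) by ring.
have a0 : 0 <= 1 - b - g by lra.
rewrite -(hexnorm_dir (isdir_rot (isdir_rot du)) g0 a0).
rewrite /nd /bary embD; congr hexnorm.
by case: u {du} => x y; apply: eqC; rewrite /= ?intrB; ring.
Qed.

Lemma nd_c w u b g : isdir u -> b + g <= 1 -> 0 <= b -> nd (w + rot u) (bary w u b g) = 1 - g.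
Proof.
move=> du bg b0.
have -> : 1 - g = (1 - b - g) + b by ring.
have d4 := isdir_rot (isdir_rot (isdir_rot (isdir_rot du))).
have a0 : 0 <= 1 - b - g by lra.
rewrite -(hexnorm_dir d4 a0 b0).
rewrite /nd /bary embD; congr hexnorm.
by case: u {du d4} => x y; apply: eqC; rewrite /= ?intrB; ring.
Qed.

Lemma int01 (p : int) : -1 < p -> p < 2 -> p = 0 \/ p = 1.
Proof. by case: p => [[|[|n]]|[|n]] //; [left | right]. Qed.

(** A point of a closed triangle lies in the open stars of its corners only. By rotation it is
    enough to treat [u = (1, 0)], where both integer coordinates of the vertex are 0 or 1. *)
Lemma nd_support w u b g v : isdir u -> 0 <= b -> 0 <= g -> b + g <= 1 ->
  nd v (bary w u b g) < 1 -> [\/ v = w, v = w + u | v = w + rot u].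
Proof.
move=> du b0 g0 bg.
suff H v' : hexnorm (b%:C * emb u + g%:C * emb (rot u) - emb v') < 1 ->
    [\/ v' = 0, v' = u | v' = rot u].
  move=> nv; case: (H (v - w)).
  - by move: nv; rewrite /nd /bary embD embN; congr (hexnorm _ < 1); ring.
  - by move=> /eqP; rewrite subr_eq0 => /eqP ->; constructor 1.
  - by move=> <-; constructor 2; rewrite addrC subrK.
  - by move=> <-; constructor 3; rewrite addrC subrK.
case: du => k ->; elim: k v' => [|k IH] [p q].
  rewrite /= => /hexnorm_lt1[]; rewrite !ReB !ImB !ReD !ImD !Re_scale !Im_scale /=.
  rewrite !ltr_norml => /andP[p1 p2] /andP[q1 q2] /andP[r1 r2].
  have ltz (m n : int) : (m%:~R < n%:~R :> R) -> m < n by rewrite ltr_int.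
  have p3 : -1 < p by apply: ltz; lra.
  have p4 : p < 2 by apply: ltz; lra.
  have q3 : -1 < q by apply: ltz; lra.
  have q4 : q < 2 by apply: ltz; lra.
  have r3 : -1 < p - q by apply: ltz; rewrite intrB; lra.
  clear ltz.
  case: (int01 p3 p4) q3 q4 r3 r1 r2 => -> q3 q4 r3 r1 r2;
    case: (int01 q3 q4) r3 r1 r2 => -> // _ r1 r2; [by constructor 1|by constructor 2|by constructor 3].
pose v'' : int * int := (q, q - p).
have E : rot v'' = (p, q) by rewrite /rot /=; congr pair; lia.
rewrite iterS -E => H; case: (IH v'').
- rewrite -hexnorm_rot; move: H; congr (is_true (hexnorm _ < 1)).
  by rewrite !emb_rot; apply: eqC => /=; ring.
- by move=> e; constructor 1; rewrite e.
- by move=> e; constructor 2; rewrite e.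
- by move=> e; constructor 3; rewrite e.
Qed.

(** The left side is the determinant of [u] and [rot u]. *)
Lemma isdir_norm u : isdir u -> u.1 * u.1 - u.1 * u.2 + u.2 * u.2 = 1.
Proof.
by move=> /isdir_cases; rewrite !inE; do 5?[move=> /predU1P[->//|]]; move=> /eqP ->.
Qed.

Lemma isdir_normR u : isdir u -> u.1%:~R * u.1%:~R - u.1%:~R * u.2%:~R + u.2%:~R * u.2%:~R = 1 :> R.
Proof. by move=> /isdir_norm E; rewrite -!intrM -intrB -intrD E. Qed.

Lemma bary_ex w u z : isdir u -> exists x y, z = bary w u x y.
Proof.
move=> /isdir_normR; set p := u.1%:~R; set q := u.2%:~R => uN.
pose c := z - emb w.
exists (Re c * p - Im c * (p - q)), (p * Im c - q * Re c).
rewrite -[z](subrK (emb w)) -/c /bary emb_rot [LHS]addrC -addrA; congr (_ + _).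
have E (r : R) : r = r * (p * p - p * q + q * q) by rewrite uN mulr1.
by case: (c) => cr ci; apply: eqC => /=; rewrite -/p -/q [LHS]E; ring.
Qed.

(** Up to the sign, the argument of the quotient is the angle under which the edge from [w] to
    [w + u] is seen, and the sign of [y] tells from which side; the determinant 1 of [isdir_norm]
    makes this exact. *)
Lemma bary_turn_Im w u (x y : R) : isdir u -> bary w u x y != emb w ->
  exists2 q : R, 0 < q &
    Im (- ((bary w u x y - emb (w + u)) / (bary w u x y - emb w))) = - (y * q).
Proof.
move=> du; rewrite -subr_eq0.
have -> : bary w u x y - emb w = x%:C * emb u + y%:C * emb (rot u) by rewrite /bary; ring.
have -> : bary w u x y - emb (w + u) = x%:C * emb u + y%:C * emb (rot u) - emb u.
  by rewrite /bary embD; ring.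
set d := x%:C * _ + _ => d0; have d1 : 0 < normc d by rewrite normc_gt0.
exists ((normc d ^+ 2)^-1); first by rewrite invr_gt0 exprn_gt0.
rewrite mulrBl divff // opprB ImB [Im 1]/= subr0 Im_div.
rewrite -sqr_normcE -[RHS]mulNr; congr (_ * _).
have uN := isdir_normR du.
rewrite /d emb_rot ReD ImD !Re_scale !Im_scale /=.
transitivity (- y * (u.1%:~R * u.1%:~R - u.1%:~R * u.2%:~R + u.2%:~R * u.2%:~R)); first by ring.
by rewrite uN mulr1.
Qed.

End TriangularLattice.

(** * The polygon between white and black vertices *)

Section LatticeCurve.
Variable R : realType.
Local Notation C := R[i].
Variables (K : set C) (rho : R).
Hypothesis Kbounded : forall z, K z -> normc z <= rho.
Implicit Types (u v w : int * int) (D : (int * int) * (int * int)).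

Variable N : nat.
Hypothesis rho_lt_N : rho + 4 < N%:R.

(** [N] exceeds [rho + 4] and the polygon stays within 4 of [K], so a far vertex has larger modulus
    than every point of the polygon. *)
Definition far v := (N < maxn `|v.1| `|v.2|)%N.

(** The closed square of half side 1 contains the star of [v]; hence every vertex at distance less
    than 1 from a point of [K] is close. *)
Definition close_vertex v := exists2 p, K p &
  `|Re p - (v.1%:~R : R)| <= 1 /\ `|Im p - (v.2%:~R : R)| <= 1.

(* The vertices that can be joined to infinity along edges avoiding the close
   vertices; the other vertices are the black ones. *)
Inductive white : int * int -> Prop :=
| WhiteFar v of far v : white v
| WhiteStep v u of white v & isdir u & ~ close_vertex (v + u) : white (v + u).

Lemma far_gt v : far v <-> N%:R < Num.max `|v.1%:~R| `|v.2%:~R| :> R.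
Proof.
have natZ (a : int) : `|a%:~R| = (absz a)%:R :> R by rewrite natr_absz intr_norm.
by rewrite /far leq_max lt_max !natZ !ltr_nat.
Qed.

Lemma close_not_far v : close_vertex v -> ~ far v.
Proof.
move=> [p Kp [p1 p2]] /far_gt.
have := Kbounded Kp; have := Re_le_normc p; have := Im_le_normc p; have := rho_lt_N.
have := ler_normD (v.1%:~R - Re p) (Re p); have := ler_normD (v.2%:~R - Im p) (Im p).
rewrite !subrK [`|v.1%:~R - _|]distrC [`|v.2%:~R - _|]distrC lt_max => ? ? ? ? ? ?.
by move=> /orP[]; lra.
Qed.

Lemma white_not_close v : white v -> ~ close_vertex v.
Proof. by case=> // v' fv /close_not_far. Qed.

(* The dart [(w, u)] stands for the edge from the white vertex [w] to the black
   vertex [w + u]; the polygon crosses it at its midpoint. *)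
Definition dart D := [/\ isdir D.2, white D.1 & ~ white (D.1 + D.2)].

Lemma dart_close D : dart D -> close_vertex (D.1 + D.2).
Proof. by move=> [du ww nb]; apply: contrapT => /(WhiteStep ww du). Qed.

(* The other edge with ends of different colours of the triangle
   [w, w + u, w + rot u]. *)
Definition next_dart D :=
  if `[< white (D.1 + rot D.2) >] then (D.1 + rot D.2, D.2 - rot D.2)
  else (D.1, rot D.2).

(** The same walk turning the other way: [u - rot u] is the inverse rotation of [u], because [rot]
    composed with itself is [rot] minus the identity. *)
Definition prev_dart D :=
  if `[< white (D.1 + (D.2 - rot D.2)) >] then (D.1 + (D.2 - rot D.2), rot D.2)
  else (D.1, D.2 - rot D.2).

Lemma next_dart_dart D : dart D -> dart (next_dart D).
Proof.
case: D => w u [/= du ww nb]; rewrite /next_dart /=.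
case: asboolP => cw; split => //=; last exact: isdir_rot.
  exact: isdir_sub_rot.
by rewrite -addrA [rot u + _]addrC subrK.
Qed.

(** The left inverse makes the walk injective, so that by finiteness every orbit is a cycle through
    its start. *)
Lemma next_dartK D : dart D -> prev_dart (next_dart D) = D.
Proof.
case: D => w u [/= du ww nb]; rewrite /next_dart /prev_dart /=.
case: (asboolP (white (w + rot u))) => cw /=.
  have -> : w + rot u + (u - rot u - rot (u - rot u)) = w.
    by case: w u {du ww nb cw} => [a b] [x y]; rewrite /rot; congr pair => /=; lia.
  rewrite asboolT //; congr pair.
  by case: u {du nb cw} => [x y]; rewrite /rot; congr pair => /=; lia.
have -> : w + (rot u - rot (rot u)) = w + u.
  by case: w u {du ww nb cw} => [a b] [x y]; rewrite /rot; congr pair => /=; lia.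
rewrite asboolF //; congr pair.
by case: u {du nb cw} => [x y]; rewrite /rot; congr pair => /=; lia.
Qed.

Lemma darts_finite : exists s : seq ((int * int) * (int * int)), forall D, dart D -> D \in s.
Proof.
pose ints := [seq i%:Z - N%:Z | i <- iota 0 (N + N).+1].
pose box := [seq (a, b) | a <- ints, b <- ints].
exists [seq (b - u, u) | b <- box, u <- dirs] => D [du ww nb].
have nf : ~ far (D.1 + D.2) by move=> /WhiteFar.
have inints (a : int) : (`|a| <= N)%N -> a \in ints.
  move=> aN; apply/mapP; exists (absz (a + N%:Z)); last by lia.
  by rewrite mem_iota add0n leq0n; lia.
move: nf; rewrite /far => /negP; rewrite -leqNgt geq_max => /andP[h1 h2].
have inbox : (D.1 + D.2) \in box.
  by apply/allpairsP; exists ((D.1 + D.2).1, (D.1 + D.2).2); split; [exact: inints | exact: inints | case: (D.1 + D.2)].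
apply/allpairsP; exists (D.1 + D.2, D.2); split; [exact: inbox | exact: isdir_cases |].
by rewrite addrK; case: (D).
Qed.

Lemma dart_ex : K !=set0 -> exists D, dart D.
Proof.
move=> [p Kp]; pose v0 : int * int := (Num.floor (Re p), Num.floor (Im p)).
have cv0 : close_vertex v0.
  exists p => //=; split; rewrite ler_norml;
  [have /andP[? ] := floor_itv (Re p) | have /andP[? ] := floor_itv (Im p)];
  by rewrite intrD => ?; apply/andP; split; lra.
(* Walk to the right from a close vertex until the first white vertex; with its left neighbour it
   forms a dart. *)
pose v i : int * int := (v0.1 + i%:Z, v0.2).
have [n wn] : exists n, `[< white (v n) >].
  exists (N + absz v0.1).+1%N; apply/asboolP/WhiteFar.
  by rewrite /far /= leq_max; apply/orP; left; lia.
have := ex_minnP (ex_intro (fun n => `[< white (v n) >]) n wn).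
case=> -[|m] /asboolP wm mmin.
  have v00 : v 0%N = v0 by rewrite /v addr0; case: (v0).
  by have := white_not_close wm; rewrite v00.
exists (v m.+1, (-1, 0)); split => //=.
  by exists 3%N.
have -> : v m.+1 + (-1, 0) = v m by rewrite /v; congr pair => /=; lia.
by move=> /asboolP /mmin; rewrite ltnn.
Qed.

Definition dart_iter D0 i := iter i next_dart D0.

Lemma dart_iter_dart D0 i : dart D0 -> dart (dart_iter D0 i).
Proof. by move=> d0; elim: i => //= i; exact: next_dart_dart. Qed.

Lemma dart_iter_cancel D0 i j : dart D0 -> (i <= j)%N ->
  dart_iter D0 i = dart_iter D0 j -> D0 = dart_iter D0 (j - i).
Proof.
move=> d0; elim: i j => [|i IH] [|j] // ij; rewrite ?subn0 //.
rewrite subSS => E; apply: IH => //.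
by rewrite -(next_dartK (dart_iter_dart i d0)) -(next_dartK (dart_iter_dart j d0)); congr prev_dart.
Qed.

Lemma dart_period D0 : dart D0 -> exists k, [/\ (0 < k)%N, dart_iter D0 k = D0 &
  forall i j, (i < k)%N -> (j < k)%N -> dart_iter D0 i = dart_iter D0 j -> i = j].
Proof.
move=> d0; have [s Hs] := darts_finite.
have nu : ~~ uniq [seq dart_iter D0 i | i <- iota 0 (size s).+1].
  apply/negP => u; have := uniq_leq_size (s2 := s) u.
  rewrite size_map size_iota ltnn => H; suff : false by []; apply: H.
  by move=> _ /mapP[i _ ->]; apply: Hs; exact: dart_iter_dart.
have [m [m0 Dm]] : exists m, (0 < m)%N /\ dart_iter D0 m = D0.
  have /(uniqPn D0)[i [j [ij]]] := nu; rewrite size_map size_iota => js.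
  have iS : (i < (size s).+1)%N by exact: ltn_trans ij js.
  rewrite !(nth_map 0%N) ?size_iota // !nth_iota // !add0n => E.
  exists (j - i)%N; rewrite subn_gt0; split => //.
  by rewrite -(dart_iter_cancel d0 (ltnW ij) E).
pose P n := (0 < n)%N && (dart_iter D0 n == D0).
have exP : exists n, P n by exists m; rewrite /P m0 Dm eqxx.
have := ex_minnP exP; case=> k /andP[k0 /eqP Dk] kmin.
exists k; split => // i j.
wlog ij : i j / (i <= j)%N.
  by move=> H ik jk E; have [/H|/ltnW/H] := leqP i j; [apply | move=> ->].
move=> ik jk E; have := dart_iter_cancel d0 ij E.
move=> /esym E'; apply/eqP; rewrite eqn_leq ij /= leqNgt; apply/negP => ij'.
have := kmin (j - i)%N; rewrite /P subn_gt0 ij' E' eqxx => /(_ isT).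
by have := leq_subr i j; lia.
Qed.

Definition dart_mid D : C := emb R D.1 + (2^-1)%:C * emb R D.2.

Definition dart_pt D (t : R) : C := dart_mid D + t%:C * (dart_mid (next_dart D) - dart_mid D).

(** The segment joins the midpoints of two sides of one triangle, so its distances to the corners
    are explicit. *)
Lemma dart_ptE D t : exists bg : R * R, [/\ bg.2 = t / 2,
   bg.1 = (if `[< white (D.1 + rot D.2) >] then 2^-1 else (1 - t) / 2) &
   dart_pt D t = bary D.1 D.2 bg.1 bg.2].
Proof.
case: D => w u; rewrite /dart_pt /dart_mid /next_dart /bary /=.
case: asboolP => cw; eexists (_, _); split => //=.
  rewrite !embD embN !emb_rot; apply: eqC => /=; by field.
by rewrite !emb_rot; apply: eqC => /=; field.
Qed.

(** At [t = 1] the point is the midpoint of the next edge, and one end of the dart is at distance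
    exactly 1; hence the half-open interval. *)
Lemma dart_pt_support D t : dart D -> 0 <= t < 1 ->
  [/\ nd D.1 (dart_pt D t) < 1, nd (D.1 + D.2) (dart_pt D t) < 1,
      nd (D.1 + rot D.2) (dart_pt D t) = 1 - t / 2 &
      forall v, nd v (dart_pt D t) < 1 -> [\/ v = D.1, v = D.1 + D.2 | v = D.1 + rot D.2]].
Proof.
move=> [du _ _] /andP[t0 t1]; have [[b g] /= [Eg Eb ->]] := dart_ptE D t.
have [b0 g0 bg] : [/\ 0 < b, 0 <= g & b + g < 1] by rewrite Eg Eb; case: ifP; split; lra.
have [b0' bg'] := (ltW b0, ltW bg).
rewrite nd_w // nd_b // nd_c // Eg; split => //; try lra.
by move=> v; rewrite -Eg; exact: nd_support.
Qed.

(** The colours decide which of the vertices within distance 1 are the ends of the dart; the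
    parameter is then read off the distance to the third corner. *)
Lemma dart_pt_inj D D' t t' : dart D -> dart D' -> 0 <= t < 1 -> 0 <= t' < 1 ->
  dart_pt D t = dart_pt D' t' -> D = D' /\ t = t'.
Proof.
have half_inj (x y : R) : 1 - x / 2 = 1 - y / 2 -> x = y by lra.
move=> dD dD' t01 t01' E.
have [sw sb sc ss] := dart_pt_support dD t01.
have [sw' sb' sc' ss'] := dart_pt_support dD' t01'.
rewrite E in sw sb sc ss.
have key : D.1 = D'.1 -> D.2 = D'.2 -> D = D' /\ t = t'.
  move=> ew eu; split; first by case: (D) (D') ew eu => [? ?] [? ?] /= -> ->.
  by apply: half_inj; rewrite -sc' -sc ew eu.
have [du ww nb] := dD; have [du' ww' nb'] := dD'.
have [c1 c2 c3 c4 c5] := dir_cancel D.1 (isdir_neq0 du).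
case: (ss _ sw') => ew'.
- have sub u : D'.1 + D'.2 = D.1 + u -> D'.2 = u by rewrite ew' => /addrI.
  case: (ss _ sb') => eb'; first by case: nb'; rewrite eb'.
    by apply: key => //; rewrite (sub _ eb').
  have eu' := sub _ eb'.
  by case: (ss' _ sb); rewrite ew' ?eu'.
- by case: nb; rewrite -ew'.
case: (ss _ sb') => eb'; first by case: nb'; rewrite eb'.
  have eu' : D'.2 = D.2 - rot D.2.
    by rewrite -(addKr D'.1 D'.2) eb' ew' addrC opprD addrACA subrr add0r.
  by case: (ss' _ sw); rewrite ?eb' ?ew' ?eu' => // /esym.
by case: nb'; rewrite eb' -ew'.
Qed.

Lemma dart_pt_white D t z : dart D -> 0 <= t < 1 -> z = dart_pt D t ->
  exists2 v, white v & nd v z < 1.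
Proof. by move=> dD t01 ->; have [? _ _ _] := dart_pt_support dD t01; exists D.1 => //; case: dD. Qed.

Lemma dart_pt_black D t z : dart D -> 0 <= t < 1 -> z = dart_pt D t ->
  exists v, [/\ close_vertex v, ~ white v & nd v z < 1].
Proof.
move=> dD t01 ->; have [_ ? _ _] := dart_pt_support dD t01; exists (D.1 + D.2).
by split => //; [exact: dart_close | case: dD].
Qed.

Section Orbit.
Variables (D0 : (int * int) * (int * int)) (k : nat).
Hypothesis dD0 : dart D0.
Hypothesis k0 : (0 < k)%N.
Hypothesis Dk : dart_iter D0 k = D0.
Hypothesis Dinj : forall i j, (i < k)%N -> (j < k)%N ->
  dart_iter D0 i = dart_iter D0 j -> i = j.

Definition mids i := dart_mid (dart_iter D0 i).

(** Piecewise linear interpolation as a sum of clamped steps: step [i] is carried out while [k t]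
    runs from [i] to [i + 1]. Continuity is immediate in this form. *)
Definition lattice_curve (t : R) : C :=
  mids 0 + \sum_(i < k) (clamp01 (k%:R * t - i%:R))%:C * (mids i.+1 - mids i).

Lemma clamp01_le0 (t : R) : t <= 0 -> clamp01 t = 0.
Proof. by move=> t0; rewrite /clamp01 min_l ?max_l //; lra. Qed.

Lemma clamp01_ge1 (t : R) : 1 <= t -> clamp01 t = 1.
Proof. by move=> t1; rewrite /clamp01 min_r // max_r. Qed.

Lemma lattice_curveE i (s : R) : (i < k)%N -> 0 <= s <= 1 ->
  lattice_curve ((i%:R + s) / k%:R) = dart_pt (dart_iter D0 i) s.
Proof.
move=> ik s01; have /andP[s0 s1] := s01.
have kn : k%:R != 0 :> R by rewrite pnatr_eq0 -lt0n.
rewrite /lattice_curve mulrC divfK // /dart_pt -/(mids i) -/(mids i.+1).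
rewrite -(big_mkord xpredT (fun j => (clamp01 (i%:R + s - j%:R))%:C * (mids j.+1 - mids j))).
rewrite (big_cat_nat (n := i)) //=; last exact: ltnW.
rewrite (big_ltn ik) (_ : i%:R + s - i%:R = s) ?clamp01_id ?addrA //; last by rewrite addrAC subrr add0r.
rewrite [X in _ + X]big1_seq ?addr0; last first.
  move=> j /=; rewrite mem_index_iota => /andP[ij jk]; rewrite clamp01_le0 ?mul0r //.
  by have : i.+1%:R <= j%:R :> R by [rewrite ler_nat]; rewrite -natr1; lra.
congr (_ + _); rewrite (eq_big_nat _ _ (F2 := fun j => mids j.+1 - mids j)).
  by rewrite telescope_sumr // addrC subrK.
move=> j /andP[_ ji]; rewrite clamp01_ge1 ?mul1r //.
by have : j.+1%:R <= i%:R :> R by [rewrite ler_nat]; rewrite -natr1; lra.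
Qed.

Lemma lattice_curve_continuous t : ccont lattice_curve t.
Proof.
apply: ccontD; first exact: ccont_cst.
have H (r : seq 'I_k) : ccont (fun t : R => \sum_(i <- r) (clamp01 (k%:R * t - (i : nat)%:R))%:C * (mids i.+1 - mids i)) t.
  elim: r => [|i r IH].
    rewrite (_ : (fun _ => _) = fun=> 0); first exact: ccont_cst.
    by apply/funext => ?; rewrite big_nil.
  rewrite (_ : (fun _ => _) = fun t : R => (clamp01 (k%:R * t - (i : nat)%:R))%:C * (mids i.+1 - mids i) +
    \sum_(i <- r) (clamp01 (k%:R * t - (i : nat)%:R))%:C * (mids i.+1 - mids i)); last first.
    by apply/funext => ?; rewrite big_cons.
  apply: ccontD IH; apply: ccontM; last exact: ccont_cst.
  split; apply: (cvg_comp (fun t : R => clamp01 (k%:R * t - (i : nat)%:R)) (fun t : R => t%:C : C) _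
    (@real_complex_continuous R _)).
  apply: (cvg_comp (fun t : R => k%:R * t - (i : nat)%:R) (@clamp01 R) _ (@clamp01_continuous R _)).
  by apply: cvgB; [apply: cvgM; [exact: cvg_cst | exact: cvg_id] | exact: cvg_cst].
exact: H.
Qed.

Lemma lattice_curve0 : lattice_curve 0 = mids 0.
Proof.
have := lattice_curveE k0 (_ : 0 <= (0 : R) <= 1); rewrite lexx ler01 => /(_ isT).
by rewrite addr0 mul0r => ->; rewrite /dart_pt mul0r addr0.
Qed.

Lemma lattice_curve1 : lattice_curve 1 = mids 0.
Proof.
have k1 : (k.-1 < k)%N by rewrite prednK.
have := lattice_curveE k1 (_ : 0 <= (1 : R) <= 1); rewrite lexx ler01 => /(_ isT).
rewrite natr1 prednK // divff ?pnatr_eq0 -?lt0n // => ->.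
rewrite /dart_pt mul1r addrC subrK /mids; congr dart_mid.
by rewrite -[RHS]/D0 -[RHS]Dk -{2}(prednK k0).
Qed.

Lemma orbit_param (t : R) : 0 <= t < 1 -> exists i (s : R), [/\ (i < k)%N, 0 <= s < 1 &
  t = (i%:R + s) / k%:R].
Proof.
move=> /andP[t0 t1]; have kp : 0 < k%:R :> R by rewrite ltr0n.
have kt : 0 <= k%:R * t by rewrite mulr_ge0 // ltW.
have := truncn_itv kt; set i := Num.truncn _ => /andP[i1 i2].
exists i, (k%:R * t - i%:R); split.
- by rewrite -(ltr_nat R) (le_lt_trans i1) // -[ltRHS]mulr1 ltr_pM2l.
- by move: i2; rewrite -natr1 => i2; apply/andP; split; lra.
- by rewrite addrC subrK mulrC mulKf // gt_eqF.
Qed.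

Lemma lattice_curve_pt (t : R) : 0 <= t <= 1 -> exists i (s : R), [/\ (i < k)%N, 0 <= s < 1,
  lattice_curve t = dart_pt (dart_iter D0 i) s & t < 1 -> t = (i%:R + s) / k%:R].
Proof.
move=> /andP[t0]; rewrite le_eqVlt => /predU1P[->|t1].
  exists 0%N, 0; split; rewrite ?lexx ?ltr01 ?ltxx //.
  by rewrite lattice_curve1 /dart_pt mul0r addr0.
have t01 : 0 <= t < 1 by rewrite t0.
have [i [s [ik s01 E]]] := orbit_param t01; exists i, s; split => //.
by rewrite E lattice_curveE //; case/andP: s01 => ? /ltW ?; apply/andP.
Qed.

Local Notation gam := lattice_curve.

Let dDi i : dart (dart_iter D0 i) := dart_iter_dart i dD0.

Lemma lattice_curve_inj : {in `[0, 1[ &, injective gam}.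
Proof.
have half s : 0 <= s < 1 -> 0 <= s <= 1 :> bool by move=> /andP[-> /ltW].
move=> t t'; rewrite !in_itv /= => t01 t01'.
have [i [s [ik s01 ->]]] := orbit_param t01; have [j [s' [jk s01' ->]]] := orbit_param t01'.
rewrite !lattice_curveE ?half // => /(dart_pt_inj (dDi i) (dDi j) s01 s01')[Eij ->].
by rewrite (Dinj ik jk Eij).
Qed.

(** Each point of the polygon lies in the star of a white vertex and in the star of a close one. A
    point that misses one of the two kinds is therefore off the polygon. *)
Lemma lattice_curve_avoid t z : 0 <= t <= 1 ->
  (forall v, nd v z < 1 -> ~ close_vertex v) \/ (forall v, nd v z < 1 -> ~ white v) -> gam t != z.
Proof.
move=> /lattice_curve_pt[i [s [ik s01 -> _]]] H; apply/eqP => /esym E.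
have [v vw vz] := dart_pt_white (dDi i) s01 E.
have [b [bc _ bz]] := dart_pt_black (dDi i) s01 E.
by case: H => H; [exact: (H b) | exact: (H v)].
Qed.

Lemma lattice_curve_avoids t p : 0 <= t <= 1 -> K p -> gam t != p.
Proof.
move=> t01 Kp; apply: lattice_curve_avoid => //; right => v /nd_lt1[v1 v2] /white_not_close; apply.
by exists p => //; split; exact: ltW.
Qed.

Lemma lattice_curve_near t : 0 <= t <= 1 -> exists2 p, K p & normc (gam t - p) <= 4.
Proof.
move=> /lattice_curve_pt[i [s [ik s01 E _]]].
have [b [[p Kp [p1 p2]] _ /nd_lt1[b1 b2]]] := dart_pt_black (dDi i) s01 E.
exists p => //; apply: le_trans (normc_le_ReIm _) _; rewrite ReB ImB.
have := ler_normD (Re (gam t) - b.1%:~R) (b.1%:~R - Re p).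
have := ler_normD (Im (gam t) - b.2%:~R) (b.2%:~R - Im p).
by rewrite !addrA !subrK ![`|_%:~R - _|]distrC; lra.
Qed.

Lemma lattice_curve_closed : gam 0 = gam 1.
Proof. by rewrite lattice_curve0 lattice_curve1. Qed.

Lemma segment_winding (a b : C) x :
  (forall s t, 0 <= s <= 1 -> 0 <= t <= 1 -> gam t != a + s%:C * (b - a)) ->
  winding (fun t => gam t - a) x -> winding (fun t => gam t - b) x.
Proof.
move=> H wa; refine (@winding_connected R gam _ a b x _ lattice_curve_closed (@segment_conn R a b) _ _ _ wa).
- exact: lattice_curve_continuous.
- by move=> _ [s s01 <-] t t01; apply: H => //; move: s01; rewrite /= in_itv.
- by exists 0; [rewrite /= in_itv /= lexx ler01 | rewrite mul0r addr0].
- by exists 1; [rewrite /= in_itv /= lexx ler01 | rewrite mul1r addrC subrK].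
Qed.

(** An edge between two vertices that are not close does not meet the polygon, so the value 0 is
    carried from the far vertices along the path that makes [v] white. *)
Lemma winding_white v : white v -> winding (fun t => gam t - emb R v) 0.
Proof.
elim=> [{}v /far_gt fv | {}v u wv IH du nc].
  apply: winding_far; [exact: lattice_curve_continuous | exact: lattice_curve_closed |].
  move=> t /lattice_curve_near[p /Kbounded pr gp].
  have := normcD (gam t - p) p; rewrite subrK.
  have := Re_le_normc (emb R v); have := Im_le_normc (emb R v); have := rho_lt_N.
  by move: fv; rewrite lt_max /= => /orP[] ? ? ? ? ?; lra.
apply: segment_winding IH => s t /andP[s0 s1] t01.
rewrite (_ : _ + _ = bary v u s 0); last first.
  by rewrite /bary mul0r addr0 embD addrAC subrr add0r.
apply: lattice_curve_avoid => //; left => v' nv'.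
have nc' : nd (v + rot u) (bary v u s 0) = 1 by rewrite nd_c ?subr0 ?addr0.
have [->|->|vE] : [\/ v' = v, v' = v + u | v' = v + rot u].
  by apply: (nd_support du s0 (lexx _) _ nv'); rewrite addr0.
- exact: white_not_close.
- by [].
- by move: nv'; rewrite vE nc' ltxx.
Qed.

Lemma orbit_last : dart_iter D0 k.-1 = prev_dart D0.
Proof. by rewrite -(next_dartK (dDi k.-1)) -[next_dart _]/(dart_iter D0 k.-1.+1) prednK // Dk. Qed.

Local Notation w0 := (D0.1).
Local Notation u0 := (D0.2).

(** Together with [lattice_curve_end]: just after time 0 and just before time 1 the polygon is on
    opposite sides of the edge of [D0], as the sign of the last coordinate shows. *)
Lemma lattice_curve_start s : 0 <= s <= 1 -> exists x, gam (s / k%:R) = bary w0 u0 x (s / 2).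
Proof.
move=> s01; have := lattice_curveE k0 s01; rewrite add0r => ->.
by have [[x y] /= [-> _ ->]] := dart_ptE D0 s; exists x.
Qed.

Lemma lattice_curve_end s : 0 <= s <= 1 -> exists x, gam (1 - s / k%:R) = bary w0 u0 x (- (s / 2)).
Proof.
move=> s01; have k1 : (k.-1 < k)%N by rewrite prednK.
have s01' : 0 <= 1 - s <= 1 by case/andP: s01 => ? ?; apply/andP; split; lra.
have := lattice_curveE k1 s01'.
have kn : k%:R != 0 :> R by rewrite pnatr_eq0 -lt0n.
rewrite addrA natr1 prednK // mulrBl divff // => ->.
rewrite /dart_pt; have -> : next_dart (dart_iter D0 k.-1) = D0.
  by rewrite -[LHS]/(dart_iter D0 k.-1.+1) prednK.
rewrite orbit_last /prev_dart; case: asboolP => _.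
  exists ((1 - s) / 2 + s); rewrite /dart_mid /bary /= !embD !embN !emb_rot.
  by case: (D0) => w u; apply: eqC => /=; field.
exists (2^-1); rewrite /dart_mid /bary /= !embD !embN !emb_rot.
by case: (D0) => w u; apply: eqC => /=; field.
Qed.

(** Only the dart [D0] crosses its own edge, and the orbit visits it once per period. *)
Lemma lattice_curve_cross t x : 0 <= t < 1 -> 0 < x <= 1 -> gam t = bary w0 u0 x 0 -> t = 0.
Proof.
move=> /andP[t0 t1] /andP[x0 x1] E.
have t01 : 0 <= t <= 1 by rewrite t0 ltW.
have [du ww nb] := dD0.
have [i [s [ik s01 Et t_E]]] := lattice_curve_pt t01; have tE := t_E t1.
have [sw sb sc _] := dart_pt_support (dDi i) s01; rewrite -Et E in sw sb sc.
have nc : nd (w0 + rot u0) (bary w0 u0 x 0) = 1 by rewrite nd_c ?subr0 ?addr0 // ltW.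
have supp v : nd v (bary w0 u0 x 0) < 1 -> v = w0 \/ v = w0 + u0.
  move=> nv; have [->|->|vE] : [\/ v = w0, v = w0 + u0 | v = w0 + rot u0].
  - by apply: (nd_support du (ltW x0) (lexx _) _ nv); rewrite addr0.
  - by left.
  - by right.
  by move: nv; rewrite vE nc ltxx.
have [di wi nbi] := dDi i.
have e1 : (dart_iter D0 i).1 = w0 by case: (supp _ sw) => // e; case: nb; rewrite -e.
have e2 : (dart_iter D0 i).2 = u0.
  by case: (supp _ sb) => [e|]; [case: nbi; rewrite e | rewrite e1 => /addrI].
have eD : dart_iter D0 i = D0 by move: e1 e2; case: (dart_iter D0 i) => [? ?] /= -> ->; case: (D0).
have i0 : i = 0%N by apply: Dinj.
move: sc; rewrite e1 e2 nc tE i0 add0r => sc.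
by rewrite (_ : s = 0) ?mul0r //; lra.
Qed.

(** With [w] the white and [b] the black end, [h = - (gam - b) / (gam - w)] is positive exactly on
    the open edge, which the polygon crosses once, at its start, from one side to the other. By
    [winding_full_turn] the windings around the two ends differ by one turn, and around [w] it is
    0. *)
Lemma winding_black : winding (fun t => gam t - emb R (w0 + u0)) (- (pi *+ 2)).
Proof.
have [du ww nb] := dD0; have ww0 := winding_white ww.
have avw t : 0 <= t <= 1 -> gam t != emb R w0.
  move=> t01; apply: lattice_curve_avoid => //; left => v nv.
  have E : emb R w0 = bary w0 u0 0 0 by rewrite /bary !mul0r !addr0.
  have [->|vE|vE] : [\/ v = w0, v = w0 + u0 | v = w0 + rot u0].
    by move: nv; rewrite E; apply: nd_support; rewrite ?addr0.
  - exact: white_not_close.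
  - by move: nv; rewrite E vE nd_b ?addr0 ?subr0 ?ltxx.
  - by move: nv; rewrite E vE nd_c ?addr0 ?subr0 ?ltxx.
have avb t : 0 <= t <= 1 -> gam t != emb R (w0 + u0).
  move=> t01; apply: lattice_curve_avoid => //; right => v nv.
  have E : emb R (w0 + u0) = bary w0 u0 1 0 by rewrite /bary mul1r mul0r !addr0 embD.
  have [vE|->//|vE] : [\/ v = w0, v = w0 + u0 | v = w0 + rot u0].
    by move: nv; rewrite E; apply: nd_support; rewrite ?addr0.
  - by move: nv; rewrite E vE nd_w ?addr0 ?ltxx.
  - by move: nv; rewrite E vE nd_c ?addr0 ?subr0 ?ltxx.
have [x wx] : exists x, winding (fun t => gam t - emb R (w0 + u0)) x.
  apply: winding_ex => [t|t t01]; last by rewrite subr_eq0 avb.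
  by apply: ccontB; [exact: lattice_curve_continuous | exact: ccont_cst].
pose h t := - ((gam t - emb R (w0 + u0)) / (gam t - emb R w0)).
have N1 : -1 != 0 :> C by rewrite oppr_eq0 oner_neq0.
have wh : winding h x.
  have := windingM (winding_cst N1) (windingM wx (windingV ww0)).
  by rewrite oppr0 addr0 add0r; apply: eq_winding => t _; rewrite mulN1r.
suff <- : x = - (pi *+ 2) by [].
have kp : 0 < k%:R :> R by rewrite ltr0n.
have h_start : h 0 = 1.
  have /lattice_curve_start[y] : 0 <= (0 : R) <= 1 by rewrite lexx ler01.
  rewrite /h lattice_curve0 /mids /= /dart_mid embD => _.
  have un : emb R u0 != 0.
    apply/eqP => -[/eqP]; rewrite intr_eq0 => /eqP a0 /eqP; rewrite intr_eq0 => /eqP b0.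
    by case: (isdir_neq0 du); case: (u0) a0 b0 => ? ? /= -> ->.
  have -> : emb R w0 + (2^-1)%:C * emb R u0 - emb R w0 = (2^-1)%:C * emb R u0 by ring.
  have -> : emb R w0 + (2^-1)%:C * emb R u0 - (emb R w0 + emb R u0) = - ((2^-1)%:C * emb R u0).
    by apply: eqC => /=; field.
  by rewrite mulNr opprK divff // mulf_neq0 // -normc_gt0 normcR normr_gt0; lra.
apply: (winding_full_turn wh) => //.
- move=> t t01; rewrite oppr_eq0 mulf_neq0 ?invr_eq0 ?subr_eq0 ?avb ?avw //.
- by rewrite /h lattice_curve1 -lattice_curve0.
- move=> t /andP[t0 t1]; have t01 : 0 <= t <= 1 by rewrite !ltW.
  have [a [b E]] := bary_ex w0 (gam t) du; have := avw t t01; rewrite /h E => nw.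
  have [q q0 ->] := bary_turn_Im du nw => /eqP; rewrite oppr_eq0 mulf_eq0 (gt_eqF q0) orbF => /eqP b0.
  have := nw; rewrite b0 /bary mul0r addr0 embD => nw'.
  have [a0 u_0] : a != 0 /\ emb R u0 != 0.
    by split; apply/eqP => e; case/eqP: nw'; rewrite e ?mul0r ?mulr0 addr0.
  have -> : - ((emb R w0 + a%:C * emb R u0 - (emb R w0 + emb R u0)) /
     (emb R w0 + a%:C * emb R u0 - emb R w0)) = (a^-1 - 1)%:C.
    have aC : a%:C != 0 by rewrite -normc_gt0 normcR normr_gt0.
    have -> : emb R w0 + a%:C * emb R u0 - (emb R w0 + emb R u0) = (a%:C - 1) * emb R u0 by ring.
    have -> : emb R w0 + a%:C * emb R u0 - emb R w0 = a%:C * emb R u0 by ring.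
    by rewrite -mulf_div divff // mulr1 mulrBl divff // mul1r opprB rmorphB fmorphV.
  rewrite [Re _]/= subr_lt0; have [an|ap] := ltP a 0; first by rewrite (lt_trans _ ltr01) // invr_lt0.
  have ap' : 0 < a by rewrite lt_def a0.
  rewrite invf_lt1 // ltNge; apply/negP => a1.
  have := t0; rewrite (@lattice_curve_cross t a) ?ltxx ?t1 ?(ltW t0) ?ap' ?E ?b0 //.
exists (k%:R^-1); first by rewrite invr_gt0.
move=> t /andP[t0 te] t1.
have tk : t = (t * k%:R) / k%:R by rewrite mulfK // gt_eqF.
have s01 : 0 <= t * k%:R <= 1.
  apply/andP; split; first by rewrite mulr_ge0 // ltW.
  by rewrite -ler_pdivlMr // mul1r ltW.
have sp : 0 < t * k%:R by rewrite mulr_gt0.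
split.
  have [y E] := lattice_curve_start s01; rewrite -tk in E.
  have := avw t; rewrite /h E => /(_ _) nw; have [|q q0 ->] := bary_turn_Im du (nw _).
    by rewrite !ltW.
  by rewrite oppr_lt0 mulr_gt0 // divr_gt0.
have [y E] := lattice_curve_end s01; rewrite -tk in E.
have := avw (1 - t); rewrite /h E => /(_ _) nw; have [|q q0 ->] := bary_turn_Im du (nw _).
  by apply/andP; split; lra.
by rewrite mulNr opprK mulr_gt0 // divr_gt0.
Qed.

(** Applied to each coordinate: on the way from a close vertex to its point of [K], every vertex
    that comes within distance 1 is close on account of the same point. *)
Lemma int_between (a b : int) (p s : R) : `|p - b%:~R| <= 1 -> 0 <= s <= 1 ->
  `|b%:~R + s * (p - b%:~R) - a%:~R| < 1 -> `|p - a%:~R| <= 1.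
Proof.
have ltz (m n : int) : (m%:~R < n%:~R :> R) -> m < n by rewrite ltr_int.
move=> pb /andP[s0 s1] sa.
wlog pb0 : p a b pb sa / 0 <= p - b%:~R.
  move=> H; have [/H|pb0] := leP 0 (p - b%:~R); first exact.
  have := H (- p) (- a) (- b); rewrite !mulrNz -!opprD !normrN mulrN -!opprD !normrN.
  by apply => //; lra.
move: pb sa; rewrite ler_norml ltr_norml => /andP[p1 p2] /andP[q1 q2].
have sp : 0 <= s * (p - b%:~R) by rewrite mulr_ge0.
have sp' : s * (p - b%:~R) <= p - b%:~R by rewrite ler_piMl.
have h1 : -1 < a - b by apply: ltz; rewrite intrB; lra.
have h2 : a - b < 2 by apply: ltz; rewrite intrB; lra.
have -> : a%:~R = b%:~R + (a - b)%:~R :> R by rewrite intrB; ring.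
by case: (int01 h1 h2) => ->; rewrite ler_norml; apply/andP; split; lra.
Qed.

(** The polygon is met neither between the black end of [D0] and a point of [K] close to it, nor
    within the connected set [K]. *)
Lemma winding_lattice_curve p : connected K -> K p -> winding (fun t => gam t - p) (- (pi *+ 2)).
Proof.
move=> cK Kp; have [q Kq [q1 q2]] := dart_close dD0.
have wq : winding (fun t => gam t - q) (- (pi *+ 2)).
  apply: segment_winding winding_black => s t s01 t01.
  apply: lattice_curve_avoid => //; right => v /nd_lt1[v1 v2] /white_not_close; apply.
  exists q => //; split; [apply: (int_between q1 s01) | apply: (int_between q2 s01)].
    by move: v1; rewrite ReD Re_scale ReB.
  by move: v2; rewrite ImD Im_scale ImB.
refine (@winding_connected R gam K q p _ _ lattice_curve_closed cK _ Kq Kp wq).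
  exact: lattice_curve_continuous.
by move=> c Kc t t01; exact: lattice_curve_avoids.
Qed.

End Orbit.

Lemma lattice_polygon : connected K -> K !=set0 -> exists g : R -> C,
  [/\ forall t, ccont g t, g 0 = g 1, {in `[0, 1[ &, injective g},
      forall t, 0 <= t <= 1 -> ~ K (g t) /\ exists2 p, K p & normc (g t - p) <= 4 &
      forall p, K p -> winding (fun t => g t - p) (- (pi *+ 2))].
Proof.
move=> cK /dart_ex[D0 dD0]; have [k [k0 Dk Dinj]] := dart_period dD0.
exists (lattice_curve D0 k); split.
- by move=> t; exact: lattice_curve_continuous.
- exact: lattice_curve_closed.
- exact: lattice_curve_inj.
- move=> t t01; split; last exact: lattice_curve_near.
  by move=> /(lattice_curve_avoids dD0 k0 Dk t01)/eqP.
- by move=> p; exact: winding_lattice_curve.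
Qed.

End LatticeCurve.

Lemma jordan_polygon (R : realType) (K : set R[i]) (d : R) : 0 < d ->
  connected K -> K !=set0 -> (exists M : R, forall z, K z -> normc z <= M) ->
  exists g : R -> R[i],
    [/\ forall t, ccont g t, g 0 = g 1, {in `[0, 1[ &, injective g},
      forall t, 0 <= t <= 1 -> ~ K (g t) /\ exists2 p, K p & normc (g t - p) <= d &
      forall p, K p -> winding (fun t => g t - p) (- (pi *+ 2))].
Proof.
(* The unit lattice polygon stays within 4 of its set, so the mesh is [d / 4]. *)
move=> d0 cK [p0 Kp0] [M KM]; pose e := d / 4; have e0 : 0 < e by rewrite divr_gt0.
have eC0 : e%:C != 0 :> R[i] by rewrite -normc_gt0 normcR normr_gt0 gt_eqF.
pose K' : set R[i] := [set z / e%:C | z in K].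
have K'P z : K' (z / e%:C) <-> K z.
  by split=> [[w Kw /(mulIf (invr_neq0 eC0)) <-//]|Kz]; exists z.
have cK' : connected K'.
  apply: connected_continuous_connected cK _; apply: continuous_subspaceT => z.
  by have [] := ccontM (ccont_id z) (ccont_cst z (e%:C)^-1).
pose rho := M / e.
have K'b z : K' z -> normc z <= rho.
  move=> [w /KM wM <-]; rewrite normc_div normcR (ger0_norm (ltW e0)).
  by rewrite ler_pM2r // invr_gt0.
have [N NP] : exists N : nat, rho + 4 < N%:R.
  by exists (Num.truncn (rho + 4)).+1; exact: truncnS_gt.
have [|g [gc g01 ginj gK gw]] := lattice_polygon K'b NP cK'; first by exists (p0 / e%:C), p0.
exists (fun t => g t * e%:C); split.
- by move=> t; apply: ccontM (gc t) _; exact: ccont_cst.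
- by rewrite g01.
- by move=> t t' t1 t2 /(mulIf eC0); exact: ginj.
- move=> t t01; have [nK [p [q Kq <-] gp]] := gK t t01; split.
    by move=> /K'P; rewrite mulfK.
  exists q => //; have -> : g t * e%:C - q = (g t - q / e%:C) * e%:C by rewrite mulrBl divfK.
  rewrite normcM normcR (ger0_norm (ltW e0)).
  by have : normc (g t - q / e%:C) * e <= 4 * e by [rewrite ler_pM2r]; rewrite /e; lra.
- move=> p /K'P /gw wp; have := windingM wp (winding_cst eC0).
  by rewrite addr0; apply: eq_winding => t _; rewrite mulrBl divfK.
Qed.

(** * Separating a component *)

Section ClosedCurves.
Variable R : realType.
Local Notation C := R[i].

Lemma bounded_setP (A : set C) :
  bounded_set A <-> exists M : R, forall z, A z -> normc z <= M.
Proof.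
split=> [[M [Mr H]]|[M H]].
  exists (Re M + 1) => z Az; have ltM : M < M + 1 by rewrite ltrDl ltr01.
  have leRe (x y : C) : x <= y -> Re x <= Re y by rewrite lecE => /andP[].
  by have := leRe _ _ (H _ ltM z Az); rewrite ReD.
exists M%:C; split; first by rewrite complex_real.
move=> x Mx z Az; apply: le_trans (ltW Mx).
by rewrite -[`|z|]/((normc z)%:C) lecR H.
Qed.

Lemma ray_connected (b : C) : connected [set t%:C * b | t in (`[1, +oo[%classic : set R)].
Proof.
apply: connected_continuous_connected; first exact/connected_intervalP/interval_is_interval.
apply: continuous_subspaceT => t.
by have [] := ccontM (ccont_real_complex t) (ccont_cst t b).
Qed.

Lemma unbounded_component (G A : set C) (z b : C) (r : R) : 0 <= r ->
  (forall w, G w -> normc w <= r) -> connected A -> A z -> A b -> A `<=` ~` G ->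
  r < normc b -> ~ bounded_set (connected_component (~` G) z).
Proof.
move=> r0 Gr cA Az Ab AG rb /bounded_setP[M HM].
have b0 : 0 < normc b by exact: le_lt_trans rb.
pose B := [set t%:C * b | t in (`[1, +oo[%classic : set R)].
have Bb : B b by exists 1; rewrite ?mul1r //= in_itv /= lexx.
have cAB : connected (A `|` B).
  by apply: connectedU; [exists b | exact: cA | exact: ray_connected].
have ABG : A `|` B `<=` ~` G.
  move=> w [/AG //|[t]]; rewrite /= in_itv andbT => /= t1 <- /Gr; apply/negP.
  rewrite -ltNge normcM normcR ger0_norm; last lra.
  by apply: lt_le_trans rb _; rewrite ler_peMl ?normc_ge0.
pose t := `|M| / normc b + 1.
have Mb : 0 <= `|M| / normc b by rewrite divr_ge0 ?normc_ge0.
have Bt : (A `|` B) (t%:C * b).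
  by right; exists t => //; rewrite /= in_itv /= andbT /t; lra.
have := HM _ (@connected_component_max _ (~` G) (A `|` B) z (or_introl Az) ABG cAB _ Bt).
rewrite normcM normcR ger0_norm; last by rewrite /t; lra.
by rewrite /t mulrDl divfK ?gt_eqF //; have := ler_norm M; lra.
Qed.

Lemma winding_outside (g : R -> C) (p : C) : (forall t, ccont g t) -> g 0 = g 1 ->
  ~ (g @` `[0, 1]) p -> ~ bounded_set (connected_component (~` (g @` `[0, 1])) p) ->
  winding (fun t => g t - p) 0.
Proof.
move=> gc g01 gp ub.
have [r Hr] : exists r : R, forall z, (g @` `[0, 1]) z -> normc z <= r.
  apply: compact_bounded_normc; apply: continuous_compact; last exact: segment_compact.
  by apply: continuous_subspaceT => t; have [] := gc t.
have [b [bp rb]] : exists b, connected_component (~` (g @` `[0, 1])) p b /\ r < normc b.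
  apply: contrapT => H; apply/ub/bounded_setP; exists r => z zp; rewrite leNgt; apply/negP => rz.
  by apply: H; exists z.
have in01 t : 0 <= t <= 1 -> (g @` `[0, 1]) (g t) by move=> t01; exists t => //; rewrite /= in_itv.
apply: (@winding_connected R g _ b p 0 gc g01
   (@component_connected _ (~` (g @` `[0, 1])) p) _ bp).
- move=> c cp t t01; apply/eqP => e; apply: (connected_component_sub cp).
  by rewrite -e; exact: in01.
- exact: connected_component_refl.
- by apply: winding_far => // t t01; apply: le_lt_trans rb; exact/Hr/in01.
Qed.

Lemma winding_inside (g : R -> C) (p : C) x : (forall t, ccont g t) -> g 0 = g 1 ->
  ~ (g @` `[0, 1]) p -> winding (fun t => g t - p) x -> x != 0 ->
  jordan_interior (g @` `[0, 1]) p.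
Proof.
move=> gc g01 gp wx x0; split => //; apply: contrapT => ub.
have w0 := winding_outside gc g01 gp ub.
move/eqP: x0; apply; apply: winding_uniq wx w0 => t t01; rewrite subr_eq0.
by apply/eqP => e; apply: gp; exists t => //; rewrite /= in_itv.
Qed.

Lemma compact_closed_dist (A B : set C) : compact A -> closed B -> A `&` B = set0 ->
  exists2 d : R, 0 < d & forall x y, A x -> B y -> d <= normc (x - y).
Proof.
move=> /compact_near_coveringP cA cB AB.
have H : \forall d \near (0 : R)^'+, A `<=` (fun x => forall y, B y -> d <= normc (x - y)).
  apply: (cA R (0 : R)^'+ (fun d x => forall y, B y -> d <= normc (x - y)) _) => x Ax.
  have nB : (~` B) x by move=> Bx; have : (A `&` B) x by []; rewrite AB.
  have [r r0 Hr] := open_nearc (closed_openC cB) nB.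
  have r2 : 0 < r / 2 by rewrite divr_gt0.
  exists ([set x' | normc (x' - x) < r / 2], [set d | d < r / 2]).
    by split; [apply/nbhs_normc; exists (r / 2) | exact: nbhs_right_lt].
  move=> [x' d] /= [x'x dr] y By; rewrite leNgt; apply/negP => yd; apply: (Hr y) By.
  by have := normc_triangle x' y x; rewrite [normc (y - x')]normc_distC; lra.
have [d [Hd d0]] := filter_ex (filterI H (nbhs_right_gt (0 : R))).
by exists d => // x y Ax By; exact: Hd.
Qed.

(** * A polygon around one component that leaves the others outside *)

Section Separation.
Variables (E : set C) (l : nat) (E_ : 'I_l -> set C) (r : R).
Hypothesis Eclosed : closed E.
Hypothesis r_ge0 : 0 <= r.
Hypothesis Er : forall z, E z -> normc z <= r.
Hypothesis E_compact : forall j, compact (E_ j).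
Hypothesis E_connected : forall j, connected (E_ j).
Hypothesis E_n0 : forall j, E_ j !=set0.
Hypothesis E_cover : forall z, E z <-> exists j, E_ j z.
Hypothesis E_disj : forall j k z, E_ j z -> E_ k z -> j = k.
Hypothesis E_clopen : forall D : set C, open D -> D `<=` ~` E ->
  (forall z, ~ E z -> closure D z -> D z) -> (exists M : R, forall z, D z -> normc z <= M) ->
  forall z, ~ D z.

(** A compact connected set stands in for a path from [z] to the far region. By compactness it keeps
    a positive distance from [E_ j], and the polygon can be drawn closer than that. *)
Definition escape j z := exists A, [/\ compact A, connected A, A z, A `<=` ~` E_ j &
  exists2 b, A b & r + 1 < normc b].

Lemma E_closed j : closed (E_ j).
Proof. exact: compact_closed (@C_hausdorff R) (@E_compact j). Qed.

Lemma segment_compactC (a b : C) : compact ((fun t : R => a + t%:C * (b - a)) @` `[0, 1]%classic).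
Proof.
apply: continuous_compact; last exact: segment_compact.
apply: continuous_subspaceT => t.
by have [] := ccontD (ccont_cst t a) (ccontM (ccont_real_complex t) (ccont_cst t (b - a))).
Qed.

Lemma escape_near j z : ~ E_ j z -> nearc z (fun w => escape j w <-> escape j z).
Proof.
move=> Ez; have [d d0 Hd] := open_nearc (closed_openC (@E_closed j)) Ez.
have step z1 z2 : normc (z1 - z) < d -> normc (z2 - z) < d -> escape j z1 -> escape j z2.
  move=> h1 h2 [A [cA cnA Az Aj [b Ab rb]]].
  pose S := (fun t : R => z1 + t%:C * (z2 - z1)) @` `[0, 1]%classic.
  have S1 : S z1 by exists 0; [rewrite /= in_itv /= lexx ler01 | rewrite mul0r addr0].
  have S2 : S z2 by exists 1; [rewrite /= in_itv /= lexx ler01 | rewrite mul1r addrC subrK].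
  exists (A `|` S); split.
  - by apply: compactU => //; exact: segment_compactC.
  - by apply: connectedU => //; [exists z1 | exact: segment_conn].
  - by right.
  - move=> w [/Aj//|[t]]; rewrite /= in_itv /= => /andP[t0 t1] <-; apply: Hd.
    rewrite (_ : _ - z = (1 - t)%:C * (z1 - z) + t%:C * (z2 - z)); last first.
      by rewrite rmorphB rmorph1; ring.
    apply: le_lt_trans (normcD _ _) _; rewrite !normcM !normcR !ger0_norm ?subr_ge0 //.
    have t0' : 0 <= 1 - t by lra.
    have [t2|t2] := leP t (1 / 2).
      have : t * normc (z2 - z) <= t * d by rewrite ler_wpM2l // ltW.
      by have : (1 - t) * normc (z1 - z) < (1 - t) * d by [rewrite ltr_pM2l //; lra]; lra.
    have : (1 - t) * normc (z1 - z) <= (1 - t) * d by rewrite ler_wpM2l // ltW.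
    by have : t * normc (z2 - z) < t * d by [rewrite ltr_pM2l //; lra]; lra.
  by exists b => //; left.
have zz : normc (z - z) < d by rewrite subrr normc0.
by exists d => // w wz; split; exact: step.
Qed.

(** The points that cannot escape form a bounded open set [W], relatively closed off [E_ j]. Its
    part off [E] is empty by [E_clopen], so [W] lies in the other components; their union is closed
    and disjoint from [E_ j], hence [W] is clopen in the plane, and being bounded it is empty. *)
Lemma escape_all j z : ~ E_ j z -> escape j z.
Proof.
move=> Ez; apply: contrapT => nz.
pose W := [set w | ~ E_ j w /\ ~ escape j w].
have oW : open W.
  apply: open_nearcP => w [Ew nw].
  have := open_nearc (closed_openC (@E_closed j)) Ew.
  by apply: nearcS2 (escape_near Ew) => w' ew' Ew'; split => // /ew'.
have Wr w : W w -> normc w <= r + 1.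
  move=> [Ew nw]; rewrite leNgt; apply/negP => rw; apply: nw.
  exists [set w]; split => //; last by exists w.
  - exact: compact_set1.
  - exact: connected1.
  - by move=> _ ->.
have Wcl w : ~ E_ j w -> closure W w -> W w.
  move=> Ew cw; split => // ew.
  have [w' [[_ nw'] H]] := cw _ (iffLR (nearcP _ _) (escape_near Ew)).
  by apply: nw'; apply/H.
pose D := W `&` ~` E.
have D0 w : ~ D w.
  apply: E_clopen.
  - by apply: openI => //; exact: closed_openC.
  - by move=> ? [].
  - move=> w' Ew' cw'; split => //; apply: Wcl.
      by move=> Ej; apply: Ew'; apply/E_cover; exists j.
    by apply: closureS cw' => ? [].
  by exists (r + 1) => w' [/Wr].
have WE w : W w -> exists2 k, k != j & E_ k w.
  move=> Ww; have /E_cover[k Ek] : E w by apply: contrapT => Ew; exact: (D0 w).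
  by exists k => //; apply/eqP => kj; case: Ww => + _; rewrite -kj.
have cW : closed W.
  move=> w cw; apply: Wcl => // Ej.
  pose B := \big[setU/set0]_(k < l | k != j) E_ k.
  have cB : closed B.
    apply: compact_closed; first exact: C_hausdorff.
    by apply: bigsetU_compact => k _; exact: E_compact.
  have BP w' : B w' <-> exists2 k, k != j & E_ k w'.
    rewrite /B -bigcup_seq_cond; split=> [[k /= /andP[_ kj] Ek]|[k kj Ek]]; first by exists k.
    by exists k => //=; rewrite mem_index_enum.
  have /BP[k kj Ek] : B w by apply: cB; apply: closureS cw => w' /WE/BP.
  by move/eqP: kj; apply; exact: E_disj Ek Ej.
have WT : W = setT by apply: clopenC => //; exists z.
have := Wr ((r + 2)%:C); rewrite WT normcR ger0_norm ?addr_ge0 // => /(_ I).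
by apply/negP; rewrite -ltNge ltrD2l ltr1n.
Qed.

(** The polygon is drawn closer to [E_ j] than every other component and the escape set of one of
    its points. These sets then join each other component to infinity off the polygon. *)
Lemma separating_curve j : exists g : R -> C,
  [/\ forall t, ccont g t, g 0 = g 1, jordan_curve (g @` `[0, 1]),
      g @` `[0, 1] `<=` ~` E & surrounds_only (g @` `[0, 1]) E_ j] /\
  (forall p, E_ j p -> winding (fun t => g t - p) (- (pi *+ 2))) /\
  (forall k p, k != j -> E_ k p -> winding (fun t => g t - p) 0).
Proof.
have [z zE] := choice E_n0.
have H k : exists A, k != j ->
    [/\ compact A, connected A, A (z k), A `<=` ~` E_ j & exists2 b, A b & r + 1 < normc b].
  have [->|kj] := eqVneq k j; first by exists set0.
  have /escape_all[A HA] : ~ E_ j (z k) by move/eqP: kj => kj Ej; apply: kj; exact: E_disj (zE k) Ej.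
  by exists A.
have [A HA] := choice H.
pose B k := A k `|` E_ k.
have Hd k : exists d : R, 0 < d /\ (k != j -> forall x y, B k x -> E_ j y -> d <= normc (x - y)).
  have [->|kj] := eqVneq k j; first by exists 1.
  have [cA _ _ Aj _] := HA k kj.
  have [|||d d0 Pd] := @compact_closed_dist (B k) (E_ j).
  - exact: compactU.
  - exact: E_closed.
  - apply/seteqP; split => // w [[/Aj//|Ek] Ej].
    by move/eqP: kj; apply; exact: E_disj Ek Ej.
  by exists d.
have [d dP] := choice Hd.
(* The default 1 of the minimum also keeps the polygon inside the disc of radius [r + 1], which the
   escape sets leave. *)
pose e := \big[Num.min/1]_(k < l | k != j) d k.
have e0 : 0 < e by apply: lt_bigmin => [|k _]; [exact: ltr01 | case: (dP k)].
have e1 : e <= 1 by exact: bigmin_le_id.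
have ed k : k != j -> e <= d k by move=> kj; exact: bigmin_le_cond.
have e2 : 0 < e / 2 by rewrite divr_gt0.
have Ejr p : E_ j p -> normc p <= r by move=> Ep; apply/Er/E_cover; exists j.
have [g [gc g01 ginj gK gw]] := jordan_polygon e2 (@E_connected j) (@E_n0 j) (ex_intro _ r Ejr).
pose G := g @` `[0, 1].
have GP w : G w -> ~ E_ j w /\ exists2 p, E_ j p & normc (w - p) <= e / 2.
  by move=> [t]; rewrite /= in_itv => /= t01 <-; exact: gK.
have GB k w : k != j -> B k w -> ~ G w.
  move=> kj Bw /GP[_ [p Ep wp]]; have [_ /(_ kj w p Bw Ep)] := dP k.
  by have := ed k kj; lra.
have GE : G `<=` ~` E.
  move=> w Gw /E_cover[k Ek]; have [kj|kj] := eqVneq k j.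
    by case: (GP w Gw) => + _; rewrite -kj.
  by apply: (GB k w kj) Gw; right.
have Gr w : G w -> normc w <= r + 1.
  move=> /GP[_ [p /Ejr pr wp]]; have := normcD (w - p) p; rewrite subrK; lra.
have out k : k != j -> ~ bounded_set (connected_component (~` G) (z k)).
  move=> kj; have [cA cnA Az Aj [b Ab rb]] := HA k kj.
  apply: (@unbounded_component G (A k) (z k) b (r + 1)) => //; first by rewrite addr_ge0.
  by move=> w Aw; apply: GB kj _; left.
have EG k w : E_ k w -> ~ G w by move=> Ek /GE; apply; apply/E_cover; exists k.
exists g; split; split => //.
- by exists g; split => //; apply: continuous_subspaceT => t; have [] := gc t.
- move=> k; split => [sub|-> p Ep]; last first.
    apply: (winding_inside gc g01 (EG j p Ep) (gw p Ep)).
    by rewrite oppr_eq0 mulrn_eq0 /= gt_eqF // pi_gt0.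
  apply/eqP/contraT => kj; have [_ bd] := sub _ (zE k).
  by case: (out k kj).
move=> k p kj Ep; have wz := winding_outside gc g01 (EG k _ (zE k)) (out k kj).
apply: (@winding_connected R g (E_ k) (z k) p 0 gc g01 (@E_connected k)) => //.
move=> c Ec t t01; apply/eqP => e'; apply: (EG k c Ec).
by exists t => //; rewrite /= in_itv.
Qed.

End Separation.

End ClosedCurves.

(** * The exponents and the polynomial Q *)

Section ZeroCounting.
Variable R : realType.
Local Notation C := R[i].

Lemma count_zerosE (p : {poly C}) (A : set C) (c : C) (rs : seq C) : c != 0 ->
  p = c *: \prod_(x <- rs) ('X - x%:P) ->
  count_zeros p A = count (fun x => x \in A) rs.
Proof.
move=> c0 pE; have mupE z : mup z p = count_mem z rs.
  rewrite pE -mul_polyC mupMr ?mu_prod_XsubC //.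
  by rewrite rootC.
rewrite /count_zeros (eq_fsbigr (fun z => count_mem z rs)) => [|z _]; last exact: mupE.
rewrite (fsbigE [seq x <- undup rs | x \in A]).
- rewrite big_filter_cond.
  rewrite (eq_bigl (fun i => i \in A)) => [|i]; last by rewrite andbb.
  rewrite -sum1_count -[RHS](big_undup_iterop_count addn).
  by apply: eq_bigr => i _; rewrite Monoid.iteropE iter_addn_0 mul1n.
- by rewrite filter_uniq // undup_uniq.
- by move=> z /=; rewrite mem_filter => /andP[+ _]; rewrite inE.
- move=> z Az; rewrite mem_filter mem_undup negb_and mem_set //= => zr.
  by apply/count_memPn.
Qed.

Lemma sum_count_partition (l : nat) (E_ : 'I_l -> set C) (rs : seq C) :
  (forall j k z, E_ j z -> E_ k z -> j = k) ->
  (forall z, z \in rs -> exists j, E_ j z) ->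
  (\sum_(j < l) count (fun x => x \in E_ j) rs)%N = size rs.
Proof.
move=> dj; elim: rs => [|x rs IH] H; first by rewrite big1.
rewrite /= big_split /= IH; last by move=> z zr; apply: H; rewrite inE zr orbT.
have [j Ej] := H x (mem_head _ _).
rewrite (bigD1 j) //= mem_set // big1 // => k kj.
by apply/eqP; rewrite eqb0; apply/negP; rewrite inE => Ek; move/eqP: kj; apply; exact: dj Ek Ej.
Qed.

Lemma asymp_comp (f g : C -> C) (al be : C) n : be != 0 -> (0 < n)%N ->
  asymp f al 1 -> asymp g be n -> asymp (fun z => f (g z)) (al * be) n.
Proof.
move=> be0 n0 Hf Hg e e0.
have nb : 0 < normc be by rewrite normc_gt0.
have k0 : 0 < normc be / 2 by rewrite divr_gt0.
have a0 : 0 < normc al + 1 by rewrite ltr_wpDl ?normc_ge0.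
pose e1 := e / 2 / (normc be + 1); have e10 : 0 < e1.
  by rewrite !divr_gt0 // ltr_wpDl ?normc_ge0.
pose e2 := e / 2 / (normc al + 1); have e20 : 0 < e2 by rewrite !divr_gt0.
have [r1 H1] := Hf _ e10; have [r2 H2] := Hg _ e20.
have [r3 H3] := asymp_lower_bound k0 Hg; have [r4 H4] := asymp_bound ltr01 Hg.
exists (Num.max (Num.max r2 r3) (Num.max r4 (Num.max 1 (Num.max 0 r1 / (normc be / 2))))) => z.
rewrite !gt_max => /andP[/andP[/H2 h2 /H3 h3]] /and3P[/H4 h4 z1 zr].
have z0 : 0 < normc z by lra.
have zn : normc z <= normc z ^+ n.
  by rewrite -(prednK n0) exprS ler_peMr ?normc_ge0 // exprn_ege1 // ltW.
have zN : 0 < normc z ^+ n by exact: exprn_gt0.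
have /H1 h1 : r1 < normc (g z).
  apply: lt_le_trans h3; apply: (@le_lt_trans _ _ (Num.max 0 r1)); first by rewrite le_max lexx orbT.
  move: zr; rewrite ltr_pdivrMr // => /lt_le_trans; apply.
  by rewrite mulrC; have -> : normc be - normc be / 2 = normc be / 2; [lra | rewrite ler_pM2l].
rewrite (_ : _ - _ = (f (g z) - al * g z ^+ 1) + al * (g z - be * z ^+ n)); last by ring.
apply: le_trans (normcD _ _) _; rewrite normcM.
have b1 : e1 * normc (g z) ^+ 1 <= e / 2 * normc z ^+ n.
  rewrite expr1; apply: (@le_trans _ _ (e1 * ((normc be + 1) * normc z ^+ n))).
    by rewrite ler_pM2l.
  by rewrite mulrA /e1 divfK // gt_eqF // ltr_wpDl ?normc_ge0.
have b2 : normc al * (e2 * normc z ^+ n) <= e / 2 * normc z ^+ n.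
  rewrite mulrA ler_pM2r // /e2 mulrCA ger_pMr ?divr_gt0 // ler_pdivrMr // mul1r.
  by rewrite lerDl.
have b3 : normc al * normc (g z - be * z ^+ n) <= normc al * (e2 * normc z ^+ n).
  by rewrite ler_wpM2l ?normc_ge0.
lra.
Qed.

Lemma polynomial_bounded_preimage (Q : {poly C}) n (B : R) : size Q = n.+2 ->
  exists M : R, forall w, normc Q.[w] <= B -> normc w <= M.
Proof.
move=> sQ; have q0 : Q`_n.+1 != 0.
  by rewrite -[n.+1]/(n.+2.-1) -sQ -/(lead_coef Q) lead_coef_eq0 -size_poly_eq0 sQ.
have k0 : 0 < normc Q`_n.+1 / 2 by rewrite divr_gt0 // normc_gt0.
have [r H] := asymp_lower_bound k0 (asymp_horner sQ (@asymp_id R)).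
exists (Num.max r (Num.max 1 (B / (normc Q`_n.+1 / 2)))) => w wB; rewrite leNgt; apply/negP.
rewrite !gt_max => /and3P[/H h w1 wb].
have wn : normc w <= normc w ^+ n.+1.
  by rewrite exprS ler_peMr ?normc_ge0 // exprn_ege1 // ltW.
move: wb; rewrite ltr_pdivrMr // => wb.
have : normc w * (normc Q`_n.+1 / 2) <= normc w ^+ n.+1 * (normc Q`_n.+1 / 2) by rewrite ler_pM2r.
by have := le_trans h wB; lra.
Qed.

End ZeroCounting.

(** * The factorization of [F] through the Walsh map *)

Section WalshPolynomial.
Variable R : realType.
Local Notation C := R[i].
Variables (Omega : set C) (ro : C -> C) (d1 : R) (P : {poly C}) (n : nat).
Hypothesis Oclosed : closed Omega.
Hypothesis Obounded : exists M : R, forall x, Omega x -> normc x <= M.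
Hypothesis n0 : (0 < n)%N.
Hypothesis sP : size P = n.+1.
Hypothesis d1_gt0 : 0 < d1.
Hypothesis rod : forall x, ~ Omega x -> cdiff ro x.
Hypothesis ro1 : forall x, ~ Omega x -> 1 < normc (ro x).
Hypothesis ro_closed : forall e : R, 0 < e ->
  closed [set x | ~ Omega x /\ expR e <= normc (ro x)].
Hypothesis roasymp : asymp ro d1%:C 1.
Hypothesis ro_winding : forall (x : R -> C) (omega : C) (t : R), (forall t, ccont x t) ->
  x 0 = x 1 -> (forall t, 0 <= t <= 1 -> ~ Omega (x t)) -> Omega omega ->
  winding (fun t => x t - omega) t -> winding (fun t => ro (x t)) t.

Let E := [set z : C | Omega P.[z]].
Let F z := ro P.[z].

Variables (l : nat) (E_ : 'I_l -> set C).
Hypothesis E_enum : enumerates_components E E_.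

Variables (a : 'I_l -> C) (m : 'I_l -> R) (c : R) (phi : C -> C).
Let L := lemniscatic_set a m c.
Hypothesis m_gt0 : forall j, 0 < m j.
Hypothesis m_sum : \sum_j m j = 1.
Hypothesis c_ge0 : 0 <= c.
Hypothesis phid : forall z, ~ E z -> cdiff phi z.
Hypothesis phi_near : exists M r : R, forall z, r < normc z -> normc (phi z - z) <= M / normc z.
Hypothesis phi_out : forall z, ~ E z -> ~ L (phi z).
Hypothesis phi_closed : forall B : set C, closed B -> B `<=` ~` L ->
  closed [set z | ~ E z /\ B (phi z)].
Hypothesis phi_labels : forall (G : set C) (j : 'I_l), jordan_curve G -> G `<=` ~` E ->
  surrounds_only G E_ j ->
  surrounds_only (phi @` G) (fun k => connected_component L (a k)) j.

Local Notation pn := (P`_n).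
Local Notation alpha := (d1%:C * P`_n).

Lemma near_id_asymp (psi : C -> C) :
  (exists M r : R, forall z, r < normc z -> normc (psi z - z) <= M / normc z) -> asymp psi 1 1.
Proof.
move=> [M [r H]] e e0; exists (Num.max r (Num.max 1 (`|M| / e))) => z.
rewrite !gt_max => /and3P[/H h z1 zM]; rewrite mul1r expr1; apply: le_trans h _.
have z0 : 0 < normc z by lra.
rewrite ler_pdivrMr //; move: zM; rewrite ltr_pdivrMr // => zM.
have : normc z * e <= e * normc z * normc z by rewrite [normc z * e]mulrC ler_peMr // ?ltW // mulr_gt0.
by have := ler_norm M; lra.
Qed.

Let phi_asymp : asymp phi 1 1 := near_id_asymp phi_near.

Lemma pn_neq0 : pn != 0.
Proof. by rewrite -[n]/(n.+1.-1) -sP -/(lead_coef P) lead_coef_eq0 -size_poly_eq0 sP. Qed.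

Lemma alpha_neq0 : alpha != 0.
Proof. by rewrite mulf_neq0 ?pn_neq0 // -normc_gt0 normcR normr_gt0 gt_eqF. Qed.

Lemma F_asymp : asymp F alpha n.
Proof. exact: asymp_comp pn_neq0 n0 roasymp (asymp_horner sP (@asymp_id R)). Qed.

Lemma preimage_closed (A : set C) : closed A -> closed [set z | A P.[z]].
Proof.
move=> cA; apply: closed_normc => z Hz; apply: contrapT => Az.
have [d d0 Hd] := ccont_preimage (cdiff_continuous (cdiff_horner P z)) (open_nearc (closed_openC cA) Az).
by have [w Aw wz] := Hz d d0; exact: (Hd w wz).
Qed.

Lemma E_closed' : closed E. Proof. exact: preimage_closed. Qed.

Lemma E_bounded : exists2 r : R, 0 <= r & forall z, E z -> normc z <= r.
Proof.
have [M HM] := Obounded; have sP' : size P = n.-1.+2 by rewrite prednK.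
have [r Hr] := polynomial_bounded_preimage M sP'.
exists (Num.max 0 r) => [|z /HM/Hr h]; first by rewrite le_max lexx.
by rewrite le_max h orbT.
Qed.

Let Fd z : ~ E z -> cdiff F z.
Proof. by move=> Ez; apply: cdiff_comp; [exact: cdiff_horner | exact: rod]. Qed.

Let F1 z : ~ E z -> 1 < normc (F z).
Proof. exact: ro1. Qed.

Let Fclosed (e : R) : 0 < e -> closed [set z | ~ E z /\ expR e <= normc (F z)].
Proof. by move=> /ro_closed/preimage_closed. Qed.

Let E_ex : exists z, ~ E z.
Proof.
have [r r0 Er] := E_bounded; exists (r + 1)%:C => /Er.
rewrite normcR ger0_norm ?addr_ge0 //.
by apply/negP; rewrite -ltNge ltrDl.
Qed.

Lemma components_compact j : compact (E_ j).
Proof.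
have [_ rE] := E_enum; have [r _ Er] := E_bounded.
have [x Ex jE] : [set connected_component E x | x in E] (E_ j) by rewrite -rE; exists j.
apply: (@closed_bounded_compact _ _ r); rewrite -jE.
  by apply: component_closed; exact: E_closed'.
by move=> z /connected_component_sub /Er.
Qed.

Lemma components_connected j : connected (E_ j).
Proof.
have [_ rE] := E_enum.
have [x Ex <-] : [set connected_component E x | x in E] (E_ j) by rewrite -rE; exists j.
exact: component_connected.
Qed.

Lemma components_n0 j : E_ j !=set0.
Proof.
have [_ rE] := E_enum.
have [x Ex <-] : [set connected_component E x | x in E] (E_ j) by rewrite -rE; exists j.
by exists x; exact: connected_component_refl.
Qed.

Lemma components_cover z : E z <-> exists j, E_ j z.
Proof.
have [_ rE] := E_enum; split=> [Ez|[j Ej]].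
  have [j _ jE] : range E_ (connected_component E z) by rewrite rE; exists z.
  by exists j; rewrite jE; exact: connected_component_refl.
have [x Ex jE] : [set connected_component E x | x in E] (E_ j) by rewrite -rE; exists j.
by move: Ej; rewrite -jE; exact: connected_component_sub.
Qed.

Lemma components_disj j k z : E_ j z -> E_ k z -> j = k.
Proof.
have [injE rE] := E_enum => jz kz; apply: injE => //; rewrite ?inE //.
have [x Ex jE] : [set connected_component E x | x in E] (E_ j) by rewrite -rE; exists j.
have [y Ey kE] : [set connected_component E x | x in E] (E_ k) by rewrite -rE; exists k.
by rewrite -jE -kE in jz kz *; rewrite (same_connected_component jz) (same_connected_component kz).
Qed.

Definition zeros (omega : C) : seq C := sval (closed_field_poly_normal (P - omega%:P)).

Lemma lead_shift omega : lead_coef (P - omega%:P) = pn.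
Proof.
rewrite lead_coefDl ?lead_coefE ?sP // size_polyN.
by apply: leq_ltn_trans (size_polyC_leq1 _) _; rewrite ltnS.
Qed.

Lemma zerosE omega : P - omega%:P = pn *: \prod_(x <- zeros omega) ('X - x%:P).
Proof. by rewrite -[pn](lead_shift omega); exact: (svalP (closed_field_poly_normal (P - omega%:P))). Qed.

Lemma size_zeros omega : size (zeros omega) = n.
Proof.
have : size (P - omega%:P) = n.+1.
  rewrite size_polyDl // size_polyN sP.
  by apply: leq_ltn_trans (size_polyC_leq1 _) _; rewrite ltnS.
by rewrite zerosE size_scale ?pn_neq0 // size_prod_XsubC => -[].
Qed.

Lemma mem_zeros omega z : z \in zeros omega <-> P.[z] = omega.
Proof.
have E0 : (P - omega%:P).[z] = P.[z] - omega by rewrite hornerD hornerN hornerC.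
have : (z \in zeros omega) = root (P - omega%:P) z.
  by rewrite zerosE rootZ ?pn_neq0 // root_prod_XsubC.
by rewrite /root E0 subr_eq0 => ->; split => /eqP.
Qed.

Definition component_degree omega j := count (fun x => x \in E_ j) (zeros omega).

Lemma count_zeros_degree omega j : count_zeros (P - omega%:P) (E_ j) = component_degree omega j.
Proof. exact: count_zerosE pn_neq0 (zerosE omega). Qed.

Lemma sum_degree omega : Omega omega -> (\sum_(j < l) component_degree omega j)%N = n.
Proof.
move=> Oo; rewrite /component_degree sum_count_partition ?size_zeros //.
  by move=> j k z; exact: components_disj.
by move=> z /mem_zeros Pz; apply/components_cover; rewrite /E /= Pz.
Qed.

(** The polygon runs clockwise, so each zero in [E_ j] contributes [- 2 pi]. The number of zeros
    does not depend on [omega] because the other side of [key], which comes from the image curve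
    alone, does not. *)
Lemma degree_winding j : exists N : nat, (forall omega, Omega omega -> component_degree omega j = N) /\
  n%:R * m j <= N%:R.
Proof.
have [r r0 Er] := E_bounded.
have [g [[gc g01 jg gE gs] [win wout]]] := separating_curve E_closed' r0 Er
  components_compact components_connected components_n0 components_cover components_disj
  (exterior_clopen E_closed' Fd F1 Fclosed) j.
have gE' t : 0 <= t <= 1 -> ~ E (g t) by move=> t01; apply: gE; exists t => //; rewrite /= in_itv.
pose tpi : R := pi *+ 2; have tpi0 : 0 < tpi by rewrite pmulrn_lgt0 // pi_gt0.
have wF omega : Omega omega -> winding (fun t => F (g t)) ((component_degree omega j)%:R * - tpi).
  move=> Oo; apply: (ro_winding (omega := omega) (x := fun t => P.[g t])) => //.
  - by move=> t; exact: ccont_comp (gc t) (cdiff_continuous (cdiff_horner P _)).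
  - by rewrite g01.
  pose X x : R := if x \in E_ j then - tpi else 0.
  have wX x : x \in zeros omega -> winding (fun t => g t - x) (X x).
    move=> /mem_zeros Px; have /components_cover[k Ek] : E x by rewrite /E /= Px.
    rewrite /X; case: ifP => [|/negP]; rewrite ?inE => xj; first exact: win.
    by apply: (wout k) => //; apply/eqP => kj; apply: xj; rewrite -kj.
  have -> : (component_degree omega j)%:R * - tpi = 0 + \sum_(x <- zeros omega) X x.
    rewrite add0r /X -big_mkcond /= big_const_seq iter_addr_0 mulr_natl /component_degree.
    by congr (_ *+ _); apply: eq_count => x /=.
  have wp : winding (fun t => pn * \prod_(x <- zeros omega) (g t - x)) (0 + \sum_(x <- zeros omega) X x).
    apply: windingM (winding_cst pn_neq0) _.
    elim: (zeros omega) wX => [|x s IH] wX.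
      by rewrite big_nil; apply: eq_winding (winding_cst (oner_neq0 _)) => t _; rewrite big_nil.
    rewrite big_cons; apply: (@eq_winding _ (fun t => (g t - x) * \prod_(y <- s) (g t - y))).
      by move=> t _; rewrite big_cons.
    apply: windingM; first by apply: wX; exact: mem_head.
    by apply: IH => y ys; apply: wX; rewrite inE ys orbT.
  apply: eq_winding wp => t _.
  have : (P - omega%:P).[g t] = P.[g t] - omega by rewrite hornerD hornerN hornerC.
  rewrite zerosE hornerZ horner_prod => <-; congr (_ * _).
  by apply: eq_bigr => x _; rewrite hornerXsubC.
pose f (i : unit + 'I_l) : C -> C := if i is inr k then fun z => phi z - a k else F.
pose beta (i : unit + 'I_l) : R := if i is inr k then - (n%:R * m k) else 1.
have phic t : 0 <= t <= 1 -> ccont (fun t => phi (g t)) t.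
  by move=> /gE' Et; exact: ccont_comp (gc t) (cdiff_continuous (phid Et)).
(* [phi] is continuous only off [E], and [g] is known to stay there only on the unit interval;
   clamping gives a globally continuous closed curve. *)
pose h t := phi (g (clamp01 t)).
have hc t : ccont h t.
  have [] := phic _ (clamp01_itv t); split.
  exact: (cvg_comp (@clamp01 R) (fun t => phi (g t)) (@clamp01_continuous R t)).
have h01 : h 0 = h 1 by rewrite /h !clamp01_id ?lexx ?ler01 // g01.
have hE t : 0 <= t <= 1 -> h t = phi (g t) by move=> t01; rewrite /h clamp01_id.
have imE : h @` `[0, 1] = phi @` (g @` `[0, 1]).
  apply/seteqP; split=> [_ [t + <-]|_ [_ [t + <-] <-]]; rewrite /= in_itv /= => t01.
    by rewrite hE //; exists (g t) => //; exists t => //; rewrite /= in_itv.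
  by exists t; [rewrite /= in_itv | rewrite hE].
have hL t : ~ L (h t) by apply: phi_out; exact: gE' (clamp01_itv t).
have aL k : L (a k).
  by rewrite /L /lemniscatic_set /= (bigD1 k) //= subrr normc0 powR0 ?gt_eqF // mul0r.
have wk k : k != j -> winding (fun t => h t - a k) 0.
  move=> kj; have := phi_labels jg gE gs k; rewrite -imE => -[+ _] => sub.
  (* The label only denies that all of [L_k] is inside. One outside point suffices, since [L_k] is
     connected and off the curve. *)
  have [w [Lw nw]] : exists w, connected_component L (a k) w /\ ~ jordan_interior (h @` `[0, 1]) w.
    apply: contrapT => H; move/eqP: kj; apply; apply: sub => w Lw.
    by apply: contrapT => nw; apply: H; exists w.
  have Gw w' : connected_component L (a k) w' -> ~ (h @` `[0, 1]) w'.
    by move=> /connected_component_sub Lw' [t _ e]; apply: (hL t); rewrite e.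
  have w0 : winding (fun t => h t - w) 0.
    by apply: (winding_outside hc h01 (Gw w Lw)) => bd; apply: nw; split => //; exact: Gw.
  apply: (@winding_connected R h (connected_component L (a k)) w (a k) 0 hc h01
    (@component_connected _ L (a k)) _ Lw _ w0).
    by move=> w' /Gw nG t t01; apply/eqP => e; apply: nG; exists t => //; rewrite /= in_itv.
  exact: connected_component_refl.
have ha k t : h t - a k != 0 by exact: (@lemniscatic_neq R l a m c m_gt0 c_ge0 (h t) k (hL t)).
have [y wy] : exists y, winding (fun t => h t - a j) y.
  by apply: winding_ex => [t|t _]; [exact: ccontB (hc t) (ccont_cst t _) | exact: ha].
have h01' : h 0 - a j = h 1 - a j by rewrite h01.
have [s ys] := winding_integer h01' (ha j 0) wy.
have logc z : (~` E) z -> logsum beta f z = - (n%:R * ln c).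
  move=> Ez; rewrite -(green_function E_closed' Fd F1 Fclosed n0 alpha_neq0 F_asymp m_gt0 m_sum
    c_ge0 phid phi_asymp phi_out phi_closed E_ex Ez).
  rewrite /logsum big_sumType /= big_const card_unit /= addr0 mul1r; congr (_ + _).
  by rewrite /logU mulr_sumr -sumrN; apply: eq_bigr => k _; rewrite mulrA mulNr.
have key omega : Omega omega -> (component_degree omega j)%:R = - (n%:R * m j * s%:~R).
  move=> Oo.
  pose xs (i : unit + 'I_l) : R := if i is inr k then (if k == j then y else 0)
    else (component_degree omega j)%:R * - tpi.
  have fdd z : (~` E) z -> forall i, cdiff (f i) z.
    by move=> Ez [[]|k]; [exact: Fd | apply: cdiffB; [exact: phid | exact: cdiff_cst]].
  have f0 z : (~` E) z -> forall i, f i z != 0.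
    move=> Ez [[]|k]; first exact: (@F_neq0 R E F F1 z Ez).
    exact: (@phi_neq R E l a m c phi m_gt0 c_ge0 phi_out z k Ez).
  have wxs i : winding (fun t => f i (g t)) (xs i).
    case: i => [[]|k] /=; first exact: wF.
    have : winding (fun t => h t - a k) (if k == j then y else 0).
      by have [->//|/wk] := eqVneq k j.
    by apply: eq_winding => t t01; rewrite hE.
  have := winding_logsum (closed_openC E_closed') fdd f0 logc gc gE' wxs.
  rewrite big_sumType /= big_const card_unit /= addr0 mul1r (bigD1 j) //= eqxx big1 ?addr0.
    rewrite ys -/tpi => H; apply/(mulIf (lt0r_neq0 tpi0)); lra.
  by move=> k /negbTE ->; rewrite mulr0.
have [z0 Ez0] := components_n0 j.
have Oz0 : Omega P.[z0] by apply: (iffRL (components_cover z0)); exists j.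
exists (component_degree P.[z0] j); split.
  by move=> omega Oo; apply/eqP; rewrite -(eqr_nat R) key // key.
(* [z0] itself is a zero of [P - P.[z0]] in [E_ j]; by [key], positivity forces the integer [s] to
   be at most -1. *)
have pos : (0 < component_degree P.[z0] j)%N.
  by rewrite -has_count; apply/hasP; exists z0; [apply/mem_zeros | rewrite inE].
have nm : 0 < n%:R * m j by rewrite mulr_gt0 // ltr0n.
have sneg : s%:~R <= -1 :> R.
  have : 0 < (component_degree P.[z0] j)%:R :> R by rewrite ltr0n.
  rewrite key // oppr_gt0 pmulr_rlt0 // ltrz0 => s0.
  by rewrite -[-1]/((-1)%:~R) ler_int; lia.
by rewrite key // -mulrN ler_peMr ?(ltW nm) // lerNr.
Qed.

Lemma degreeE j omega : Omega omega -> (component_degree omega j)%:R = n%:R * m j.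
Proof.
move=> Oo; have [N HN] := choice degree_winding.
have le k : 0 <= (component_degree omega k)%:R - n%:R * m k.
  by have [/(_ omega Oo) -> ?] := HN k; rewrite subr_ge0.
have : \sum_(k < l) ((component_degree omega k)%:R - n%:R * m k) = 0.
  by rewrite sumrB -natr_sum sum_degree // -mulr_sumr m_sum mulr1 subrr.
move=> /psumr_eq0P => /(_ (fun k _ => le k) j isT) /eqP.
by rewrite subr_eq0 => /eqP.
Qed.

Variable omega0 : C.
Hypothesis Oomega0 : Omega omega0.

Let N j := component_degree omega0 j.

Definition walsh_poly : {poly C} := (d1%:C * pn) *: \prod_(j < l) ('X - (a j)%:P) ^+ N j.
Local Notation Q := walsh_poly.

(** The roots of [Q] listed with multiplicity, so that size and subleading coefficient come from the
    product of linear factors over a list. *)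
Definition centers := flatten [seq nseq (N j) (a j) | j <- index_enum 'I_l].

Lemma centers_prod : \prod_(j < l) ('X - (a j)%:P) ^+ N j = \prod_(x <- centers) ('X - x%:P).
Proof.
rewrite /centers big_flatten big_map; apply: eq_bigr => j _.
by rewrite big_nseq -Monoid.iteropE.
Qed.

Lemma size_centers : size centers = n.
Proof.
rewrite /centers size_flatten /shape -map_comp sumnE big_map.
by rewrite -(sum_degree Oomega0); apply: eq_bigr => j _; rewrite /= size_nseq.
Qed.

Lemma sum_centers : \sum_(x <- centers) x = \sum_(j < l) (N j)%:R * a j.
Proof.
rewrite /centers big_flatten big_map; apply: eq_bigr => j _.
by rewrite big_nseq iter_addr_0 mulr_natl.
Qed.

Lemma size_walsh_poly : size Q = n.+1.
Proof.
by rewrite /walsh_poly size_scale ?alpha_neq0 // centers_prod size_prod_XsubC size_centers.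
Qed.

Lemma lead_walsh_poly : Q`_n = alpha.
Proof.
have -> : Q`_n = lead_coef Q by rewrite lead_coefE size_walsh_poly.
rewrite /walsh_poly lead_coefZ centers_prod.
by rewrite (monicP (monic_prod_XsubC _ _ _)) mulr1.
Qed.

Lemma subleading_walsh_poly : Q`_n.-1 = - (alpha * \sum_(j < l) (N j)%:R * a j).
Proof.
have := @coefPn_prod_XsubC _ centers; rewrite size_centers sum_centers -lt0n => /(_ n0) E0.
by rewrite /walsh_poly coefZ centers_prod E0 mulrN.
Qed.

Lemma horner_walsh_poly w : Q.[w] = alpha * \prod_(j < l) (w - a j) ^+ N j.
Proof.
rewrite /walsh_poly hornerZ horner_prod; congr (_ * _); apply: eq_bigr => j _.
by rewrite horner_exp hornerXsubC.
Qed.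

Definition walsh_ratio z := Q.[phi z] / F z.
Local Notation ratio := walsh_ratio.

Let phi_neq' z j : ~ E z -> phi z - a j != 0.
Proof. exact: (@phi_neq R E l a m c phi m_gt0 c_ge0 phi_out z j). Qed.

Let F_neq z : ~ E z -> F z != 0.
Proof. exact: (@F_neq0 R E F F1 z). Qed.

Lemma walsh_poly_neq0 z : ~ E z -> Q.[phi z] != 0.
Proof.
move=> Ez; rewrite horner_walsh_poly mulf_neq0 ?alpha_neq0 //; apply/prodf_neq0 => j _.
by rewrite expf_neq0 // phi_neq'.
Qed.

Lemma ratio_cdiff z : ~ E z -> cdiff ratio z.
Proof.
move=> Ez; apply: cdiffM; first by apply: cdiff_comp; [exact: phid | exact: cdiff_horner].
by apply: cdiffV; [exact: Fd | exact: F_neq].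
Qed.

Lemma lnc_ratio z : ~ E z -> lnc (ratio z) = lnc alpha + n%:R * ln c.
Proof.
move=> Ez; rewrite (lncM (walsh_poly_neq0 Ez) (invr_neq0 (F_neq Ez))) (lncV (F_neq Ez)).
have := green_function E_closed' Fd F1 Fclosed n0 alpha_neq0 F_asymp m_gt0 m_sum
    c_ge0 phid phi_asymp phi_out phi_closed E_ex Ez.
rewrite horner_walsh_poly lncM ?alpha_neq0 //; last first.
  by apply/prodf_neq0 => j _; rewrite expf_neq0 // phi_neq'.
rewrite lnc_prod => [|j]; last by rewrite expf_neq0 // phi_neq'.
rewrite (eq_bigr (fun j => n%:R * (m j * lnc (phi z - a j)))) => [|j _]; last first.
  by rewrite lncX ?phi_neq' // degreeE // mulrA.
by rewrite -mulr_sumr -/(logU a m (phi z)); lra.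
Qed.

Lemma ratio_neq0 z : ~ E z -> ratio z != 0.
Proof. by move=> Ez; rewrite mulf_neq0 ?invr_eq0 ?F_neq ?walsh_poly_neq0. Qed.

(** A one-term [logsum]: constant modulus forces a locally constant argument. *)
Lemma ratio_locally_constant z : ~ E z -> nearc z (fun w => ratio w = ratio z).
Proof.
move=> Ez.
have logE w : (~` E) w -> logsum (fun _ : unit => 1) (fun _ : unit => ratio) w = lnc alpha + n%:R * ln c.
  by move=> Ew; rewrite /logsum big_const card_unit /= addr0 mul1r lnc_ratio.
have H := @logsum_cst_Arg R unit (fun=> 1) (fun=> ratio) (~` E) (closed_openC E_closed')
  (fun w Ew _ => ratio_cdiff Ew) (fun w Ew _ => ratio_neq0 Ew) _ logE z Ez.
have oE : nearc z (~` E) by apply: open_nearc => //; exact: closed_openC E_closed'.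
apply: nearcS2 H oE => w [/(_ tt) re]; rewrite big_const card_unit /= addr0 mul1r => arg Ew.
have [rw0 rz0] := (ratio_neq0 Ew, invr_neq0 (ratio_neq0 Ez)).
have n1 : normc (ratio w / ratio z) = 1.
  apply: ln_inj; rewrite ?posrE ?normc_gt0 ?(mulf_neq0 rw0 rz0) //.
  rewrite -/(lnc _) (lncM rw0 rz0) (lncV (ratio_neq0 Ez)).
  by rewrite !lnc_ratio // subrr ln1.
have := ArgP re; rewrite n1 arg cis0 mulr1 => /(canRL (divfK (ratio_neq0 Ez))) ->.
by rewrite mul1r.
Qed.

(** The ray from [z] to infinity stays off [E], so the locally constant ratio has on it the limit
    value 1 dictated by the equal leading terms of [Q.[phi z]] and [F]. *)
Lemma ratio_far : exists r : R, forall z, r < normc z -> ratio z = 1.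
Proof.
have [r r0 Er] := E_bounded; exists r => z rz.
have Ez : ~ E z by move=> /Er; apply/negP; rewrite -ltNge.
pose B := [set t%:C * z | t in (`[1, +oo[%classic : set R)].
have zB t : 1 <= t -> normc z <= normc (t%:C * z).
  by move=> t1; rewrite normcM normcR ger0_norm ?ler_peMl ?normc_ge0 //; lra.
have EB w : B w -> ~ E w.
  move=> [t]; rewrite /= in_itv andbT => /= t1 <- /Er; apply/negP; rewrite -ltNge.
  exact: lt_le_trans rz (zB t t1).
pose U := [set w | ~ E w /\ ratio w = ratio z].
pose V := [set w | ~ E w /\ ratio w <> ratio z].
have BU : B `<=` U.
  have oE w : ~ E w -> nearc w (~` E) by move=> Ew; apply: open_nearc => //; exact: closed_openC E_closed'.
  apply: (connected_open_split (V := V) (@ray_connected R z)).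
  - apply: open_nearcP => w [Ew ew]; apply: nearcS2 (ratio_locally_constant Ew) (oE w Ew).
    by move=> w' e Ew'; split => //; rewrite e.
  - apply: open_nearcP => w [Ew ew]; apply: nearcS2 (ratio_locally_constant Ew) (oE w Ew).
    by move=> w' e Ew'; split => //; rewrite e.
  - by move=> w Bw; have := EB w Bw; have [e|e] := pselect (ratio w = ratio z); [left | right].
  - by apply/seteqP; split => w // [[_ e] [_]].
  - by exists z; split => //; exists 1; rewrite ?mul1r //= in_itv /= lexx.
apply/eqP; rewrite -subr_eq0 -normc_eq0; apply/eqP/le_anti; rewrite normc_ge0 andbT.
apply/ler_addgt0Pr => e e0; rewrite add0r.
have Qasymp := asymp_horner size_walsh_poly phi_asymp; rewrite lead_walsh_poly in Qasymp.
have [s Hs] := asymp_ratio alpha_neq0 Qasymp F_asymp e0.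
pose t := Num.max 0 s / normc z + 1.
have z0 : 0 < normc z by exact: le_lt_trans rz.
have s0 : 0 <= Num.max 0 s / normc z by rewrite divr_ge0 ?normc_ge0 // le_max lexx.
have t1 : 1 <= t by rewrite /t lerDr.
have Bt : B (t%:C * z) by exists t => //; rewrite /= in_itv /= andbT.
have [_ <-] := BU _ Bt; apply: Hs; rewrite normcM normcR ger0_norm; last lra.
rewrite /t mulrDl divfK ?gt_eqF // mul1r.
by apply: (@le_lt_trans _ _ (Num.max 0 s)); [rewrite le_max lexx orbT | rewrite ltrDl].
Qed.

Lemma walsh_factorization z : ~ E z -> Q.[phi z] = F z.
Proof.
move=> Ez; have [r Hr] := ratio_far.
have v1 : ratio z - 1 = 0.
  apply: (exterior_vanish E_closed' Fd F1 Fclosed (g := fun w => ratio w - 1)) => //.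
  - by move=> w Ew; apply: cdiffB; [exact: ratio_cdiff | exact: cdiff_cst].
  - by exists r => w _ /Hr ->; rewrite subrr.
  exists (expR (lnc alpha + n%:R * ln c) + 1) => w Ew.
  apply: le_trans (normcB _ _) _; rewrite normc1 lerD2r -(lnc_ratio Ew) /lnc lnK //.
  by rewrite posrE normc_gt0 ratio_neq0.
by move/eqP: v1; rewrite subr_eq0 => /eqP e; rewrite -[LHS](divfK (F_neq Ez)) -/(ratio z) e mul1r.
Qed.

(** [Q.[psi z] - Q.[phi z]] is [psi z - phi z] times a divided difference without zeros near
    infinity, so both maps agree there; [exterior_vanish] does the rest. *)
Lemma walsh_unique (psi : C -> C) : (forall z, ~ E z -> cdiff psi z) ->
  (exists M r : R, forall z, r < normc z -> normc (psi z - z) <= M / normc z) ->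
  (forall z, ~ E z -> Q.[psi z] = F z) -> forall z, ~ E z -> psi z = phi z.
Proof.
move=> psid /near_id_asymp psi_asymp Qpsi z Ez.
have sQ : size Q = n.-1.+2 by rewrite size_walsh_poly prednK.
have [q qa qE] := asymp_horner_quotient sQ psi_asymp phi_asymp.
have q0 : n.-1.+1%:R * Q`_n.-1.+1 != 0.
  by rewrite prednK // lead_walsh_poly mulf_neq0 ?alpha_neq0 // pnatr_eq0 -lt0n.
have [r1 H1] := asymp_neq0 q0 qa; have [r r0 Er] := E_bounded.
pose r2 := Num.max r r1.
have zero w : ~ E w -> r2 < normc w -> psi w - phi w = 0.
  move=> Ew; rewrite gt_max => /andP[_ /H1 qw].
  have := qE w; rewrite Qpsi // walsh_factorization // subrr => /esym/eqP.
  by rewrite mulf_eq0 (negbTE qw) orbF => /eqP.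
apply/eqP; rewrite -subr_eq0; apply/eqP.
apply: (exterior_vanish E_closed' Fd F1 Fclosed (g := fun w => psi w - phi w)) Ez.
- by move=> w Ew; apply: cdiffB; [exact: psid | exact: phid].
- by exists r2.
(* Boundedness: inside the disc, [|F|] is either below [expR 1] or taken on the compact set [T].
   Since preimages of bounded sets under [Q] are bounded, this bounds [psi] and [phi]. *)
pose T := [set w | ~ E w /\ expR 1 <= normc (F w)] `&` [set w | normc w <= r2].
have cT : compact T.
  apply: (@closed_bounded_compact _ _ r2); last by move=> w [].
  apply: closedI; first by apply: Fclosed.
  exact: closed_rcont_le (@rcont_abs_normc R).
have [B HB] : exists B : R, forall w, (F @` T) w -> normc w <= B.
  apply: compact_bounded_normc; apply: continuous_compact => //.
  apply: continuous_in_subspaceT => w; rewrite inE => -[[Ew _] _].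
  by have [] := cdiff_continuous (Fd Ew).
have FB w : ~ E w -> normc w <= r2 -> normc (F w) <= Num.max B (expR 1).
  move=> Ew wr; rewrite le_max; have [h|/ltW ->] := leP (expR 1) (normc (F w)); last by rewrite orbT.
  by rewrite HB //; exists w.
have [M HM] := polynomial_bounded_preimage (Num.max B (expR 1)) sQ.
exists (Num.max 0 (M + M)) => w Ew; rewrite le_max.
have [wr|/(zero w Ew) ->] := leP (normc w) r2; last by rewrite normc0 lexx.
apply/orP; right; apply: le_trans (normcB _ _) _.
by apply: lerD; apply: HM; rewrite ?Qpsi ?walsh_factorization //; exact: FB.
Qed.

Hypothesis ro_expansion : exists K r : R, forall x, r < normc x -> normc (ro x - d1%:C * x) <= K.

(** [Q.[phi z] - Q.[z]] is [O(1/z)] times [O(z^(n-1))], and [F - d1 P] is bounded. For [n >= 2] both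
    are [O(z^(n-2))], so [Q] and [d1 P] have the same coefficient at [z^(n-1)]. *)
Lemma walsh_centers_sum : (2 <= n)%N -> \sum_(j < l) (N j)%:R * a j = - (P`_n.-1 / P`_n).
Proof.
move=> n2; have sQ : size Q = n.-1.+2 by rewrite size_walsh_poly prednK.
have [q qa qE] := asymp_horner_quotient sQ phi_asymp (@asymp_id R).
have [r1 H1] := asymp_bound ltr01 qa; set K1 := (_ + 1) in H1.
have [M [r2 H2]] := phi_near; have [K [r3 H3]] := ro_expansion.
have [r r0 Er] := E_bounded.
have sP' : size P = n.-1.+2 by rewrite prednK.
have [r4 H4] := polynomial_bounded_preimage r3 sP'.
pose T := Q - d1%:C *: P.
have sT : (size T <= n.-2.+1)%N.
  apply: (@asymp_poly_size _ _ _ (`|M| * K1 + `|K|)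
    (Num.max (Num.max r (Num.max r1 r2)) (Num.max r4 1))) => z.
  rewrite !gt_max => /andP[/andP[rz /andP[/H1 h1 /H2 h2]] /andP[r4z z1]].
  have Ez : ~ E z by move=> /Er; apply/negP; rewrite -ltNge.
  have /H3 h3 : r3 < normc P.[z].
    by rewrite ltNge; apply/negP => /H4; apply/negP; rewrite -ltNge.
  have z0 : 0 < normc z by lra.
  have K10 : 0 <= K1 by rewrite addr_ge0 ?normc_ge0.
  have -> : T.[z] = - (Q.[phi z] - Q.[z]) + (F z - d1%:C * P.[z]).
    rewrite /T hornerD hornerN [(_ *: P).[z]]hornerZ -(walsh_factorization Ez).
    by move: (d1%:C * P.[z]) (Q.[z]) (Q.[phi z]) => y q1 q2; ring.
  apply: le_trans (normcD _ _) _; rewrite normcNE mulrDl; apply: lerD; last first.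
    apply: le_trans h3 (le_trans (ler_norm K) _).
    by rewrite ler_peMr // exprn_ege1 // (ltW z1).
  rewrite qE normcM.
  have hM : normc (phi z - z) <= `|M| / normc z.
    by apply: le_trans h2 _; rewrite ler_pM2r ?invr_gt0 // ler_norm.
  apply: le_trans (ler_pM (normc_ge0 _) (normc_ge0 _) hM h1) _.
  have -> : n.-1 = n.-2.+1 by move: n2; case: (n) => [|[|]].
  rewrite exprS /=.
  have -> : `|M| / normc z * (K1 * (normc z * normc z ^+ n.-2)) = `|M| * K1 * normc z ^+ n.-2.
    by field; rewrite gt_eqF.
  by [].
have T0 : T`_n.-1 = 0.
  by rewrite nth_default //; apply: leq_trans sT _; move: n2; case: (n) => [|[|]].
have d10 : d1%:C != 0 by rewrite -normc_gt0 normcR normr_gt0 gt_eqF.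
move: T0; rewrite /T coefB [(_ *: P)`_ _]coefZ subleading_walsh_poly => /eqP.
rewrite subr_eq0 -mulrA -mulrN => /eqP/(mulfI d10) <-.
by rewrite mulNr opprK mulrAC divff ?pn_neq0 // mul1r.
Qed.

End WalshPolynomial.

(** * From the plane to the sphere *)

Section SphereMaps.
Variable R : realType.
Local Notation C := R[i].

Lemma nbhs_infty (A : set (sphere R)) : nbhs (infty : sphere R) A ->
  exists r : R, forall z, r < normc z -> A (fin z).
Proof.
move=> [K [cK _] KA]; have [r Hr] := compact_bounded_normc cK.
exists r => z rz; apply: KA; left; exists z => //.
by move=> /Hr; apply/negP; rewrite -ltNge.
Qed.

Lemma infty_nbhs (A : set (sphere R)) (r : R) :
  (forall z, r < normc z -> A (fin z)) -> A infty -> nbhs (infty : sphere R) A.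
Proof.
move=> H Ai; exists [set z | normc z <= r].
  have cl : closed [set z : C | normc z <= r] by exact: closed_rcont_le (@rcont_abs_normc R).
  by split => //; exact: (closed_bounded_compact cl (M := r)).
move=> _ [[z /= zr <-]|->] //; apply: H.
by rewrite ltNge; apply/negP.
Qed.

Definition plane_part (f : sphere R -> sphere R) z : C := finite_part (f (fin z)).

Lemma sphere_compl_fin (K : set C) z : sphere_compl K (fin z) <-> ~ K z.
Proof. by split=> [H Kz|H [w Kw [e]]]; [apply: H; exists z | apply: H; rewrite -e]. Qed.

Lemma sphere_compl_infty (K : set C) : sphere_compl K infty.
Proof. by move=> []. Qed.

Lemma holomorphic_plane (f : sphere R -> sphere R) z w : holomorphic_at f (fin z) ->
  f (fin z) = fin w -> cdiff (plane_part f) z.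
Proof.
by move=> [_ d] e; apply: derivable_cdiff; move: d; rewrite e.
Qed.

Section Conformal.
Variables (K K' : set C) (f : sphere R -> sphere R) (alpha : C).
Hypothesis fconf : conformal (sphere_compl K) (sphere_compl K') f.
Hypothesis alpha0 : alpha != 0.
Hypothesis ffin : exists r : R, forall z, r < normc z -> f (fin z) = fin (plane_part f z).
Hypothesis fasymp : asymp (plane_part f) alpha 1.

(** A finite value would by continuity bound [f] near infinity, against its linear growth. *)
Lemma conformal_infty : f infty = infty.
Proof.
have [[fh _] _] : (holomorphic_at f infty) /\ True by split => //; apply: fconf.1; exact: sphere_compl_infty.
case e : (f infty) => [w0|//].
have nb : nbhs (f infty) [set x | exists2 w, x = fin w & normc (w - w0) < 1].
  rewrite e; change (nbhs w0 (fun z : C => exists2 w, Some z = fin w & normc (w - w0) < 1)).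
  by apply/nbhs_normc; exists 1 => // w ww; exists w.
have [r1 H1] := nbhs_infty (fh _ nb); have [r2 H2] := ffin.
have a0 : 0 < normc alpha / 2 by rewrite divr_gt0 // normc_gt0.
have [r3 H3] := asymp_lower_bound a0 fasymp.
pose t := Num.max 0 (Num.max (Num.max r1 r2) (Num.max r3 ((normc w0 + 1) / (normc alpha / 2)))) + 1.
have t0 : 0 <= t by rewrite addr_ge0 // le_max lexx.
have : Num.max 0 (Num.max (Num.max r1 r2) (Num.max r3 ((normc w0 + 1) / (normc alpha / 2)))) < normc (t%:C : C).
  by rewrite normcR ger0_norm // ltrDl.
rewrite !gt_max => /and3P[z0 /andP[/H1[w ew wb] /H2 h2] /andP[/H3 h3 zb]].
move: h3 zb; rewrite expr1 ltr_pdivrMr //.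
have -> : plane_part f t%:C = w by move: h2; rewrite ew => -[].
have := normcD (w - w0) w0; rewrite subrK => h4 h5 h6.
have : (normc alpha - normc alpha / 2) = normc alpha / 2 by field.
by move=> e1; exfalso; move: h5; rewrite e1 [_ * normc _]mulrC; lra.
Qed.

Lemma conformal_fin z : ~ K z -> f (fin z) = fin (plane_part f z).
Proof.
move=> Kz; rewrite /plane_part; case e : (f (fin z)) => [//|].
have [_ [_ finj _]] := fconf; have := finj (fin z) infty.
rewrite !inE => /(_ (iffRL (sphere_compl_fin K z) Kz) (@sphere_compl_infty K)).
by rewrite e conformal_infty => /(_ erefl).
Qed.

Lemma conformal_cdiff z : ~ K z -> cdiff (plane_part f) z.
Proof.
move=> Kz; apply: holomorphic_plane (conformal_fin Kz).
by apply: fconf.1; exact/sphere_compl_fin.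
Qed.

Lemma conformal_out z : ~ K z -> ~ K' (plane_part f z).
Proof.
move=> Kz; have [_ [ffun _ _]] := fconf.
have := ffun _ (iffRL (sphere_compl_fin K z) Kz).
by rewrite conformal_fin // => /sphere_compl_fin.
Qed.

Lemma conformal_closed (B : set C) : closed K -> (exists M : R, forall z, K z -> normc z <= M) ->
  closed B -> B `<=` ~` K' -> closed [set z | ~ K z /\ B (plane_part f z)].
Proof.
move=> cK bK; apply: (exterior_preimage_closed (alpha := alpha) cK bK conformal_cdiff) => //.
- move=> z w Kz Kw e; have [_ [_ finj _]] := fconf; have := finj (fin z) (fin w).
  rewrite !inE => /(_ (iffRL (sphere_compl_fin K z) Kz) (iffRL (sphere_compl_fin K w) Kw)).
  by rewrite !conformal_fin // e => /(_ erefl)[].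
- move=> y Ky; have [_ [_ _ fsurj]] := fconf.
  have [[z|] Kz e] := fsurj _ (iffRL (sphere_compl_fin K' y) Ky); last first.
    by move: e; rewrite conformal_infty.
  have Kz' : ~ K z by exact/sphere_compl_fin.
  by exists z => //; move: e; rewrite conformal_fin // => -[].
Qed.

End Conformal.

(** At one radius [rho] the terms are differences of convergent partial sums, hence bounded by some
    [B]. Beyond [2 rho] a geometric series of ratio 1/2 bounds the partial sums by [2 B], and the
    extra 1 is the distance of a partial sum to the limit. *)
Lemma laurent_bound (d : nat -> C) (w : C -> C) (r : R) :
  (forall z, r < normc z -> series (fun k => d k / z ^+ k) @ \oo --> w z) ->
  exists M s : R, forall z, s < normc z -> normc (w z) <= M.
Proof.
move=> H; pose rho := Num.max 0 r + 1.
have rho0 : 0 < rho by rewrite ltr_wpDl // le_max lexx.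
have rhoC : normc (rho%:C : C) = rho by rewrite normcR ger0_norm // ltW.
have rr : r < normc (rho%:C : C).
  by rewrite rhoC; apply: (@le_lt_trans _ _ (Num.max 0 r)); rewrite ?le_max ?lexx ?orbT ?ltrDl.
pose u k := d k / rho%:C ^+ k.
have [B B0 HB] : exists2 B : R, 0 <= B & forall k, normc (u k) <= B.
  have /cvg_normcP /(_ 1 ltr01) [N _ HN] := H _ rr.
  exists (\sum_(k < N) normc (u k) + 2); first by rewrite addr_ge0 ?sumr_ge0 // => k _; exact: normc_ge0.
  move=> k; have [kN|Nk] := ltnP k N.
    rewrite (bigD1 (Ordinal kN)) //= -addrA lerDl addr_ge0 // sumr_ge0 // => i _; exact: normc_ge0.
  have h1 : normc (series u k - w rho%:C) < 1 := HN k Nk.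
  have h2 : normc (series u k.+1 - w rho%:C) < 1 := HN k.+1 (leqW Nk).
  have uE : u k = series u k.+1 - series u k by rewrite !seriesEnat /= big_nat_recr //= addrAC subrr add0r.
  have := normc_triangle (w rho%:C) (series u k.+1) (series u k).
  rewrite -uE [normc (w _ - _)]normc_distC => h3.
  have S0 : 0 <= \sum_(i < N) normc (u i) by apply: sumr_ge0 => i _; exact: normc_ge0.
  lra.
exists (2 * B + 1), (2 * rho) => z rz.
have z0 : 0 < normc z by lra.
have rz' : r < normc z by apply: lt_trans rr _; rewrite rhoC; lra.
have sB N : normc (series (fun k => d k / z ^+ k) N) <= 2 * B * (1 - 2^-1 ^+ N).
  elim: N => [|N IH]; first by rewrite seriesEnat /= big_geq // normc0 expr0 subrr mulr0.
  rewrite seriesEnat /= big_nat_recr //=; apply: le_trans (normcD _ _) _.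
  have t1 : normc (d N / z ^+ N) <= B * 2^-1 ^+ N.
    have := HB N; rewrite /u !normc_div !normcX rhoC => h.
    have rN : 0 < rho ^+ N by exact: exprn_gt0.
    have h' : normc (d N) <= B * rho ^+ N by rewrite -ler_pdivrMr.
    rewrite ler_pdivrMr ?exprn_gt0 // -mulrA -exprMn; apply: le_trans h' _.
    by apply: ler_wpM2l => //; apply: lerXn2r; rewrite ?nnegrE; lra.
  have := IH; rewrite seriesEnat /= => IH'; rewrite exprS; lra.
have /cvg_normcP /(_ 1 ltr01) [N _ /(_ N (leqnn N))] := H _ rz'.
have := sB N; move: (series _ N) => S h1 h2.
have h3 := normc_triangle S (w z) 0.
have p0 : 0 <= 2^-1 ^+ N :> R by rewrite exprn_ge0.
have p1 : 0 <= B * 2^-1 ^+ N by exact: mulr_ge0.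
by move: h2 h3; rewrite !subr0 [normc (w z - S)]normc_distC /=; lra.
Qed.

(** * Transport of winding numbers by the exterior map *)

Section ExteriorWinding.
Variables (Omega : set C) (d1 : R) (ro : C -> C).
Hypothesis d10 : 0 < d1.
Hypothesis Osc : simply_connected_domain (sphere_compl Omega).
Hypothesis rod : forall x, ~ Omega x -> cdiff ro x.
Hypothesis ro_neq0 : forall x, ~ Omega x -> ro x != 0.
Hypothesis ro_asymp : asymp ro d1%:C 1.
Variable omega : C.
Hypothesis Oomega : Omega omega.

(* [ro x / (x - omega)] extends to a continuous function without zeros on the
   simply connected set [sphere_compl Omega], so that its argument does not change
   along a closed curve. *)
Definition exterior_ratio (x : sphere R) : C :=
  if x is Some z then ro z / (z - omega) else d1%:C.

Let d1C : d1%:C != 0 :> C.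
Proof. by rewrite -normc_gt0 normcR normr_gt0 gt_eqF. Qed.

Let omega_neq z : ~ Omega z -> z - omega != 0.
Proof. by move=> Oz; apply/eqP => /eqP; rewrite subr_eq0 => /eqP e; apply: Oz; rewrite e. Qed.

Lemma exterior_ratio_neq0 x : sphere_compl Omega x -> exterior_ratio x != 0.
Proof.
case: x => [z|_]; last exact: d1C.
move=> /sphere_compl_fin Oz /=; rewrite mulf_neq0 ?ro_neq0 // invr_eq0; exact: omega_neq.
Qed.

Lemma exterior_ratio_continuous x : sphere_compl Omega x -> {for x, continuous exterior_ratio}.
Proof.
case: x => [z|] Ox A.
  have Oz : ~ Omega z by exact/sphere_compl_fin.
  have [c] : ccont (fun w => ro w / (w - omega)) z.
    apply: cdiff_continuous; apply: cdiffM; first exact: rod.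
    by apply: cdiffV; [apply: cdiffB; [exact: cdiff_id | exact: cdiff_cst] | exact: omega_neq].
  by move=> /c.
move=> /nbhs_normc[e e0 He].
have ga : asymp (fun z => d1%:C * (z - omega)) d1%:C 1.
  have := asympD (@asymp_id R) (asymp_lt (ltn0Sn 0) (asymp_cst (- omega))).
  by rewrite addr0 => /(asympZ d1%:C); rewrite mulr1.
have e1 : 0 < e / (2 * d1) by rewrite divr_gt0 // mulr_gt0.
have [r H] := asymp_ratio d1C ro_asymp ga e1.
apply: (@infty_nbhs _ (Num.max r (normc omega))); last by apply: He; rewrite subrr normc0.
move=> z; rewrite gt_max => /andP[/H h zo]; apply: He => /=.
have zw : z - omega != 0.
  by apply/eqP => /eqP; rewrite subr_eq0 => /eqP e2; move: zo; rewrite e2 ltxx.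
rewrite (_ : _ - _ = d1%:C * (ro z / (d1%:C * (z - omega)) - 1)); last by field; rewrite d1C zw.
rewrite normcM normcR (gtr0_norm d10).
apply: (@le_lt_trans _ _ (d1 * (e / (2 * d1)))); first by rewrite ler_pM2l.
by rewrite (_ : d1 * _ = e / 2); [lra | field; rewrite gt_eqF].
Qed.

Lemma exterior_winding (x : R -> C) (t : R) : (forall s, ccont x s) -> x 0 = x 1 ->
  (forall s, 0 <= s <= 1 -> ~ Omega (x s)) ->
  winding (fun s => x s - omega) t -> winding (fun s => ro (x s)) t.
Proof.
move=> xc x01 xO wx.
have xO' s : 0 <= s <= 1 -> sphere_compl Omega (fin (x s)) by move=> /xO ?; exact/sphere_compl_fin.
have [_ _ _ Onull] := Osc.
have [H [Hc HO Ht Hs]] : null_homotopic_in (sphere_compl Omega) (fun s => fin (x s)).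
  apply: Onull; split; last by rewrite x01.
    apply: continuous_subspaceT => s; have [c] := xc s => A nA.
    exact: (c (fun z => A (fin z)) nA).
  by move=> _ [s + <-]; rewrite /= in_itv /=; exact: xO'.
(* Clamping extends the homotopy from the unit square to the plane, since [winding_null_homotopic]
   asks for global continuity. *)
pose cl (p : R * R) := (clamp01 p.1, clamp01 p.2).
pose sq : set (R * R) := `[0, 1]%classic `*` `[0, 1]%classic.
have clsq p : sq (cl p) by split; rewrite /= in_itv /= clamp01_itv.
have HOp p : sphere_compl Omega (H (cl p)) by apply: HO; exists (cl p); first exact: clsq.
have clc p : {for p, continuous cl}.
  have h1 : clamp01 q.1 @[q --> p] --> clamp01 p.1.
    exact: (cvg_comp (@fst R R) (@clamp01 R) cvg_fst (@clamp01_continuous R p.1)).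
  have h2 : clamp01 q.2 @[q --> p] --> clamp01 p.2.
    exact: (cvg_comp (@snd R R) (@clamp01 R) cvg_snd (@clamp01_continuous R p.2)).
  exact: (cvg_pair h1 h2).
have Hcl p : {for p, continuous (fun p => H (cl p))}.
  move=> A nA; have : within sq (nbhs (cl p)) [set q | A (H q)].
    by rewrite (nbhs_subspace_in (clsq p)); exact: (Hc (cl p) A nA).
  move=> nq; have nH := clc p _ nq.
  refine (@filterS _ (nbhs p) _ [set q | sq (cl q) -> A (H (cl q))] _ _ nH) => q; apply.
  exact: clsq.
pose K p := exterior_ratio (H (cl p)).
have Kc p : ccont K p.
  split; apply: (cvg_comp (fun p => H (cl p)) exterior_ratio (Hcl p)).
  exact: exterior_ratio_continuous.
have wr : winding (fun s => exterior_ratio (fin (x s))) 0.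
  apply: (winding_null_homotopic Kc).
  - by move=> s s' _ _; exact: exterior_ratio_neq0.
  - move=> s s01; rewrite /K /cl /= !clamp01_id ?lexx ?ler01 //.
    by have [-> ->] := Ht s s01.
  - move=> s s01; rewrite /K /cl /= !clamp01_id ?lexx ?ler01 //.
    by have [-> ->] := Hs s s01.
have := windingM wr wx; rewrite add0r; apply: eq_winding => s s01 /=.
by rewrite divfK // omega_neq //; exact: xO.
Qed.

End ExteriorWinding.

End SphereMaps.

Theorem theorem3p3 (R : realType)
    (Omega : set R[i]) (d1 : R) (RO : sphere R -> sphere R)
    (n : nat) (P : {poly R[i]})
    (l : nat) (E_ : 'I_l -> set R[i]) (a : 'I_l -> R[i]) (m : 'I_l -> R)
    (Phi : sphere R -> sphere R) :
  let E := [set z : R[i] | Omega P.[z]] in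
  compact Omega -> infinite_set Omega ->
  simply_connected_domain (sphere_compl Omega) ->
  is_exterior_riemann_map Omega d1 RO ->
  (1 <= n)%N -> size P = n.+1 ->
  enumerates_components E E_ ->
  is_walsh_map E E_ a m Phi ->
  exists n_ : 'I_l -> nat,
    (forall (j : 'I_l) (omega : R[i]), Omega omega ->
       count_zeros (P - omega%:P) (E_ j) = n_ j) /\
    let Q := (d1%:C * P`_n) *: \prod_(j < l) ('X - (a j)%:P) ^+ n_ j in
    (forall x, sphere_compl E x ->
       poly_sphere Q (Phi x) = RO (poly_sphere P x)) /\
    (forall Psi : sphere R -> sphere R,
       holomorphic_on (sphere_compl E) Psi -> normalized_at_infty Psi ->
       (forall x, sphere_compl E x ->
          poly_sphere Q (Psi x) = RO (poly_sphere P x)) ->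
       forall x, sphere_compl E x -> Psi x = Phi x) /\
    ((2 <= n)%N ->
       \sum_(j < l) (n_ j)%:R * a j = - (P`_n.-1 / P`_n)).
Proof.
move=> E cO iO Osc rRO n0 sP eE wPhi.
have [RO_conf d10 [d [r Hd]]] := rRO.
have [a_inj m_gt0 m_sum Phi_conf Phi_norm L_comp Phi_labels] := wPhi.
pose ro := plane_part RO; pose phi := plane_part Phi; pose c := log_capacity E.
have d1C : d1%:C != 0 :> R[i] by rewrite -normc_gt0 normcR normr_gt0 gt_eqF.
have RO_far z : r < normc z -> RO (fin z) = fin (ro z).
  by move=> /Hd[w e _]; rewrite /ro /plane_part e.
have [K [s Hs]] : exists K s : R, forall z, s < normc z -> normc (ro z - d1%:C * z) <= K.
  apply: (@laurent_bound R d (fun z => ro z - d1%:C * z) r) => z /Hd[w e].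
  by rewrite /ro /plane_part e.
have roasymp : asymp ro d1%:C 1.
  move=> e e0; exists (Num.max s (`|K| / e)) => z; rewrite gt_max => /andP[/Hs h zK].
  rewrite !expr1; apply: le_trans h (le_trans (ler_norm K) _).
  by rewrite mulrC -ler_pdivrMr // ltW.
have RO_ffin : exists r : R, forall z, r < normc z -> RO (fin z) = fin (plane_part RO z) by exists r.
have RO_infty := conformal_infty RO_conf d1C RO_ffin roasymp.
have RO_fin z : ~ Omega z -> RO (fin z) = fin (ro z) := conformal_fin RO_conf d1C RO_ffin roasymp (z := z).
have rod x : ~ Omega x -> cdiff ro x := conformal_cdiff RO_conf d1C RO_ffin roasymp (z := x).
have ro1 x : ~ Omega x -> 1 < normc (ro x).
  by move=> /(conformal_out RO_conf d1C RO_ffin roasymp) /negP; rewrite -ltNge.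
have Oclosed : closed Omega by exact: compact_closed (@C_hausdorff R) cO.
have Obounded := compact_bounded_normc cO.
have ro_closed (e : R) : 0 < e -> closed [set x | ~ Omega x /\ expR e <= normc (ro x)].
  move=> e0; apply: (conformal_closed RO_conf d1C RO_ffin roasymp (B := [set w | expR e <= normc w])) => //.
    rewrite (_ : [set _ | _] = [set w : R[i] | setT w /\ expR e <= normc w]).
      by apply: closed_rcont_ge; [exact: closedT | move=> w _; exact: rcont_abs_normc].
    by apply/seteqP; split => w //= [].
  move=> w /= ew; apply/negP; rewrite -ltNge; apply: lt_le_trans ew.
  by rewrite expR_gt1.
have ro_neq0 x : ~ Omega x -> ro x != 0 by move=> /ro1 h; rewrite -normc_gt0; lra.
have ro_winding (x : R -> R[i]) (omega : R[i]) (t : R) : (forall t, ccont x t) -> x 0 = x 1 ->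
    (forall t, 0 <= t <= 1 -> ~ Omega (x t)) -> Omega omega ->
    winding (fun t => x t - omega) t -> winding (fun t => ro (x t)) t.
  by move=> xc x01 xO Oo; exact: (exterior_winding d10 Osc rod ro_neq0 roasymp Oo xc x01 xO).
have [M [s' HM]] := Phi_norm.
have Phi_far z : s' < normc z -> Phi (fin z) = fin (phi z) /\ normc (phi z - z) <= M / normc z.
  by move=> /HM[w e h]; rewrite /phi /plane_part e.
have phi_near : exists M r : R, forall z, r < normc z -> normc (phi z - z) <= M / normc z.
  by exists M, s' => z /Phi_far[].
have Phi_ffin : exists r : R, forall z, r < normc z -> Phi (fin z) = fin (plane_part Phi z).
  by exists s' => z /Phi_far[].
have phiasymp : asymp phi 1 1 by exact: near_id_asymp.
have Phi_infty := conformal_infty Phi_conf (oner_neq0 _) Phi_ffin phiasymp.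
have Phi_fin z : ~ E z -> Phi (fin z) = fin (phi z) :=
  conformal_fin Phi_conf (oner_neq0 _) Phi_ffin phiasymp (z := z).
have phid z : ~ E z -> cdiff phi z := conformal_cdiff Phi_conf (oner_neq0 _) Phi_ffin phiasymp (z := z).
have phi_out z : ~ E z -> ~ lemniscatic_set a m c (phi z) :=
  conformal_out Phi_conf (oner_neq0 _) Phi_ffin phiasymp (z := z).
have c_ge0 : 0 <= c by rewrite /c /log_capacity fine_ge0 // expeR_ge0.
have Eclosed : closed E by exact: preimage_closed.
have Ebounded : exists M : R, forall z, E z -> normc z <= M.
  by have [r' _ Hr] := E_bounded Obounded n0 sP; exists r'.
have phi_closed (B : set R[i]) : closed B -> B `<=` ~` lemniscatic_set a m c ->
    closed [set z | ~ E z /\ B (phi z)].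
  exact: (conformal_closed Phi_conf (oner_neq0 _) Phi_ffin phiasymp).
have phi_labels (G : set R[i]) (j : 'I_l) : jordan_curve G -> G `<=` ~` E ->
    surrounds_only G E_ j ->
    surrounds_only (phi @` G) (fun k => connected_component (lemniscatic_set a m c) (a k)) j.
  move=> jG GE sG; have [_] := Phi_labels G j jG GE sG.
  rewrite (_ : plane_image Phi G = phi @` G) //; apply/seteqP; split=> w [z Gz e]; exists z => //.
    by move: e; rewrite Phi_fin => [[]|]; last exact: GE.
  by rewrite Phi_fin ?e //; exact: GE.
have [omega0 Oo0] : Omega !=set0.
  by apply/set0P/eqP => O0; apply: iO; rewrite O0; exact: finite_set0.
have degE j omega (Oo : Omega omega) := degreeE Oclosed Obounded n0 sP d10 rod ro1 ro_closed
  roasymp ro_winding eE m_gt0 m_sum c_ge0 phid phi_near phi_out phi_closed phi_labels j Oo.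
have Qphi := walsh_factorization Oclosed Obounded n0 sP d10 rod ro1 ro_closed
  roasymp ro_winding eE m_gt0 m_sum c_ge0 phid phi_near phi_out phi_closed phi_labels Oo0.
have Quniq := walsh_unique Oclosed Obounded n0 sP d10 rod ro1 ro_closed
  roasymp ro_winding eE m_gt0 m_sum c_ge0 phid phi_near phi_out phi_closed phi_labels Oo0.
have Qsum := walsh_centers_sum Oclosed Obounded n0 sP d10 rod ro1 ro_closed
  roasymp ro_winding eE m_gt0 m_sum c_ge0 phid phi_near phi_out phi_closed phi_labels Oo0
  (ex_intro _ K (ex_intro _ s Hs)).
have sQ := size_walsh_poly n0 sP d10 eE a Oo0.
exists (component_degree P E_ omega0); split.
  move=> j omega Oo; rewrite (count_zeros_degree n0 sP).
  by apply/eqP; rewrite -(eqr_nat R) (degE _ _ Oo) (degE _ _ Oo0).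
move=> Q; have sQ' : size Q = n.+1 := sQ.
have Q_infty : poly_sphere Q infty = infty by rewrite /= sQ' ltnS n0.
have P_infty : poly_sphere P infty = infty by rewrite /= sP ltnS n0.
split; last split => //.
  move=> [z|] Ez; last by rewrite Phi_infty Q_infty P_infty RO_infty.
  have Ez' : ~ E z by exact/sphere_compl_fin.
  by rewrite Phi_fin // -[poly_sphere P _]/(fin P.[z]) RO_fin // -[LHS]/(fin Q.[phi z]) Qphi.
move=> Psi Psi_hol Psi_norm QPsi.
(* [Q] sends infinity to infinity and [RO] is finite off [Omega], so the functional equation forces
   [Psi] to be finite off [E]. *)
have Psi_fin z : ~ E z -> Psi (fin z) = fin (plane_part Psi z).
  move=> Ez; rewrite /plane_part; case e : (Psi (fin z)) => [//|].
  have := QPsi (fin z) (iffRL (sphere_compl_fin E z) Ez).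
  by rewrite e Q_infty -[poly_sphere P _]/(fin P.[z]) RO_fin.
move=> [z|] Ez; last first.
  (* [Q] is finite at finite points, so the equation at infinity leaves only the value infinity for
     [Psi]. *)
  have := QPsi infty Ez; rewrite P_infty RO_infty Phi_infty.
  by case: (Psi infty).
have Ez' : ~ E z by exact/sphere_compl_fin.
rewrite -[Some z]/(fin z) Psi_fin // Phi_fin //; congr fin; apply: Quniq Ez'.
- move=> w Ew; apply: holomorphic_plane (Psi_fin w Ew).
  by apply: Psi_hol; exact/sphere_compl_fin.
- have [M2 [r2 H2]] := Psi_norm; exists M2, r2 => w /H2[v e h].
  by rewrite /plane_part e.
move=> w Ew; have := QPsi (fin w) (iffRL (sphere_compl_fin E w) Ew).
by rewrite Psi_fin // -[poly_sphere P _]/(fin P.[w]) RO_fin // => -[].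
Qed.
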